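(* Let $v_0\in X$ and $w_0=W(v_0)$ satisfy, for $s\in\mathbb R$, $$\nu Av_0(s)=P_Nf-P_NB(\varphi v_0(s)+w_0(s)),\qquad \frac{dw_0(s)}{ds}+\nu Aw_0(s)=h-Q_NB(\varphi v_0(s)+w_0(s)),$$ put $u_0=v_0+w_0$, and let $\sigma_0<\sigma_1$. Suppose that $|w_0(s)|$ is nondecreasing in $(\sigma_0,\sigma_1)$. Then: (i) $\nu\|u_0(s)\|^2\le|f|\,|u_0(s)|$ for all $s\in(\sigma_0,\sigma_1)$. (ii) If, in addition, $w_0(s)$ is nonzero for all $s\in(\sigma_0,\sigma_1)$, $\|w_0(s)\|^2/|w_0(s)|$ is nondecreasing on $(\sigma_0,\sigma_1)$, and for some $s_0\in(\sigma_0,\sigma_1)$ we have $\|u_0(s_0)\|^2/|u_0(s_0)|=|f|/\nu$, then $f$ is an eigenvector of $A$ for the eigenvalue $\lambda^0=\|u_0(s_0)\|^2/|u_0(s_0)|^2$, $\lambda^0>(N\kappa_0)^2$, and $f=Q_Nf$.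
   Context: Navier–Stokes setting: $\nu,L>0$, $\Omega=[0,L]^2$, $\kappa_0=2\pi/L$. $H$ is the closure in $L^2(\Omega)^2$ of the $\mathbb R^2$-valued $\Omega$-periodic trigonometric polynomials $\phi$ with $\nabla\cdot\phi=0$, $\int_\Omega\phi\,dx=0$; $(\cdot,\cdot)$ and $|\cdot|$ are the $L^2$ scalar product and norm. $A=-\Delta$ on $H$, $V=D(A^{1/2})$, $\|u\|=|A^{1/2}u|$. $B(u,v)=\mathcal P((u\cdot\nabla)v)$ with $\mathcal P$ the Helmholtz–Leray orthogonal projector of $L^2(\Omega)^2$ onto $H$ ($B$ extended by continuity where possible), and $B(u)=B(u,u)$. $f\in H$ is time-independent, $|f|>0$, $G=|f|/(\nu^2\kappa_0^2)$. $N$ is a positive integer, $P_N$ is the orthogonal projector of $H$ onto the span of the eigenvectors of $A$ with eigenvalue $\le(\kappa_0N)^2$, $Q_N=I-P_N$, $h=Q_Nf$. Constants: $c_A,c_B,c_L,c_T$ are fixed absolute constants such that, whenever the norms make sense, $|(B(w,u),v)|\le c_T\|w\|\|u\|(\ln\frac{e\|v\|}{\kappa_0|v|})^{1/2}|v|$; $|(B(w,u),v)|\le c_B\|w\|\|u\|(\ln\frac{e|Aw|}{\kappa_0\|w\|})^{1/2}|v|$; $|(B(w,u),v)|\le c_T\|w\|\|u\|(\ln\frac{e|Au|}{\kappa_0\|u\|})^{1/2}|v|$; $|(B(u,v),w)|\le c_L|u|^{1/2}\|u\|^{1/2}\|v\||w|^{1/2}\|w\|^{1/2}$; $|(B(u,v),w)|\le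 c_L|u|^{1/2}\|u\|^{1/2}\|v\|^{1/2}|Av|^{1/2}|w|$; $|(B(u,v),w)|\le c_A|u|^{1/2}|Au|^{1/2}\|v\||w|$; $|(B(u,v),w)|\le c_A|u|\|v\||w|^{1/2}|Aw|^{1/2}$; $\|u\|_\infty\le c_A|u|^{1/2}|Au|^{1/2}$; $|(B(u,v),w)|\le c_A|u|\|v\|^{1/2}|A^{3/2}v|^{1/2}|w|$. Standing assumptions: $N>3c_LG$ and $N>G(9+\beta(G,N))(c_A+c_L)$, where $\beta(G,N)=\dfrac{9c_TG(\ln eN)^{1/2}+|h|/|f|}{N-3c_LG}$. $X=C_b(\mathbb R,P_NH)$ is the space of bounded continuous functions of $s\in\mathbb R$ with norm $\|v\|_X=\sup_s\|v(s)\|$; $Y=C_b(\mathbb R,Q_NH)$ has norm $|w|_Y=\sup_s|w(s)|$. $\varphi:\mathbb R\to[0,1]$ is the continuous piecewise linear function equal to $1$ for $|\xi|\le2G$, $0$ for $|\xi|\ge3G$, and affine in between on each side; in equations $\varphi v$ means $s\mapsto\varphi(\|v(s)\|/(\nu\kappa_0))v(s)$. For $v\in X$, $W(v)\in Y$ denotes the unique weak solution $w$ on $\mathbb R$, bounded in the norm $\|\cdot\|$, of $\frac{dw}{ds}+\nu Aw+Q_NB(\varphi v+w)=h$. (The two equations in the claim express that $v_0$ is a stationary solution of the determining form $\frac{d}{dt}v+\nu Av+P_NB(\varphi v+W(v))=P_Nf$ in $X$.) *)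

(* Defs.v *)
From HB Require Import structures.
From mathcomp Require Import all_boot all_order all_algebra.
From mathcomp Require Import all_classical all_reals all_analysis.
Import Order.TTheory GRing.Theory Num.Theory.
Import numFieldNormedType.Exports.

Set Implicit Arguments.
Unset Strict Implicit.
Unset Printing Implicit Defensive.

Local Open Scope classical_set_scope.
Local Open Scope ring_scope.

(* An element of L^2(Omega)^2 is represented by a function on the whole plane,
   of which only the values on Omega = [0,L]^2 matter, and these only up to
   Lebesgue-a.e. equality (eqO below).  Values that are determined only up to
   eqO (A u, A^s u, P_N u, weak derivatives, P_N B(u)) are selected by xget;
   outside of the domain of the operator xget returns 0. *)

Notation vfield R := ((R * R)%type -> 'rV[R]_2).

Definition Omega (R : realType) (L : R) : set (R * R) :=
  `[0, L]%classic `*` `[0, L]%classic.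

Definition leb2 (R : realType) :=
  (@lebesgue_measure R \x @lebesgue_measure R)%E.

Definition kappa0 (R : realType) (L : R) : R := 2 * pi / L.

Definition eqO (R : realType) (L : R) (u v : vfield R) : Prop :=
  u = v %[ae @leb2 R in Omega L].

(* scalar L^2(Omega) *)
Definition L2s (R : realType) (L : R) (g : R * R -> R) : Prop :=
  (g \_ (Omega L) : R * R -> R) \in Lfun (@leb2 R) 2%:E.

Definition L2 (R : realType) (L : R) (u : vfield R) : Prop :=
  forall i : 'I_2, L2s L (fun x => u x 0 i).

Definition ip (R : realType) (L : R) (u v : vfield R) : R :=
  \sum_(i < 2) \int[@leb2 R]_(x in Omega L) (u x 0 i * v x 0 i).

Definition nrm (R : realType) (L : R) (u : vfield R) : R :=
  Num.sqrt (ip L u u).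

Definition supnrm (R : realType) (L : R) (u : vfield R) : \bar R :=
  'N[@leb2 R]_(+oo%E)[
    (fun x => (Num.sqrt (\sum_(i < 2) (u x 0 i) ^+ 2))%:E) \_ (Omega L)]%E.

(* Real Omega-periodic trigonometric polynomials; an entry ((k1, k2), (a, b))
   of the list contributes a cos(kappa0 k.x) + b sin(kappa0 k.x). *)
Definition trig_poly (R : realType) (L : R) (psi : R * R -> R) : Prop :=
  exists s : seq ((int * int) * (R * R)),
    forall x : R * R, psi x =
      \sum_(m <- s)
        (m.2.1 * cos (kappa0 L * (m.1.1%:~R * x.1 + m.1.2%:~R * x.2))
         + m.2.2 * sin (kappa0 L * (m.1.1%:~R * x.1 + m.1.2%:~R * x.2))).

Definition dir (R : realType) (i : 'I_2) : (R * R)%type :=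
  if i == 0 then (1, 0) else (0, 1).

Definition partial (R : realType) (i : 'I_2) (psi : R * R -> R) : R * R -> R :=
  fun x => 'D_(dir R i) psi x.

Definition divergence (R : realType) (phi : vfield R) : R * R -> R :=
  fun x => \sum_(i < 2) partial i (fun y => phi y 0 i) x.

Definition laplacian (R : realType) (phi : vfield R) : vfield R :=
  fun x => \row_j \sum_(i < 2) partial i (partial i (fun y => phi y 0 j)) x.

Definition sol_trig_poly (R : realType) (L : R) (phi : vfield R) : Prop :=
  [/\ forall i : 'I_2, trig_poly L (fun x => phi x 0 i),
      forall x, divergence phi x = 0 &
      forall i : 'I_2, \int[@leb2 R]_(x in Omega L) (phi x 0 i) = 0].

Definition H (R : realType) (L : R) : set (vfield R) :=
  [set u | L2 L u /\
    forall e : R, 0 < e -> exists2 phi, sol_trig_poly L phi & nrm L (u - phi) < e].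

(* A = - Laplacian on H, with domain {u in H | Laplacian u in H}: the Laplacian
   of the periodic field u is taken in the sense of distributions. *)
Definition is_A (R : realType) (L : R) (u g : vfield R) : Prop :=
  [/\ H L u, H L g &
      forall phi, sol_trig_poly L phi -> ip L g phi = ip L u (- laplacian phi)].

Definition domA (R : realType) (L : R) : set (vfield R) :=
  [set u | exists g, is_A L u g].

Definition A (R : realType) (L : R) (u : vfield R) : vfield R :=
  xget 0 [set g | is_A L u g].

Definition eigenvector (R : realType) (L lambda : R) (e : vfield R) : Prop :=
  [/\ H L e, nrm L e != 0 & is_A L e (lambda *: e)].

(* The powers of A are given by the spectral theorem (the resolvent of A is
   compact, and its eigenvectors span a dense subspace of H): A^s multiplies
   the component along an eigenvector by the s-th power of the eigenvalue. *)
Definition is_Apow (R : realType) (L s : R) (u g : vfield R) : Prop :=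
  [/\ H L u, H L g &
      forall lambda e, eigenvector L lambda e ->
        ip L g e = lambda `^ s * ip L u e].

Definition domApow (R : realType) (L s : R) : set (vfield R) :=
  [set u | exists g, is_Apow L s u g].

Definition Apow (R : realType) (L s : R) (u : vfield R) : vfield R :=
  xget 0 [set g | is_Apow L s u g].

Definition V (R : realType) (L : R) : set (vfield R) := domApow L 2^-1.

Definition Vnrm (R : realType) (L : R) (u : vfield R) : R :=
  nrm L (Apow L 2^-1 u).

Definition PNH (R : realType) (L : R) (N : nat) : set (vfield R) :=
  [set p | exists (n : nat) (c : 'I_n -> R) (e : 'I_n -> vfield R),
    (forall i, exists2 lambda, lambda <= (kappa0 L * N%:R) ^+ 2 &
       eigenvector L lambda (e i)) /\
    p = \sum_(i < n) c i *: e i].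

Definition PN (R : realType) (L : R) (N : nat) (u : vfield R) : vfield R :=
  xget 0 [set p | PNH L N p /\ forall q, PNH L N q -> ip L (u - p) q = 0].

Definition QN (R : realType) (L : R) (N : nat) (u : vfield R) : vfield R :=
  u - PN L N u.

Definition QNH (R : realType) (L : R) (N : nat) : set (vfield R) :=
  [set w | H L w /\ eqO L w (QN L N w)].

Definition is_weak_partial (R : realType) (L : R) (i : 'I_2)
    (psi g : R * R -> R) : Prop :=
  [/\ L2s L psi, L2s L g &
      forall chi, trig_poly L chi ->
        \int[@leb2 R]_(x in Omega L) (g x * chi x) =
        - \int[@leb2 R]_(x in Omega L) (psi x * partial i chi x)].

Definition weak_partial (R : realType) (L : R) (i : 'I_2)
    (psi : R * R -> R) : R * R -> R :=
  xget 0 [set g | is_weak_partial L i psi g].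

(* (u . nabla) v *)
Definition advection (R : realType) (L : R) (u v : vfield R) : vfield R :=
  fun x => \row_j \sum_(i < 2) u x 0 i * weak_partial L i (fun y => v y 0 j) x.

(* p = P g for the Helmholtz-Leray orthogonal projector P onto H *)
Definition is_leray (R : realType) (L : R) (g p : vfield R) : Prop :=
  H L p /\ forall q, H L q -> ip L p q = ip L g q.

(* Bform L u v w is (B(u,v), w), extended by continuity: for w in H the
   projector can be dropped from (P((u.nabla)v), w), as BformE shows, and the
   integral of ((u.nabla)v).w still converges, and depends continuously on
   u, v, w, where (u.nabla)v is not in L^2 (for instance for u, v, w in V). *)
Definition Bform (R : realType) (L : R) (u v w : vfield R) : R :=
  ip L (advection L u v) w.

Lemma BformE (R : realType) (L : R) (u v w p : vfield R) :
  is_leray L (advection L u v) p -> H L w -> ip L p w = Bform L u v w.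
Proof. by move=> [_]; apply. Qed.

(* P_N B(u) *)
Definition PNB (R : realType) (L : R) (N : nat) (u : vfield R) : vfield R :=
  xget 0 [set p | PNH L N p /\ forall q, PNH L N q -> ip L p q = Bform L u u q].

(* The logarithms are written only where their argument is defined. *)
Definition absolute_constants (R : realType) (cA cB cL cT : R) : Prop :=
  forall L : R, 0 < L ->
  [/\ [/\ forall w u v, V L w -> V L u -> V L v -> nrm L v != 0 ->
            `|Bform L w u v| <= cT * Vnrm L w * Vnrm L u *
              Num.sqrt (ln (expR 1 * Vnrm L v / (kappa0 L * nrm L v))) * nrm L v,
          forall w u v, domA L w -> V L u -> H L v -> Vnrm L w != 0 ->
            `|Bform L w u v| <= cB * Vnrm L w * Vnrm L u *
              Num.sqrt (ln (expR 1 * nrm L (A L w) / (kappa0 L * Vnrm L w))) *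
              nrm L v &
          forall w u v, V L w -> domA L u -> H L v -> Vnrm L u != 0 ->
            `|Bform L w u v| <= cT * Vnrm L w * Vnrm L u *
              Num.sqrt (ln (expR 1 * nrm L (A L u) / (kappa0 L * Vnrm L u))) *
              nrm L v],
      [/\ forall u v w, V L u -> V L v -> V L w ->
            `|Bform L u v w| <= cL * Num.sqrt (nrm L u) * Num.sqrt (Vnrm L u) *
              Vnrm L v * Num.sqrt (nrm L w) * Num.sqrt (Vnrm L w) &
          forall u v w, V L u -> domA L v -> H L w ->
            `|Bform L u v w| <= cL * Num.sqrt (nrm L u) * Num.sqrt (Vnrm L u) *
              Num.sqrt (Vnrm L v) * Num.sqrt (nrm L (A L v)) * nrm L w] &
      [/\ forall u v w, domA L u -> V L v -> H L w ->
            `|Bform L u v w| <= cA * Num.sqrt (nrm L u) *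
              Num.sqrt (nrm L (A L u)) * Vnrm L v * nrm L w,
          forall u v w, H L u -> V L v -> domA L w ->
            `|Bform L u v w| <= cA * nrm L u * Vnrm L v *
              Num.sqrt (nrm L w) * Num.sqrt (nrm L (A L w)),
          forall u, domA L u ->
            (supnrm L u <=
              (cA * Num.sqrt (nrm L u) * Num.sqrt (nrm L (A L u)))%:E)%E &
          forall u v w, H L u -> domApow L (3 / 2) v -> H L w ->
            `|Bform L u v w| <= cA * nrm L u * Num.sqrt (Vnrm L v) *
              Num.sqrt (nrm L (Apow L (3 / 2) v)) * nrm L w]].

Definition Grashof (R : realType) (nu L : R) (f : vfield R) : R :=
  nrm L f / (nu ^+ 2 * kappa0 L ^+ 2).

Definition beta (R : realType) (nu L cL cT : R) (N : nat) (f : vfield R) : R :=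
  let G := Grashof nu L f in
  (9 * cT * G * Num.sqrt (ln (expR 1 * N%:R)) + nrm L (QN L N f) / nrm L f) /
  (N%:R - 3 * cL * G).

(* X = C_b(R, P_N H) and Y = C_b(R, Q_N H) *)
Definition X (R : realType) (L : R) (N : nat) : set (R -> vfield R) :=
  [set v | [/\ forall s : R, PNH L N (v s),
               exists M, forall s : R, Vnrm L (v s) <= M &
               forall s : R, Vnrm L (v t - v s) @[t --> s] --> (0 : R)]].

Definition Y (R : realType) (L : R) (N : nat) : set (R -> vfield R) :=
  [set w | [/\ forall s : R, QNH L N (w s),
               exists M, forall s : R, nrm L (w s) <= M &
               forall s : R, nrm L (w t - w s) @[t --> s] --> (0 : R)]].

Definition cutoff (R : realType) (G xi : R) : R :=
  if `|xi| <= 2 * G then 1 else if 3 * G <= `|xi| then 0 else 3 - `|xi| / G.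

(* phi v *)
Definition trunc (R : realType) (nu L : R) (f : vfield R)
    (v : R -> vfield R) : R -> vfield R :=
  fun s => cutoff (Grashof nu L f) (Vnrm L (v s) / (nu * kappa0 L)) *: v s.

(* dw/ds + nu A w + Q_N B(phi v + w) = h on the real line in the weak sense:
   for every test element z of V in Q_N H, d/ds (w, z) + nu (A^(1/2) w, A^(1/2) z)
   + (B(phi v + w), z) = (h, z), integrated over bounded time intervals. *)
Definition weak_eq (R : realType) (nu L : R) (N : nat) (f : vfield R)
    (v w : R -> vfield R) : Prop :=
  forall z, V L z -> QNH L N z -> forall a b : R, a <= b ->
    ip L (w b) z - ip L (w a) z
    + \int[@lebesgue_measure R]_(s in `[a, b])
        (nu * ip L (Apow L 2^-1 (w s)) (Apow L 2^-1 z)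
         + Bform L (trunc nu L f v s + w s) (trunc nu L f v s + w s) z)
    = (b - a) * ip L (QN L N f) z.

(* w = W(v): w in Y is the weak solution that is bounded in the norm of V *)
Definition is_W (R : realType) (nu L : R) (N : nat) (f : vfield R)
    (v w : R -> vfield R) : Prop :=
  [/\ Y L N w,
      forall s, V L (w s),
      exists M, forall s : R, Vnrm L (w s) <= M &
      weak_eq nu L N f v w].

(* Main.v *)
Require Import Defs.
From mathcomp Require Import all_boot all_order all_algebra.
From mathcomp Require Import all_classical all_reals all_analysis.
From mathcomp Require Import measurable_realfun zify ring lra.
Import Order.TTheory GRing.Theory Num.Theory.
Import numFieldNormedType.Exports.

Set Implicit Arguments.
Unset Strict Implicit.
Unset Printing Implicit Defensive.

Local Open Scope classical_set_scope.
Local Open Scope ring_scope.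

(* In the orthonormal basis e_k of Stokes eigenfunctions both equations become
   scalar equations for the Fourier coefficients, the operators being replaced
   by sums over finitely many modes.  Put U = phi v0 + w0 and let u_M be the
   projection of u onto the modes |k| <= M.

   (i) Testing the equation for w0 with its projection, adding phi times the
   equation for v0 and letting M tend to infinity, B(U, U, U) = 0 makes
   (f, U) - nu (phi ||v0||^2 + ||w0||^2) the derivative of |w0|^2 / 2.  As |w0|
   is nondecreasing, nu (phi ||v0||^2 + ||w0||^2) <= (f, U) at each time.  This
   and the equation for v0 exclude ||v0|| > 2 G nu kappa0, so phi = 1 and
   U = u0.

   (ii) Equality in Cauchy-Schwarz gives f = c u0(s0).  The two monotonicity
   assumptions make ||w0||^2 nondecreasing, so just before s0 there are times
   where the derivative of ||P_M w0||^2 is almost nonnegative.  At such times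
   B(p, p, A p) = 0 for p = u_M gives nu |A u_M|^2 <= (f, A u_M) up to a small
   error, hence by Young's inequality 4 nu (u0, A p) <= |p + f|^2, now at s0, for
   each divergence-free trigonometric polynomial p.  No regularity of u0 beyond
   V is needed in this form.  As equality is attained in the limit p = c u_M,
   the first variation there yields nu A u0 = c u0. *)

(** The obstacle is regularity. In time [w0] is continuous only in the [L^2] norm, and it is merely
    bounded in V; so [||w0||^2] is not known to be even continuous, and [A u0] is not known to
    exist. Every differential identity is therefore written for finitely many modes, at the price of
    a tail [U - u_M]. In the energy balance the tail is bounded and tends to 0 at each time, which
    suffices under a time integral. In the enstrophy balance it is multiplied by [1 + |A u_M|^2],
    which may grow with M; the viscous term [nu |A u_M|^2] absorbs this, provided that the tail is
    small uniformly near [s0]. That uniformity is what the monotonicity of [||w0||^2] supplies. The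
    bound [3 c_L G < N] enters where the cutoff is removed: if [||v0|| > 2 G nu kappa0], the factor
    [1 / N] in the Poincare inequality for [w0] makes [phi v0] and [w0] so small that the nonlinear
    term cannot sustain a [v0] of that size. The weak derivatives inside B are selected by [xget],
    so their existence for fields in V has to be established, through the completeness of [L^2]. *)

Section ScalarL2.
Context (R : realType) (L : R).
Local Notation mu := (@leb2 R).
Local Notation D := (Omega L).

Lemma measurable_Omega : measurable D.
Proof. by apply: measurableX; exact: measurable_itv. Qed.
Local Hint Resolve measurable_Omega : core.

Lemma leb2_Omega : 0 < L -> mu D = (L ^+ 2)%:E.
Proof.
move=> L0; rewrite /leb2 /Omega product_measure1E //=.
by rewrite lebesgue_measure_itv /= lte_fin L0 /= sube0 expr2 EFinM.
Qed.

(** The definition speaks of the extension by zero and of a power norm; integrability of the square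
    over [Omega] is the form that domination arguments use. *)
Lemma L2sP (g : R * R -> R) :
  L2s L g <-> measurable_fun D g /\ mu.-integrable D (EFin \o (fun x => g x ^+ 2)).
Proof.
split.
- move=> Lg; have := Lfun2_integrable_sqr Lg.
  move: (Lg); rewrite /L2s inE => /andP[]; rewrite inE /= => mg _.
  have mg' : measurable_fun D g by apply/(measurable_restrictT _ measurable_Omega).
  move=> ig; split => //.
  apply: (iffRL (integrable_mkcond (mu := mu) _ measurable_Omega)).
  apply: eq_integrable ig => // x _ /=.
  by rewrite /patch; case: ifP => // _; rewrite expr0n.
- move=> [mg ig]; rewrite /L2s inE; apply/andP; split; rewrite inE /=.
    exact/(measurable_restrictT _ measurable_Omega).
  rewrite /finite_norm unlock /Lnorm poweR_lty //.
  have /integrableP[_] := ig.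
  move=> Ig; rewrite integral_mkcond in Ig; move: Ig.
  apply: le_lt_trans; rewrite le_eqVlt; apply/orP; left.
  apply/eqP; apply: eq_integral => x _ /=; rewrite /patch; case: ifP => _ /=.
    by rewrite powR_mulrn // -normrX.
  by rewrite normr0 powR0 //; apply/eqP => /eqP; rewrite pnatr_eq0.
Qed.

Lemma L2s_measurable g : L2s L g -> measurable_fun D g.
Proof. by move/L2sP => []. Qed.

(** The product is dominated by [f^2 + g^2]. *)
Lemma integrable_mul f g : L2s L f -> L2s L g ->
  mu.-integrable D (EFin \o (fun x => f x * g x)).
Proof.
move=> /L2sP[mf If] /L2sP[mg Ig].
apply: (@le_integrable _ _ _ mu _ measurable_Omega _
  (EFin \o (fun x => f x ^+ 2) \+ (EFin \o (fun x => g x ^+ 2)))).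
- by apply/measurable_EFinP; exact: measurable_funM.
- move=> x _ /=; rewrite lee_fin [leRHS]ger0_norm ?addr_ge0 ?sqr_ge0 //.
  rewrite normrM; move: (normr_ge0 (f x)) (normr_ge0 (g x)).
  rewrite -(real_normK (num_real (f x))) -(real_normK (num_real (g x))).
  by set a := `|f x|; set b := `|g x| => a0 b0; nra.
- exact: integrableD.
Qed.

Lemma L2sD f g : L2s L f -> L2s L g -> L2s L (f \+ g).
Proof.
move=> Lf Lg; have Ifg := integrable_mul Lf Lg.
move/L2sP : Lf => [mf If]; move/L2sP : Lg => [mg Ig].
apply/L2sP; split; first exact: measurable_funD.
have I1 : mu.-integrable D (fun x => (f x ^+ 2)%:E + (g x ^+ 2)%:E)%E.
  exact: integrableD.
have I2 : mu.-integrable D (fun x => 2%:E * (f x * g x)%:E)%E.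
  exact: integrableZl.
have : mu.-integrable D (fun x => ((f x ^+ 2)%:E + (g x ^+ 2)%:E)
    + 2%:E * (f x * g x)%:E)%E.
  exact: integrableD.
by apply: eq_integrable => // x _ /=; congr EFin; ring.
Qed.

Lemma L2sM (b f : R * R -> R) (C : R) : measurable_fun D b ->
  (forall x, `|b x| <= C) -> L2s L f -> L2s L (fun x => b x * f x).
Proof.
move=> mb bC /L2sP[mf If]; apply/L2sP; split; first exact: measurable_funM.
apply: (@le_integrable _ _ _ mu _ measurable_Omega _
  (fun x => (C ^+ 2)%:E * (f x ^+ 2)%:E)%E).
- by apply/measurable_EFinP; apply: measurable_funX; exact: measurable_funM.
- move=> x _ /=; rewrite lee_fin !normrX !normrM exprMn.
  rewrite -!expr2 ler_wpM2r ?sqr_ge0 // ler_sqr ?nnegrE ?normr_ge0 //.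
  by rewrite (le_trans (bC x)) ?ler_norm.
- exact: integrableZl.
Qed.

Lemma L2sZ (a : R) f : L2s L f -> L2s L (fun x => a * f x).
Proof. by apply: (@L2sM (cst a) f `|a|) => //=; exact: measurable_cst. Qed.

Lemma L2sN f : L2s L f -> L2s L (fun x => - f x).
Proof.
move=> /(@L2sZ (-1)); congr (L2s L _).
by apply/funext => x; rewrite mulN1r.
Qed.

Lemma L2sB f g : L2s L f -> L2s L g -> L2s L (fun x => f x - g x).
Proof. by move=> Lf /L2sN; exact: L2sD. Qed.

Lemma L2s_bounded (b : R * R -> R) (C : R) : 0 < L -> measurable_fun D b ->
  (forall x, `|b x| <= C) -> L2s L b.
Proof.
move=> L0 mb bC.
have L1 : L2s L (cst 1).
  apply/L2sP; split; first exact: measurable_cst.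
  have -> : EFin \o (fun x : R * R => cst 1 x ^+ 2) = EFin \o cst (1 : R).
    by apply/funext => x /=; rewrite expr1n.
  apply: measurable_bounded_integrable => //.
  - by rewrite [ltLHS](leb2_Omega L0) ltry.
  - by exists 1; split => // M M1 x _ /=; rewrite normr1 ltW.
have := L2sM mb bC L1; congr (L2s L _).
by apply/funext => x; rewrite mulr1.
Qed.

Lemma L2s_sum (I : Type) (s : seq I) (F : I -> R * R -> R) : 0 < L ->
  (forall i, L2s L (F i)) -> L2s L (fun x => \sum_(i <- s) F i x).
Proof.
move=> L0 LF; elim: s => [|i s IH].
  have -> : (fun x => \sum_(i <- [::]) F i x) = cst 0.
    by apply/funext => x; rewrite big_nil.
  apply: (@L2s_bounded _ 0 L0); [exact: measurable_cst|move=> x; rewrite normr0 //].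
have -> : (fun x => \sum_(j <- i :: s) F j x) = F i \+ (fun x => \sum_(i <- s) F i x).
  by apply/funext => x; rewrite big_cons.
exact: L2sD.
Qed.

Definition ips (f g : R * R -> R) : R := \int[mu]_(x in D) (f x * g x).

Lemma ipsC f g : ips f g = ips g f.
Proof. by rewrite /ips; apply: eq_Rintegral => x _; rewrite mulrC. Qed.

Lemma ipsDl f g h : L2s L f -> L2s L g -> L2s L h ->
  ips (fun x => f x + g x) h = ips f h + ips g h.
Proof.
move=> Lf Lg Lh; rewrite /ips -RintegralD//; try exact: integrable_mul.
by apply: eq_Rintegral => x _; rewrite mulrDl.
Qed.

Lemma ipsZl a f h : L2s L f -> L2s L h ->
  ips (fun x => a * f x) h = a * ips f h.
Proof.
move=> Lf Lh; rewrite /ips -RintegralZl//; last exact: integrable_mul.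
by apply: eq_Rintegral => x _; rewrite mulrA.
Qed.

Lemma ipsDr f g h : L2s L f -> L2s L g -> L2s L h ->
  ips h (fun x => f x + g x) = ips h f + ips h g.
Proof. by move=> Lf Lg Lh; rewrite !(ipsC h) ipsDl. Qed.

Lemma ipsZr a f h : L2s L f -> L2s L h ->
  ips h (fun x => a * f x) = a * ips h f.
Proof. by move=> Lf Lh; rewrite !(ipsC h) ipsZl. Qed.

Lemma ipsNl f h : L2s L f -> L2s L h -> ips (fun x => - f x) h = - ips f h.
Proof.
move=> Lf Lh; rewrite -mulN1r -ipsZl //; congr ips.
by apply/funext => x; rewrite mulN1r.
Qed.

Lemma ipsBl f g h : L2s L f -> L2s L g -> L2s L h ->
  ips (fun x => f x - g x) h = ips f h - ips g h.
Proof. by move=> Lf Lg Lh; rewrite ipsDl ?ipsNl//; exact: L2sN. Qed.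

Lemma ipsBr f g h : L2s L f -> L2s L g -> L2s L h ->
  ips h (fun x => f x - g x) = ips h f - ips h g.
Proof. by move=> Lf Lg Lh; rewrite !(ipsC h) ipsBl. Qed.

Lemma ips_suml (I : Type) (s : seq I) (F : I -> R * R -> R) h : 0 < L ->
  (forall i, L2s L (F i)) -> L2s L h ->
  ips (fun x => \sum_(i <- s) F i x) h = \sum_(i <- s) ips (F i) h.
Proof.
move=> L0 LF Lh; elim: s => [|i s IH].
  rewrite big_nil /ips; under eq_Rintegral do rewrite big_nil mul0r.
  by rewrite Rintegral_cst// mul0r.
rewrite big_cons -IH -ipsDl//; last exact: L2s_sum.
by rewrite /ips; apply: eq_Rintegral => x _; rewrite big_cons.
Qed.

Lemma ips_ge0 f : 0 <= ips f f.
Proof. by apply: Rintegral_ge0 => x _; rewrite -expr2 sqr_ge0. Qed.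

Lemma ae_leb2S (P Q : R * R -> Prop) : (forall x, P x -> Q x) ->
  (\forall x \ae mu, P x) -> (\forall x \ae mu, Q x).
Proof. exact: (@filterS _ _ (ae_filter_ringOfSetsType mu)). Qed.

Lemma ae_leb2S2 (P Q S : R * R -> Prop) : (forall x, P x -> Q x -> S x) ->
  (\forall x \ae mu, P x) -> (\forall x \ae mu, Q x) -> (\forall x \ae mu, S x).
Proof. exact: (@filterS2 _ _ (ae_filter_ringOfSetsType mu)). Qed.

Lemma ips_ae f g h : L2s L f -> L2s L g -> L2s L h ->
  f = g %[ae mu in D] -> ips f h = ips g h.
Proof.
move=> Lf Lg Lh fg; rewrite /ips /Rintegral; congr fine.
apply: ae_eq_integral => //.
- by apply/measurable_EFinP; apply: measurable_funM; exact: L2s_measurable.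
- by apply/measurable_EFinP; apply: measurable_funM; exact: L2s_measurable.
by apply: ae_leb2S fg => x fgx Dx /=; rewrite fgx.
Qed.

Lemma ips_eq0 f : L2s L f -> ips f f = 0 -> f = (fun=> 0) %[ae mu in D].
Proof.
move=> Lf f0; have If := integrable_mul Lf Lf.
have mf := L2s_measurable Lf.
have : (\int[mu]_(x in D) `|(f x * f x)%:E| = 0)%E.
  under eq_integral => x _ do rewrite gee0_abs ?lee_fin -?expr2 ?sqr_ge0//.
  have fin : (\int[mu]_(x in D) (f x * f x)%:E)%E \is a fin_num.
    by apply: integrable_fin_num.
  move: f0; rewrite /ips /Rintegral => /eqP; rewrite fine_eq0 //.
  move=> /eqP f0; rewrite -[RHS]f0; apply: eq_integral => x _.
  by rewrite expr2.
move=> H; have mf2 : measurable_fun D (EFin \o (fun x => f x * f x)).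
  by apply/measurable_EFinP; exact: measurable_funM.
have := (ae_eq_integral_abs mu measurable_Omega mf2).1 H.
apply: ae_leb2S => x fx Dx; have := fx Dx => /= -[] /eqP.
by rewrite mulf_eq0 orbb => /eqP.
Qed.

End ScalarL2.

(** Discriminant form of Cauchy-Schwarz, for semidefinite forms: the inner products below separate
    functions only up to null sets, so [c] may vanish. *)
Lemma quad_nonneg_disc (R : realFieldType) (a b c : R) : 0 <= c ->
  (forall t, 0 <= a + 2 * t * b + t ^+ 2 * c) -> b ^+ 2 <= a * c.
Proof.
move=> c0 H.
have [c0'|c0'|c0'] := ltgtP c 0; first by rewrite leNgt c0' in c0.
(* The minimiser of the quadratic. *)
- have := H (- b / c); have -> : a + 2 * (- b / c) * b + (- b / c) ^+ 2 * c = a - b ^+ 2 / c.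
    by field; rewrite gt_eqF.
  by rewrite subr_ge0 ler_pdivrMr.
- rewrite c0' mulr0; have [->|b0] := eqVneq b 0; first by rewrite expr0n.
  (* With [c = 0] the expression is affine in t, and at this t it equals -1. *)
  exfalso; have := H (- (a + 1) / (2 * b)); rewrite c0' mulr0 addr0.
  have -> : a + 2 * (- (a + 1) / (2 * b)) * b = -1 by field.
  by rewrite oppr_ge0 ler10.
Qed.

Lemma ips_abs_le (R : realType) (L : R) f g : L2s L f -> L2s L g ->
  `|ips L f g| <= Num.sqrt (ips L f f) * Num.sqrt (ips L g g).
Proof.
move=> Lf Lg; rewrite -sqrtrM ?ips_ge0 // -sqrtr_sqr ler_wsqrtr //.
apply: quad_nonneg_disc => [|t]; first exact: ips_ge0.
have Ltg := L2sZ t Lg.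
have := ips_ge0 L (fun x => f x + t * g x).
have Lftg : L2s L (fun x => f x + t * g x) by exact: L2sD.
rewrite ipsDl // !ipsDr // !ipsZl // !ipsZr // (ipsC _ g f).
by congr (0 <= _); ring.
Qed.

(** * The inner product on square-integrable vector fields *)

Section VectorL2.
Context (R : realType) (L : R) (hL : 0 < L).
Implicit Types u v w : vfield R.

Lemma ipE u v : ip L u v =
  \sum_(i < 2) ips L (fun x => u x 0 i) (fun x => v x 0 i).
Proof. by []. Qed.

Lemma L2D u v : L2 L u -> L2 L v -> L2 L (u + v).
Proof.
move=> Lu Lv i; have := L2sD (Lu i) (Lv i); congr (L2s L _).
by apply/funext => x /=; rewrite !mxE.
Qed.

Lemma L2Z a u : L2 L u -> L2 L (a *: u).
Proof.
move=> Lu i; have := L2sZ a (Lu i); congr (L2s L _).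
by apply/funext => x /=; rewrite !mxE.
Qed.

Lemma L2N u : L2 L u -> L2 L (- u).
Proof. by move=> /(L2Z (-1)); rewrite scaleN1r. Qed.

Lemma L2B u v : L2 L u -> L2 L v -> L2 L (u - v).
Proof. by move=> Lu /L2N; exact: L2D. Qed.

Lemma L20 : L2 L 0.
Proof.
move=> i; apply: (@L2s_bounded _ _ _ 0 hL); last by move=> x; rewrite mxE normr0.
have -> : (fun x => (0 : vfield R) x 0 i) = (fun=> 0) by apply/funext => x; rewrite mxE.
exact: measurable_cst.
Qed.

Lemma L2_sum (I : Type) (s : seq I) (F : I -> vfield R) :
  (forall i, L2 L (F i)) -> L2 L (\sum_(i <- s) F i).
Proof.
move=> LF; elim: s => [|i s IH]; first by rewrite big_nil; exact: L20.
by rewrite big_cons; exact: L2D.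
Qed.

Lemma ipC u v : ip L u v = ip L v u.
Proof. by rewrite !ipE; apply: eq_bigr => i _; rewrite ipsC. Qed.

Lemma ipDl u v w : L2 L u -> L2 L v -> L2 L w ->
  ip L (u + v) w = ip L u w + ip L v w.
Proof.
move=> Lu Lv Lw; rewrite !ipE -big_split /=; apply: eq_bigr => i _.
rewrite -ipsDl //; congr ips; by apply/funext => x; rewrite !mxE.
Qed.

Lemma ipZl a u w : L2 L u -> L2 L w -> ip L (a *: u) w = a * ip L u w.
Proof.
move=> Lu Lw; rewrite !ipE mulr_sumr; apply: eq_bigr => i _.
rewrite -ipsZl //; congr ips; by apply/funext => x; rewrite !mxE.
Qed.

Lemma ipDr u v w : L2 L u -> L2 L v -> L2 L w ->
  ip L w (u + v) = ip L w u + ip L w v.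
Proof. by move=> Lu Lv Lw; rewrite !(ipC w) ipDl. Qed.

Lemma ipZr a u w : L2 L u -> L2 L w -> ip L w (a *: u) = a * ip L w u.
Proof. by move=> Lu Lw; rewrite !(ipC w) ipZl. Qed.

Lemma ipNl u w : L2 L u -> L2 L w -> ip L (- u) w = - ip L u w.
Proof. by move=> Lu Lw; rewrite -scaleN1r ipZl // mulN1r. Qed.

Lemma ipNr u w : L2 L u -> L2 L w -> ip L w (- u) = - ip L w u.
Proof. by move=> Lu Lw; rewrite !(ipC w) ipNl. Qed.

Lemma ipBl u v w : L2 L u -> L2 L v -> L2 L w ->
  ip L (u - v) w = ip L u w - ip L v w.
Proof. by move=> Lu Lv Lw; rewrite ipDl ?ipNl//; exact: L2N. Qed.

Lemma ipBr u v w : L2 L u -> L2 L v -> L2 L w ->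
  ip L w (u - v) = ip L w u - ip L w v.
Proof. by move=> Lu Lv Lw; rewrite !(ipC w) ipBl. Qed.

Lemma ip0l w : L2 L w -> ip L 0 w = 0.
Proof. by move=> Lw; rewrite -(scale0r (0 : vfield R)) ipZl ?mul0r //; exact: L20. Qed.

Lemma ip_suml (I : Type) (s : seq I) (F : I -> vfield R) w :
  (forall i, L2 L (F i)) -> L2 L w ->
  ip L (\sum_(i <- s) F i) w = \sum_(i <- s) ip L (F i) w.
Proof.
move=> LF Lw; elim: s => [|i s IH]; first by rewrite !big_nil ip0l.
by rewrite !big_cons ipDl ?IH //; exact: L2_sum.
Qed.

Lemma ip_sumr (I : Type) (s : seq I) (F : I -> vfield R) w :
  (forall i, L2 L (F i)) -> L2 L w ->
  ip L w (\sum_(i <- s) F i) = \sum_(i <- s) ip L w (F i).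
Proof.
move=> LF Lw; rewrite ipC ip_suml //; apply: eq_bigr => i _; exact: ipC.
Qed.

Lemma ip_ge0 u : 0 <= ip L u u.
Proof. by rewrite ipE sumr_ge0 // => i _; exact: ips_ge0. Qed.

Lemma nrm_ge0 u : 0 <= nrm L u.
Proof. exact: sqrtr_ge0. Qed.

Lemma nrm_sqr u : nrm L u ^+ 2 = ip L u u.
Proof. by rewrite /nrm sqr_sqrtr // ip_ge0. Qed.

Lemma cauchy_schwarz u v : L2 L u -> L2 L v ->
  `|ip L u v| <= nrm L u * nrm L v.
Proof.
move=> Lu Lv; rewrite /nrm -sqrtrM ?ip_ge0 // -sqrtr_sqr ler_wsqrtr //.
apply: quad_nonneg_disc => [|t]; first exact: ip_ge0.
have Ltv := L2Z t Lv.
have := ip_ge0 (u + t *: v).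
have Lutv := L2D Lu Ltv.
rewrite ipDl // !ipDr // !ipZl // !ipZr // (ipC v u).
by congr (0 <= _); ring.
Qed.

Lemma cauchy_schwarz_le u v : L2 L u -> L2 L v ->
  ip L u v <= nrm L u * nrm L v.
Proof. by move=> Lu Lv; apply: le_trans (cauchy_schwarz Lu Lv); rewrite ler_norm. Qed.

Lemma nrmD_sqr u v : L2 L u -> L2 L v ->
  nrm L (u + v) ^+ 2 = nrm L u ^+ 2 + 2 * ip L u v + nrm L v ^+ 2.
Proof.
move=> Lu Lv; rewrite !nrm_sqr ipDl ?ipDr //; try exact: L2D.
by rewrite (ipC v u); ring.
Qed.

Lemma nrmZ a u : L2 L u -> nrm L (a *: u) = `|a| * nrm L u.
Proof.
move=> Lu; rewrite /nrm ipZl ?ipZr //; last exact: L2Z.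
by rewrite mulrA -expr2 sqrtrM ?sqr_ge0 // sqrtr_sqr.
Qed.

Lemma nrmN u : L2 L u -> nrm L (- u) = nrm L u.
Proof. by move=> Lu; rewrite -scaleN1r nrmZ // normrN1 mul1r. Qed.

Lemma nrmB_sqr u v : L2 L u -> L2 L v ->
  nrm L (u - v) ^+ 2 = nrm L u ^+ 2 - 2 * ip L u v + nrm L v ^+ 2.
Proof.
move=> Lu Lv; rewrite nrmD_sqr ?nrmN ?ipNr //; last exact: L2N.
by ring.
Qed.

Lemma nrmD_le u v : L2 L u -> L2 L v -> nrm L (u + v) <= nrm L u + nrm L v.
Proof.
move=> Lu Lv; rewrite -ler_sqr ?nnegrE ?addr_ge0 ?nrm_ge0 // nrmD_sqr //.
have := cauchy_schwarz_le Lu Lv; nra.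
Qed.

Lemma nrmBC u v : L2 L u -> L2 L v -> nrm L (u - v) = nrm L (v - u).
Proof. by move=> Lu Lv; rewrite -opprB nrmN //; exact: L2B. Qed.

Lemma nrm_dist_le u v : L2 L u -> L2 L v ->
  `|nrm L u - nrm L v| <= nrm L (u - v).
Proof.
move=> Lu Lv; rewrite ler_norml; apply/andP; split.
  have := nrmD_le (L2B Lv Lu) Lu; rewrite subrK (nrmBC Lv Lu); lra.
have := nrmD_le (L2B Lu Lv) Lv; rewrite subrK; lra.
Qed.

Lemma eqO_ip u v w : L2 L u -> L2 L v -> L2 L w -> eqO L u v ->
  ip L u w = ip L v w.
Proof.
move=> Lu Lv Lw uv; rewrite !ipE; apply: eq_bigr => i _.
by apply: ips_ae => //; apply: ae_leb2S uv => x h Dx; rewrite h.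
Qed.

Lemma nrm_eq0 u : L2 L u -> nrm L u = 0 -> eqO L u 0.
Proof.
move=> Lu u0; have : ip L u u = 0 by rewrite -nrm_sqr u0 expr0n.
rewrite ipE !big_ord_recl big_ord0 addr0 => /eqP.
rewrite paddr_eq0 ?ips_ge0 // => /andP[/eqP h0 /eqP h1].
apply: (ae_leb2S2 _ (ips_eq0 (Lu _) h0) (ips_eq0 (Lu _) h1)) => x e0 e1 Dx.
apply/matrixP => a b; rewrite !mxE (ord1 a).
have /orP[/eqP->|/eqP->] : (b == ord0) || (b == lift ord0 ord0).
  by case: b => [[|[|]]].
- exact: e0.
- exact: e1.
Qed.

Lemma nrmB_eq0 u v : L2 L u -> L2 L v -> nrm L (u - v) = 0 -> eqO L u v.
Proof.
move=> Lu Lv /(nrm_eq0 (L2B Lu Lv)); apply: ae_leb2S => x h Dx.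
by apply/eqP; rewrite -subr_eq0; apply/eqP; exact: h.
Qed.

End VectorL2.

(** * Hartley functions: derivatives, products and integrals *)

Section DeriveLine.
Context (R : realType).

(** A directional derivative sees only the restriction to a line, so the calculus on the plane
    reduces to one variable. *)
Lemma is_derive_line (V : normedModType R) (f : V -> R) (x v : V) (psi : R -> R) (d : R) :
  (forall h, f (h *: v + x) = psi h) -> is_derive (0 : R) 1 psi d ->
  is_derive x v f d.
Proof.
move=> fpsi [dpsi vpsi].
have E : (fun h : R => h^-1 *: ((f \o shift x) (h *: v) - f x)) =
         (fun h : R => h^-1 *: ((psi \o shift 0) (h *: 1) - psi 0)).
  apply/funext => h /=; congr (_ *: (_ - _)); first by rewrite fpsi addr0 [h *: 1]mulr1.
  by rewrite -[x in LHS]add0r -(scale0r v) fpsi.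
split; first by rewrite /derivable E.
by rewrite /derive E.
Qed.
End DeriveLine.

Section Periodic.
Context (R : realType).

Lemma periodic_int (f : R -> R) (T : R) : periodic f T ->
  forall (k : int) (a : R), f (a + T * k%:~R) = f a.
Proof.
move=> pf [n|n] a; first by rewrite mulr_natr periodicn.
rewrite NegzE mulrNz mulrN; have := periodicn pf n.+1 (a - T * n.+1%:R).
by rewrite -(mulr_natr T) subrK.
Qed.
End Periodic.

Section Cas.
Context (R : realType) (L : R).
Local Notation k0 := (kappa0 L).

Definition phase (k : int * int) (x : R * R) : R :=
  k0 * (k.1%:~R * x.1 + k.2%:~R * x.2).

(* The Hartley functions cas = cos + sin: like the complex exponentials they
   are indexed by the whole lattice, but they are real. *)
Definition cas (k : int * int) (x : R * R) : R :=
  cos (phase k x) + sin (phase k x).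

Definition kc (k : int * int) (i : 'I_2) : R := (if i == 0 then k.1 else k.2)%:~R.

Lemma casE k x : cas k x = cos (phase k x) + sin (phase k x). Proof. by []. Qed.

Lemma phaseN k x : phase (- k) x = - phase k x.
Proof. by rewrite /phase /= !mulrNz; ring. Qed.

Lemma casN k x : cas (- k) x = cos (phase k x) - sin (phase k x).
Proof. by rewrite /cas phaseN cosN sinN. Qed.

Lemma cas0 x : cas 0 x = 1.
Proof. by rewrite /cas /phase /= !mul0r addr0 mulr0 cos0 sin0 addr0. Qed.

Lemma phaseD k l x : phase (k + l) x = phase k x + phase l x.
Proof. by rewrite /phase /= !intrD; ring. Qed.

(** Both the closure of trigonometric polynomials under products and the orthogonality relations
    rest on this product formula. *)
Lemma casM k l x : cas k x * cas l x =
  2^-1 * cas (k - l) x + 2^-1 * cas (l - k) x + 2^-1 * cas (k + l) x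
  - 2^-1 * cas (- (k + l)) x.
Proof.
rewrite casN /cas -(opprB k l) !phaseN !phaseD !phaseN !cosN !sinN !cosD !sinD !cosN !sinN.
by field.
Qed.

Lemma cas_bound k x : `|cas k x| <= 2.
Proof.
rewrite (le_trans (ler_normD _ _)) // (_ : 2 = 1 + 1) //.
by rewrite lerD // ler_norml ?cos_le1 ?cos_geN1 ?sin_le1 ?sin_geN1.
Qed.

Lemma measurable_cas k : measurable_fun setT (cas k).
Proof.
have mp : measurable_fun setT (phase k).
  apply: measurable_funM; first exact: measurable_cst.
  apply: measurable_funD; apply: measurable_funM; try exact: measurable_cst.
    exact: measurable_fst.
  exact: measurable_snd.
apply: measurable_funD.
  apply: (measurableT_comp _ mp); apply: continuous_measurable_fun; exact: continuous_cos.
apply: (measurableT_comp _ mp); apply: continuous_measurable_fun; exact: continuous_sin.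
Qed.

(** Since [(cos + sin)' = cos - sin], differentiation sends [cas k] to a multiple of [cas (- k)],
    and a second derivative leads back to [cas k] with a negative factor. *)
Lemma is_derive_cas k i x :
  is_derive x (dir R i) (cas k) (k0 * kc k i * cas (- k) x).
Proof.
pose c := k0 * kc k i; pose t := phase k x.
apply: (@is_derive_line _ _ _ _ _ (fun h => cos (c * h + t) + sin (c * h + t))).
  move=> h; rewrite /cas; have -> // : phase k (h *: dir R i + x) = c * h + t.
  rewrite /phase /dir /kc /c /t /phase /kc /=; case: ifP => _ /=;
  by rewrite /GRing.scale /=; ring.
have h1 : is_derive (0 : R) 1 (fun h : R => c * h + t) c.
  apply: is_derive_eq; by rewrite addr0 [_ *: _]mulr1.
have h2 := @is_derive1_comp R cos (fun h => c * h + t) 0 _ c (is_derive_cos (c * 0 + t)) h1.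
have h3 := @is_derive1_comp R sin (fun h => c * h + t) 0 _ c (is_derive_sin (c * 0 + t)) h1.
have h4 := is_deriveD h2 h3.
have -> : k0 * kc k i * cas (- k) x =
  - sin (c * 0 + t) * c + cos (c * 0 + t) * c; last exact: h4.
by rewrite casN mulr0 add0r /t /c; ring.
Qed.

End Cas.

Section CasIntegral.
Context (R : realType) (L : R) (hL : 0 < L).
Local Notation mu := (@leb2 R).
Local Notation D := (Omega L).
Local Notation k0 := (kappa0 L).
Local Notation leb := (@lebesgue_measure R).

Lemma kappa0_gt0 : 0 < k0.
Proof. by rewrite /kappa0 divr_gt0 // mulr_gt0 // pi_gt0. Qed.

Lemma integrable_Omega_bounded (f : R * R -> R) (C : R) :
  measurable_fun D f -> (forall x, `|f x| <= C) ->
  mu.-integrable D (EFin \o f).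
Proof.
move=> mf fC; have := integrable_mul (L2s_bounded hL mf fC)
  (@L2s_bounded R L (fun=> 1) 1 hL (@measurable_cst _ _ _ _ _ _) (fun=> _)).
move=> /(_ (fun _ => _)) => H.
apply: (@eq_integrable _ _ _ mu _ (measurable_Omega L) (EFin \o (fun x => f x * 1))).
  by move=> x _ /=; rewrite mulr1.
by apply: H; rewrite normr1.
Qed.

(** Fubini with the second variable integrated first; the next lemma starts with the first variable.
    A nonzero frequency may have a single nonzero component, and the corresponding variable has to
    be integrated first. *)
Lemma Omega_integral0_snd (f : R * R -> R) (C : R) :
  measurable_fun D f -> (forall x, `|f x| <= C) ->
  (forall x, (\int[leb]_(y in `[0%R, L]) (f (x, y))%:E)%E = 0%E) ->
  \int[mu]_(x in D) f x = 0.
Proof.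
move=> mf fC f0; have If := integrable_Omega_bounded mf fC.
rewrite /Rintegral integral_mkcond.
have If' := (integrable_mkcond (mu := mu) (EFin \o f) (measurable_Omega L)).1 If.
rewrite -(integral12_prod_meas1 If') /fubini_F /= integral0_eq // => x _.
have [xD|xD] := boolP (x \in `[0, L]).
  rewrite -[RHS](f0 x) [RHS]integral_mkcond; apply: eq_integral => y _.
  rewrite /patch; congr (if _ then _ else _).
  by apply/idP/idP; rewrite !inE /Omega /= => H; [case: H|split].
apply: integral0_eq => y _; rewrite /patch; case: ifPn => //.
by rewrite inE /Omega /= => -[]; rewrite (negbTE xD).
Qed.

Lemma Omega_integral0_fst (f : R * R -> R) (C : R) :
  measurable_fun D f -> (forall x, `|f x| <= C) ->
  (forall y, (\int[leb]_(x in `[0%R, L]) (f (x, y))%:E)%E = 0%E) ->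
  \int[mu]_(x in D) f x = 0.
Proof.
move=> mf fC f0; have If := integrable_Omega_bounded mf fC.
rewrite /Rintegral integral_mkcond.
have If' := (integrable_mkcond (mu := mu) (EFin \o f) (measurable_Omega L)).1 If.
rewrite -(integral21_prod_meas1 If') /fubini_G /= integral0_eq // => y _.
have [yD|yD] := boolP (y \in `[0, L]).
  rewrite -[RHS](f0 y) [RHS]integral_mkcond; apply: eq_integral => x _.
  rewrite /patch; congr (if _ then _ else _).
  by apply/idP/idP; rewrite !inE /Omega /= => H; [case: H|split].
apply: integral0_eq => x _; rewrite /patch; case: ifPn => //.
by rewrite inE /Omega /= => -[] _; rewrite (negbTE yD).
Qed.

Lemma integral_cas1 (a : R) (m : int) : m != 0 ->
  (\int[leb]_(t in `[0%R, L])
     (cos (a + k0 * m%:~R * t) + sin (a + k0 * m%:~R * t))%:E)%E = 0%E.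
Proof.
move=> m0; set c := k0 * m%:~R.
have c0 : c != 0 by rewrite mulf_neq0 ?intr_eq0 // gt_eqF // kappa0_gt0.
(* An antiderivative of the integrand, with equal values at 0 and L because [c * L] is a multiple of
   2 pi. *)
pose F t := c^-1 * (sin (a + c * t) - cos (a + c * t)).
have dF (t : R) : is_derive t 1 F (cos (a + c * t) + sin (a + c * t)).
  have h1 : is_derive t 1 (fun t : R => a + c * t) c.
    by apply: is_derive_eq; rewrite add0r mul1r [_ *: _]mulr1.
  have h2 := @is_derive1_comp R cos (fun t => a + c * t) t _ c (is_derive_cos _) h1.
  have h3 := @is_derive1_comp R sin (fun t => a + c * t) t _ c (is_derive_sin _) h1.
  have h4 := is_deriveZ c^-1 (is_deriveB h3 h2).
  have -> : cos (a + c * t) + sin (a + c * t) =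
    c^-1 *: (cos (a + c * t) * c - (- sin (a + c * t)) * c); last exact: h4.
  by rewrite /GRing.scale /=; field.
rewrite (@continuous_FTC2 _ _ F 0 L hL).
- rewrite /F mulr0 addr0.
  have cL : c * L = (pi *+ 2) * m%:~R.
    by rewrite /c /kappa0 -mulr_natr; field; rewrite gt_eqF.
  rewrite cL (periodic_int (@sinD2pi R)) (periodic_int (@cosD2pi R)) -EFinB.
  by rewrite subrr.
- apply: derivable_within_continuous => t _.
  have h1 : is_derive t 1 (fun t : R => a + c * t) c.
    by apply: is_derive_eq; rewrite add0r mul1r [_ *: _]mulr1.
  have h2 := @is_derive1_comp R cos (fun t => a + c * t) t _ c (is_derive_cos _) h1.
  have h3 := @is_derive1_comp R sin (fun t => a + c * t) t _ c (is_derive_sin _) h1.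
  exact: (@ex_derive _ _ _ _ _ _ _ (is_deriveD h2 h3)).
- have cF : continuous F.
    move=> t; apply: differentiable_continuous; apply/derivable1_diffP.
    exact: (@ex_derive _ _ _ _ _ _ _ (dF t)).
  split; first by move=> t _; exact: (@ex_derive _ _ _ _ _ _ _ (dF t)).
    by apply: cvg_at_right_filter; exact: cF.
  by apply: cvg_at_left_filter; exact: cF.
- by move=> t _; rewrite derive1E (@derive_val _ _ _ _ _ _ _ (dF t)).
Qed.

Lemma integral_cas k : k != 0 -> \int[mu]_(x in D) cas L k x = 0.
Proof.
move=> k0'; have mc : measurable_fun D (cas L k).
  exact: (measurable_funS measurableT _ (measurable_cas L k)).
have [k2|k2] := eqVneq k.2 0.
- have k1 : k.1 != 0 by apply: contra_neq k0'; case: k k2 {mc} => a b /= -> ->.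
  apply: (Omega_integral0_fst mc (cas_bound L k)) => y.
  rewrite -[RHS](integral_cas1 0 k1); apply: eq_integral => x _.
  by rewrite /cas /phase /= k2 mul0r addr0 add0r mulrA.
- apply: (Omega_integral0_snd mc (cas_bound L k)) => x.
  rewrite -[RHS](integral_cas1 (k0 * k.1%:~R * x) k2); apply: eq_integral => y _.
  by rewrite /cas /phase /= mulrDr !mulrA.
Qed.

Lemma integral_cas0 : \int[mu]_(x in D) cas L 0 x = L ^+ 2.
Proof.
under eq_Rintegral do rewrite cas0.
rewrite Rintegral_cst; last exact: measurable_Omega.
by rewrite mul1r [X in fine X](leb2_Omega hL).
Qed.

End CasIntegral.

(** * Trigonometric polynomials and integration by parts *)

Section TrigPoly.
Context (R : realType) (L : R) (hL : 0 < L).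
Local Notation mu := (@leb2 R).
Local Notation D := (Omega L).
Local Notation k0 := (kappa0 L).
Local Notation cas := (cas L).

Definition casform (s : seq ((int * int) * R)) (x : R * R) : R :=
  \sum_(m <- s) m.2 * cas m.1 x.

(** The cosine and the sine of a phase are half the sum and half the difference of [cas k] and
    [cas (- k)], so a single real coefficient per lattice point suffices. *)
Lemma trig_polyP psi : trig_poly L psi <-> exists s, psi = casform s.
Proof.
split=> [[s es]|[s ->]].
- exists (flatten [seq [:: (m.1, 2^-1 * (m.2.1 + m.2.2));
                           (- m.1, 2^-1 * (m.2.1 - m.2.2))] | m <- s]).
  apply/funext => x; rewrite es /casform {es}; elim: s => [|m s IH] /=.
    by rewrite !big_nil.
  rewrite !big_cons IH /= casN !casE -/(phase L m.1 x).
  by field.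
- exists [seq (m.1, (m.2, m.2)) | m <- s] => x; rewrite /casform big_map /=.
  by apply: eq_bigr => m _; rewrite mulrDr.
Qed.

Lemma trig_poly_cas k : trig_poly L (cas k).
Proof.
apply/trig_polyP; exists [:: (k, 1)]; apply/funext => x.
by rewrite /casform big_seq1 mul1r.
Qed.

Lemma trig_polyD f g : trig_poly L f -> trig_poly L g ->
  trig_poly L (fun x => f x + g x).
Proof.
move=> /trig_polyP[s ->] /trig_polyP[t ->]; apply/trig_polyP; exists (s ++ t).
by apply/funext => x; rewrite /casform big_cat.
Qed.

Lemma trig_polyZ a f : trig_poly L f -> trig_poly L (fun x => a * f x).
Proof.
move=> /trig_polyP[s ->]; apply/trig_polyP; exists [seq (m.1, a * m.2) | m <- s].
apply/funext => x; rewrite /casform big_map mulr_sumr.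
by apply: eq_bigr => m _; rewrite mulrA.
Qed.

Lemma trig_polyN f : trig_poly L f -> trig_poly L (fun x => - f x).
Proof.
by move=> /(trig_polyZ (-1)); congr trig_poly; apply/funext => x; rewrite mulN1r.
Qed.

Lemma trig_polyB f g : trig_poly L f -> trig_poly L g ->
  trig_poly L (fun x => f x - g x).
Proof. by move=> hf /trig_polyN; exact: trig_polyD. Qed.

Lemma trig_poly0 : trig_poly L (fun=> 0).
Proof.
by apply/trig_polyP; exists [::]; apply/funext => x; rewrite /casform big_nil.
Qed.

Lemma trig_poly_sum (I : Type) (s : seq I) (F : I -> R * R -> R) :
  (forall i, trig_poly L (F i)) -> trig_poly L (fun x => \sum_(i <- s) F i x).
Proof.
move=> tF; elim: s => [|i s IH].
  have -> : (fun x => \sum_(i <- [::]) F i x) = (fun=> 0).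
    by apply/funext => x; rewrite big_nil.
  exact: trig_poly0.
have -> : (fun x => \sum_(j <- i :: s) F j x) =
          (fun x => F i x + \sum_(j <- s) F j x).
  by apply/funext => x; rewrite big_cons.
exact: trig_polyD.
Qed.

Lemma trig_polyM f g : trig_poly L f -> trig_poly L g ->
  trig_poly L (fun x => f x * g x).
Proof.
move=> /trig_polyP[s ->] /trig_polyP[t ->].
have -> : (fun x => casform s x * casform t x) = (fun x =>
    \sum_(m <- s) \sum_(n <- t) m.2 * n.2 * (cas m.1 x * cas n.1 x)).
  apply/funext => x; rewrite /casform mulr_suml; apply: eq_bigr => m _.
  by rewrite mulr_sumr; apply: eq_bigr => n _; ring.
apply: trig_poly_sum => m; apply: trig_poly_sum => n; apply: trig_polyZ.
have -> : (fun x => cas m.1 x * cas n.1 x) = (fun x =>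
    2^-1 * cas (m.1 - n.1) x + 2^-1 * cas (n.1 - m.1) x +
    2^-1 * cas (m.1 + n.1) x - 2^-1 * cas (- (m.1 + n.1)) x).
  by apply/funext => x; rewrite casM.
apply: trig_polyB; last by apply: trig_polyZ; exact: trig_poly_cas.
apply: trig_polyD; last by apply: trig_polyZ; exact: trig_poly_cas.
by apply: trig_polyD; apply: trig_polyZ; exact: trig_poly_cas.
Qed.

Lemma trig_poly_measurable f : trig_poly L f -> measurable_fun setT f.
Proof.
move=> /trig_polyP[s ->]; elim: s => [|m s IH].
  have -> : casform [::] = (fun=> 0) by apply/funext => x; rewrite /casform big_nil.
  exact: measurable_cst.
have -> : casform (m :: s) = (fun x => m.2 * cas m.1 x + casform s x).
  by apply/funext => x; rewrite /casform big_cons.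
apply: measurable_funD => //; apply: measurable_funM; first exact: measurable_cst.
exact: measurable_cas.
Qed.

Lemma trig_poly_measurableD f : trig_poly L f -> measurable_fun D f.
Proof. by move=> /trig_poly_measurable; exact: measurable_funS. Qed.

Lemma trig_poly_bounded f : trig_poly L f -> exists C, forall x, `|f x| <= C.
Proof.
move=> /trig_polyP[s ->]; exists (\sum_(m <- s) `|m.2| * 2) => x.
rewrite (le_trans (ler_norm_sum _ _ _)) // ler_sum // => m _.
by rewrite normrM ler_wpM2l // cas_bound.
Qed.

Lemma trig_poly_L2s f : trig_poly L f -> L2s L f.
Proof.
move=> tf; have [C fC] := trig_poly_bounded tf.
exact: L2s_bounded (trig_poly_measurableD tf) fC.
Qed.

Lemma L2sM_trig f g : trig_poly L f -> L2s L g -> L2s L (fun x => f x * g x).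
Proof.
move=> tf Lg; have [C fC] := trig_poly_bounded tf.
exact: L2sM (trig_poly_measurableD tf) fC Lg.
Qed.

Definition dcas (i : 'I_2) (s : seq ((int * int) * R)) :=
  [seq (- m.1, k0 * kc R m.1 i * m.2) | m <- s].

Lemma is_derive_casform s i x :
  is_derive x (dir R i) (casform s) (casform (dcas i s) x).
Proof.
elim: s => [|m s IH].
  have -> : casform [::] = cst 0 by apply/funext => y; rewrite /casform big_nil.
  rewrite /= ; exact: is_derive_cst.
have -> : casform (m :: s) = m.2 *: cas m.1 + casform s.
  by apply/funext => y; rewrite /casform big_cons.
have h1 := is_deriveZ m.2 (is_derive_cas L m.1 i x).
have h2 := is_deriveD h1 IH.
have -> : casform (dcas i (m :: s)) x =
  m.2 *: (k0 * kc R m.1 i * cas (- m.1) x) + casform (dcas i s) x; last exact: h2.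
by rewrite /casform /= big_cons /= /GRing.scale /=; congr (_ + _); ring.
Qed.

Lemma trig_poly_is_derive f i x : trig_poly L f ->
  is_derive x (dir R i) f (partial i f x).
Proof.
move=> /trig_polyP[s ->]; have h := is_derive_casform s i x.
rewrite /partial (@derive_val _ _ _ _ _ _ _ h); exact: h.
Qed.

Lemma partial_casform i s : partial i (casform s) = casform (dcas i s).
Proof.
by apply/funext => x; rewrite /partial (@derive_val _ _ _ _ _ _ _ (is_derive_casform s i x)).
Qed.

Lemma partial_cas i k : partial i (cas k) = fun x => k0 * kc R k i * cas (- k) x.
Proof.
by apply/funext => x; rewrite /partial (@derive_val _ _ _ _ _ _ _ (is_derive_cas L k i x)).
Qed.

Lemma trig_poly_partial i f : trig_poly L f -> trig_poly L (partial i f).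
Proof.
move=> /trig_polyP[s ->]; rewrite partial_casform; apply/trig_polyP.
by eexists.
Qed.

Lemma partialD i f g : trig_poly L f -> trig_poly L g ->
  partial i (fun x => f x + g x) = fun x => partial i f x + partial i g x.
Proof.
move=> tf tg; apply/funext => x; rewrite [LHS]/partial.
exact: (@derive_val _ _ _ _ _ _ _ (is_deriveD
  (trig_poly_is_derive i x tf) (trig_poly_is_derive i x tg))).
Qed.

Lemma partialZ i a f : trig_poly L f ->
  partial i (fun x => a * f x) = fun x => a * partial i f x.
Proof.
move=> tf; apply/funext => x; rewrite [LHS]/partial.
exact: (@derive_val _ _ _ _ _ _ _ (is_deriveZ a (trig_poly_is_derive i x tf))).
Qed.

Lemma partial0 i : partial i (fun=> 0 : R) = fun=> 0.
Proof.
have := partialZ i 0 trig_poly0.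
under eq_fun do rewrite mul0r.
by move=> ->; apply/funext => x; rewrite mul0r.
Qed.

Lemma partial_sum i (I : Type) (s : seq I) (F : I -> R * R -> R) :
  (forall i, trig_poly L (F i)) ->
  partial i (fun x => \sum_(j <- s) F j x) = fun x => \sum_(j <- s) partial i (F j) x.
Proof.
move=> tF; elim: s => [|j s IH].
  under eq_fun do rewrite big_nil.
  by rewrite partial0; apply/funext => x; rewrite big_nil.
under eq_fun do rewrite big_cons.
rewrite partialD ?IH //; last exact: trig_poly_sum.
by apply/funext => x; rewrite big_cons.
Qed.

Lemma partialM i f g : trig_poly L f -> trig_poly L g ->
  partial i (fun x => f x * g x) =
  fun x => partial i f x * g x + f x * partial i g x.
Proof.
move=> tf tg; apply/funext => x; rewrite [LHS]/partial.
rewrite (@derive_val _ _ _ _ _ _ _ (is_deriveM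
  (trig_poly_is_derive i x tf) (trig_poly_is_derive i x tg))).
by rewrite /GRing.scale /= addrC mulrC.
Qed.

Lemma integrable_trig f : trig_poly L f -> mu.-integrable D (EFin \o f).
Proof.
move=> tf; have [C fC] := trig_poly_bounded tf.
exact: (integrable_Omega_bounded hL (trig_poly_measurableD tf) fC).
Qed.

(** The constant mode is killed by the factor [k_i], and all others integrate to 0 over a period. *)
Lemma integral_partial i f : trig_poly L f -> \int[mu]_(x in D) partial i f x = 0.
Proof.
move=> /trig_polyP[s ->]; rewrite partial_casform.
elim: s => [|m s IH].
  under eq_Rintegral do rewrite /casform big_nil.
  by rewrite Rintegral_cst ?mul0r //; exact: measurable_Omega.
have -> : casform (dcas i (m :: s)) =
  (fun x => k0 * kc R m.1 i * m.2 * cas (- m.1) x + casform (dcas i s) x).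
  by apply/funext => x; rewrite /casform /= big_cons.
rewrite RintegralD //; [|exact: measurable_Omega|..].
- rewrite IH addr0 RintegralZl; [|exact: measurable_Omega|].
    have [m0|m0] := eqVneq m.1 0.
      by rewrite /kc m0 if_same mulr0 !mul0r.
    by rewrite integral_cas ?mulr0 // oppr_eq0.
  by apply: integrable_trig; exact: trig_poly_cas.
- by apply: integrable_trig; apply: trig_polyZ; exact: trig_poly_cas.
- by apply: integrable_trig; apply/trig_polyP; eexists.
Qed.

Lemma ips_partial i f g : trig_poly L f -> trig_poly L g ->
  ips L (partial i f) g = - ips L f (partial i g).
Proof.
move=> tf tg; have := integral_partial i (trig_polyM tf tg).
rewrite partialM // RintegralD; first last.
- by apply: integrable_trig; apply: trig_polyM => //; exact: trig_poly_partial.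
- by apply: integrable_trig; apply: trig_polyM => //; exact: trig_poly_partial.
- exact: measurable_Omega.
by move=> /eqP; rewrite addr_eq0 => /eqP.
Qed.

(** In the product formula the terms of frequency [k + l] and [- (k + l)] have opposite signs and
    equal integrals; only the two terms in [k - l] survive. *)
Lemma ips_cas k l : ips L (cas k) (cas l) = L ^+ 2 * (k == l)%:R.
Proof.
rewrite /ips; under eq_Rintegral do rewrite casM.
have tc m : trig_poly L (fun x => 2^-1 * cas m x).
  by apply: trig_polyZ; exact: trig_poly_cas.
rewrite RintegralB; [|exact: measurable_Omega|..]; first last.
- by apply: integrable_trig; exact: tc.
- by apply: integrable_trig; do ?apply: trig_polyD; exact: tc.
rewrite RintegralD; [|exact: measurable_Omega|..]; first last.
- by apply: integrable_trig; exact: tc.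
- by apply: integrable_trig; do ?apply: trig_polyD; exact: tc.
rewrite RintegralD; [|exact: measurable_Omega|..]; try exact: integrable_trig.
have Z m : \int[mu]_(x in D) (2^-1 * cas m x) = 2^-1 * (L ^+ 2 * (m == 0)%:R).
  rewrite RintegralZl; [|exact: measurable_Omega|]; last first.
    by apply: integrable_trig; exact: trig_poly_cas.
  have [->|m0] := eqVneq m 0; first by rewrite integral_cas0 // mulr1.
  by rewrite integral_cas // !mulr0n !mulr0.
rewrite !Z oppr_eq0 !subr_eq0 (eq_sym l k).
by field.
Qed.

End TrigPoly.

(** * Frequencies and the Stokes eigenfunctions *)

Definition zrange (M : nat) : seq int := [seq (i%:Z - M%:Z) | i <- iota 0 (2 * M).+1].

Lemma mem_zrange M (a : int) : (a \in zrange M) = (`|a| <= M%:Z).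
Proof.
apply/mapP/idP => [[i]|aM].
  rewrite mem_iota add0n => /andP[_ iM] ->; rewrite ler_norml; apply/andP; split; lia.
by exists (absz (a + M%:Z)); [rewrite mem_iota; lia|lia].
Qed.

Lemma zrange_uniq M : uniq (zrange M).
Proof. by rewrite map_inj_uniq ?iota_uniq // => i j /addIr[]. Qed.

(** A disc of frequencies, not a square, so that membership is a bound on the eigenvalue and
    [modes N] indexes a basis of the range of [P_N]. Frequency 0 is left out because fields in H
    have mean zero. *)
Definition modes (M : nat) : seq (int * int) :=
  [seq k <- [seq (i, j) | i <- zrange M, j <- zrange M] |
    (k != 0) && (k.1 ^+ 2 + k.2 ^+ 2 <= M%:Z ^+ 2)].

Lemma mem_modes M k : (k \in modes M) =
  (k != 0) && (k.1 ^+ 2 + k.2 ^+ 2 <= M%:Z ^+ 2).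
Proof.
rewrite mem_filter andb_idr // => /andP[_]; case: k => a b h.
apply/allpairsPdep; exists a, b; rewrite !mem_zrange; split => //.
- rewrite -[leRHS]ger0_norm // -ler_sqr ?nnegrE ?normr_ge0 // -!normrX.
  by rewrite !ger0_norm ?sqr_ge0 // (le_trans _ h) // lerDl sqr_ge0.
- rewrite -[leRHS]ger0_norm // -ler_sqr ?nnegrE ?normr_ge0 // -!normrX.
  by rewrite !ger0_norm ?sqr_ge0 // (le_trans _ h) // lerDr sqr_ge0.
Qed.

Lemma modes_uniq M : uniq (modes M).
Proof.
apply: filter_uniq; apply: allpairs_uniq; try exact: zrange_uniq.
by move=> [a b] [c d] _ _.
Qed.

Lemma modes_neq0 M k : k \in modes M -> k != 0.
Proof. by rewrite mem_modes => /andP[]. Qed.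

Lemma modesS M M' : (M <= M')%N -> {subset modes M <= modes M'}.
Proof.
move=> MM' k; rewrite !mem_modes => /andP[-> h] /=; rewrite (le_trans h) //.
by rewrite ler_sqr ?nnegrE.
Qed.

Lemma modes_exhaust k : k != 0 -> exists M, k \in modes M.
Proof.
move=> k0; exists (absz k.1 ^ 2 + absz k.2 ^ 2)%N; rewrite mem_modes k0 /=; nia.
Qed.

Lemma big_modesS (R : realType) M M' (F : int * int -> R) : (M <= M')%N ->
  \sum_(k <- modes M') F k =
  \sum_(k <- modes M) F k + \sum_(k <- modes M' | k \notin modes M) F k.
Proof.
move=> MM'; rewrite (bigID (mem (modes M))) /=; congr (_ + _).
rewrite -big_filter; apply: perm_big; apply: uniq_perm.
- exact/filter_uniq/modes_uniq.
- exact: modes_uniq.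
move=> k; rewrite mem_filter; apply: andb_idr; exact: modesS.
Qed.

Section EigenBasis.
Context (R : realType) (L : R) (hL : 0 < L).
Local Notation k0 := (kappa0 L).
Local Notation cas := (cas L).

Definition ksq (k : int * int) : R := (k.1 ^+ 2 + k.2 ^+ 2)%:~R.

Definition lam (k : int * int) : R := k0 ^+ 2 * ksq k.

Definition kperp (k : int * int) (i : 'I_2) : R := (if i == 0 then - k.2 else k.1)%:~R.

(** The direction [k^perp] makes the field divergence-free, and the first factor normalises it in
    [L^2]. In two dimensions there is only this direction, hence one field per frequency; for
    [k = 0] the formula gives 0. *)
Definition eb (k : int * int) : vfield R :=
  fun x => \row_i ((Num.sqrt (ksq k) * L)^-1 * kperp k i * cas k x).

Lemma lamE k : lam k = k0 ^+ 2 * ksq k. Proof. by []. Qed.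

Lemma ksq_gt0 k : k != 0 -> 0 < ksq k.
Proof.
move=> k0'; rewrite /ksq ltr0z lt0r addr_ge0 ?sqr_ge0 // andbT.
rewrite paddr_eq0 ?sqr_ge0 // !sqrf_eq0; apply: contra k0' => /andP[/eqP h1 /eqP h2].
by apply/eqP; case: k h1 h2 => a b /= -> ->.
Qed.

Lemma ksq_ge1 k : k != 0 -> 1 <= ksq k.
Proof. by move=> /ksq_gt0; rewrite /ksq ltr0z ler1z. Qed.

Lemma lam_ge0 k : 0 <= lam k.
Proof. by rewrite mulr_ge0 ?sqr_ge0 // /ksq ler0z addr_ge0 ?sqr_ge0. Qed.

Lemma lam_ge k : k != 0 -> k0 ^+ 2 <= lam k.
Proof. by move=> h; rewrite ler_peMr ?sqr_ge0 // ksq_ge1. Qed.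

Lemma mem_modes_lam M k : (k \in modes M) = (k != 0) && (lam k <= (k0 * M%:R) ^+ 2).
Proof.
rewrite mem_modes; congr (_ && _).
rewrite /lam [(_ * M%:R) ^+ 2]exprMn ler_pM2l ?exprn_gt0 ?kappa0_gt0 // /ksq.
by rewrite (_ : M%:R ^+ 2 = (M%:Z ^+ 2)%:~R) ?ler_int // rmorphXn.
Qed.

Lemma kperpE k i : kperp k i = (if i == 0 then - k.2%:~R else k.1%:~R).
Proof. by rewrite /kperp; case: ifP => // _; rewrite mulrNz. Qed.

Lemma kperp_sq k : \sum_(i < 2) kperp k i ^+ 2 = ksq k.
Proof.
rewrite !big_ord_recl big_ord0 addr0 !kperpE /= sqrrN /ksq intrD !rmorphXn /=.
by rewrite addrC.
Qed.

Lemma eb_comp k i : (fun x => eb k x 0 i) =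
  fun x => (Num.sqrt (ksq k) * L)^-1 * kperp k i * cas k x.
Proof. by apply/funext => x; rewrite mxE. Qed.

Lemma trig_poly_eb k i : trig_poly L (fun x => eb k x 0 i).
Proof. by rewrite eb_comp; apply: trig_polyZ; exact: trig_poly_cas. Qed.

Lemma L2_eb k : L2 L (eb k).
Proof. by move=> i; apply: trig_poly_L2s => //; exact: trig_poly_eb. Qed.

Lemma L2s_cas k : L2s L (cas k).
Proof. by apply: trig_poly_L2s => //; exact: trig_poly_cas. Qed.

Lemma ip_eb u k : L2 L u -> ip L u (eb k) = (Num.sqrt (ksq k) * L)^-1 *
  \sum_(i < 2) kperp k i * ips L (fun x => u x 0 i) (cas k).
Proof.
move=> Lu; rewrite ipE mulr_sumr; apply: eq_bigr => i _.
by rewrite eb_comp ipsZr ?mulrA //; exact: L2s_cas.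
Qed.

Lemma sqrt_ksq_sqr k : Num.sqrt (ksq k) ^+ 2 = ksq k.
Proof. by rewrite sqr_sqrtr // /ksq ler0z addr_ge0 ?sqr_ge0. Qed.

Lemma ip_eb_eb k l : k != 0 -> l != 0 -> ip L (eb k) (eb l) = (k == l)%:R.
Proof.
move=> k0' l0; rewrite ip_eb; last exact: L2_eb.
have [<-|kl] := eqVneq k l; last first.
  rewrite big1 ?mulr0 // => i _; rewrite eb_comp ipsZl; try exact: L2s_cas.
  by rewrite ips_cas // (negbTE kl) !mulr0.
have -> : \sum_(i < 2) kperp k i * ips L (fun x => eb k x 0 i) (cas k) =
    (Num.sqrt (ksq k) * L)^-1 * L ^+ 2 * ksq k.
  rewrite -[X in _ = _ * X]kperp_sq mulr_sumr; apply: eq_bigr => i _.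
  rewrite eb_comp ipsZl; try exact: L2s_cas.
  by rewrite ips_cas // eqxx mulr1; ring.
have s0 : Num.sqrt (ksq k) != 0 by rewrite gt_eqF // sqrtr_gt0 ksq_gt0.
move: s0 (sqrt_ksq_sqr k); set s := Num.sqrt _ => s0 <-.
by rewrite mulr1n; field; rewrite s0 gt_eqF.
Qed.

Lemma sol_eb k : sol_trig_poly L (eb k).
Proof.
split=> [i|x|i]; first exact: trig_poly_eb.
- rewrite /divergence !big_ord_recl big_ord0 addr0.
  have tc : trig_poly L (cas k) by exact: trig_poly_cas.
  rewrite !eb_comp !(partialZ _ _ tc) !partial_cas !kperpE /kc /=.
  by ring.
- have [->|k0'] := eqVneq k 0.
    rewrite eb_comp (_ : (fun _ => _) = (fun=> 0)).
      by rewrite Rintegral_cst ?mul0r //; exact: measurable_Omega.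
    by apply/funext => x; rewrite kperpE oppr0 if_same mulr0 mul0r.
  rewrite eb_comp RintegralZl; [|exact: measurable_Omega|].
    by rewrite integral_cas // mulr0.
  by apply: integrable_trig => //; exact: trig_poly_cas.
Qed.

Lemma trig_expand psi : trig_poly L psi -> exists M0, forall M, (M0 <= M)%N ->
  forall x, psi x =
    \sum_(k <- 0 :: modes M) (L ^- 2 * ips L psi (cas k)) * cas k x.
Proof.
move=> /trig_polyP[s ->].
have H : exists M0, forall M, (M0 <= M)%N -> forall m, m \in s -> m.1 \in 0 :: modes M.
  elim: s => [|m s [M0 IH]]; first by exists 0%N.
  have [m0|/modes_exhaust [M1 hM1]] := eqVneq m.1 0.
    exists M0 => M hM n; rewrite inE => /orP[/eqP ->|/(IH M hM)//].
    by rewrite m0 inE eqxx.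
  exists (maxn M0 M1) => M; rewrite geq_max => /andP[h0 h1] n.
  rewrite inE => /orP[/eqP ->|/(IH M h0)//].
  by rewrite inE (modesS h1) ?orbT.
have [M0 hM0] := H; exists M0 => M hM x.
have Lf : L2s L (casform L s) by apply: trig_poly_L2s => //; apply/trig_polyP; eexists.
have U : uniq (0 :: modes M).
  by rewrite /= modes_uniq andbT; apply/negP => /modes_neq0; rewrite eqxx.
(* The list may repeat a frequency; the inner product with [cas k] collects all entries of that
   frequency. *)
have E k : L ^- 2 * ips L (casform L s) (cas k) * cas k x =
    \sum_(m <- s) L ^- 2 * (m.2 * (L ^+ 2 * (m.1 == k)%:R)) * cas k x.
  rewrite /casform ips_suml //; first last.
  - exact: L2s_cas.
  - by move=> m; apply: L2sZ; exact: L2s_cas.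
  rewrite mulr_sumr mulr_suml; apply: eq_bigr => m _.
  by rewrite ipsZl ?ips_cas //; exact: L2s_cas.
under eq_bigr => k _ do rewrite E.
rewrite exchange_big /= /casform big_seq [RHS]big_seq; apply: eq_bigr => m ms.
rewrite (bigD1_seq m.1) //=; last exact: hM0 ms.
rewrite eqxx big1 ?addr0 => [|k km]; last first.
  by rewrite eq_sym (negbTE km) !(mulr0, mul0r).
by rewrite mulr1n; field; rewrite gt_eqF.
Qed.

(** The divergence is tested with [cas (- k)], whose derivatives are multiples of [cas k]. *)
Lemma div_free_coef phi k : sol_trig_poly L phi ->
  \sum_(i < 2) kc R k i * ips L (fun x => phi x 0 i) (cas k) = 0.
Proof.
move=> [tp dp _].
have H : ips L (divergence phi) (cas (- k)) = 0.
  rewrite /ips; under eq_Rintegral do rewrite dp mul0r.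
  by rewrite Rintegral_cst ?mul0r //; exact: measurable_Omega.
have tc : trig_poly L (cas (- k)) by exact: trig_poly_cas.
move: H; rewrite /divergence ips_suml //; first last.
- exact: L2s_cas.
- by move=> i; apply: trig_poly_L2s => //; apply: trig_poly_partial.
have E i : ips L (partial i (fun x => phi x 0 i)) (cas (- k)) =
    - (k0 * kc R (- k) i * ips L (fun x => phi x 0 i) (cas k)).
  rewrite ips_partial // partial_cas opprK ipsZr //; first exact: L2s_cas.
  exact: trig_poly_L2s.
under eq_bigr => i _ do rewrite E.
move=> H; have : k0 * (\sum_(i < 2) kc R k i * ips L (fun x => phi x 0 i) (cas k)) = 0.
  apply: etrans H; rewrite mulr_sumr; apply: eq_bigr => i _.
  by rewrite /kc /=; case: ifP => _; rewrite mulrNz; ring.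
by move=> /eqP; rewrite mulf_eq0 gt_eqF ?kappa0_gt0 //= => /eqP.
Qed.

Definition proj (M : nat) (u : vfield R) : vfield R :=
  \sum_(k <- modes M) ip L u (eb k) *: eb k.

Lemma fct_sumE (I : Type) (s : seq I) (F : I -> vfield R) x i :
  (\sum_(j <- s) F j) x 0 i = \sum_(j <- s) F j x 0 i.
Proof.
elim: s => [|j s IH]; first by rewrite !big_nil mxE.
by rewrite !big_cons -IH mxE.
Qed.

Lemma projE M u x i : proj M u x 0 i = \sum_(k <- modes M) ip L u (eb k) * eb k x 0 i.
Proof. by rewrite /proj fct_sumE; apply: eq_bigr => k _; rewrite mxE. Qed.

Lemma sol_L2 phi : sol_trig_poly L phi -> L2 L phi.
Proof. by move=> [tp _ _] i; exact: trig_poly_L2s. Qed.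

(** By [div_free_coef] the coefficient vector at k is orthogonal to k, hence a multiple of [k^perp];
    the mean value condition removes [k = 0]. *)
Lemma sol_expand phi : sol_trig_poly L phi ->
  exists M0, forall M, (M0 <= M)%N -> phi = proj M phi.
Proof.
move=> sp; have [tp _ mp] := sp; have Lp := sol_L2 sp.
have [M0 h0] := trig_expand (tp 0); have [M1 h1] := trig_expand (tp 1).
exists (maxn M0 M1) => M; rewrite geq_max => /andP[hM0 hM1].
apply/funext => x; apply/matrixP => a i; rewrite (ord1 a) projE {a}.
have -> : phi x 0 i = \sum_(k <- 0 :: modes M)
    (L ^- 2 * ips L (fun x => phi x 0 i) (cas k)) * cas k x.
  have /orP[/eqP->|/eqP->] : (i == 0) || (i == 1) by case: i => [[|[|]]].
  - exact: h0.
  - exact: h1.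
rewrite big_cons /= (_ : ips _ _ (cas 0) = 0); last first.
  by rewrite /ips -[RHS](mp i); apply: eq_Rintegral => y _; rewrite cas0 mulr1.
rewrite mulr0 mul0r add0r big_seq [RHS]big_seq; apply: eq_bigr => k /modes_neq0 k0'.
rewrite ip_eb // mxE mulrA; congr (_ * _).
have := div_free_coef k sp; rewrite !big_ord_recl !big_ord0 !addr0 !kperpE /kc /=.
set p0 := ips _ _ _; set p1 := ips _ _ _ => E.
have k1 := ksq_gt0 k0'.
have s0 : Num.sqrt (ksq k) != 0 by rewrite gt_eqF // sqrtr_gt0.
have -> : ips L (fun x => phi x 0 i) (cas k) = if i == 0 then p0 else p1.
  have /orP[/eqP->|/eqP->] : (i == 0) || (i == 1) by case: i => [[|[|]]].
  - by [].
  - by rewrite /= /p1; congr ips; apply/funext => y; congr (phi y 0 _); apply: val_inj.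
(* After multiplication by [|k|^2 L^2] what remains is component i of
   [|k|^2 p = (k^perp . p) k^perp], valid for p orthogonal to k. *)
apply: (mulfI (mulf_neq0 (lt0r_neq0 k1) (expf_neq0 2 (lt0r_neq0 hL)))).
rewrite [RHS](_ : _ = (if i == 0 then - k.2%:~R else k.1%:~R) *
   (- k.2%:~R * p0 + k.1%:~R * p1)); last first.
  move: s0 (sqrt_ksq_sqr k); set s := Num.sqrt _ => s0 <-.
  set q := (if _ then _ else _); set r := (_ + _).
  by field; rewrite s0 gt_eqF.
rewrite [LHS](_ : _ = ksq k * if i == 0 then p0 else p1); last first.
  by set q := (if _ then _ else _); field; rewrite gt_eqF.
rewrite /ksq intrD !rmorphXn /=; case: ifP => _.
  have {}E : k.2%:~R * p1 = - (k.1%:~R * p0) by rewrite -[RHS]add0r -E; ring.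
  rewrite mulrDr [X in _ = _ + X](_ : _ = - k.1%:~R * (k.2%:~R * p1)); last ring.
  by rewrite E; ring.
have {}E : k.1%:~R * p0 = - (k.2%:~R * p1) by rewrite -[RHS]add0r -E; ring.
rewrite mulrDr [X in _ = X + _](_ : _ = - k.2%:~R * (k.1%:~R * p0)); last ring.
by rewrite E; ring.
Qed.

End EigenBasis.

Lemma sqr_le_add (R : realDomainType) (x y z : R) : 0 <= x -> 0 <= y ->
  y ^+ 2 = x ^+ 2 + z ^+ 2 -> x <= y.
Proof. by move=> x0 y0 E; rewrite -ler_sqr ?nnegrE // E lerDl sqr_ge0. Qed.

(** * Fourier series in H *)

Section HSpace.
Context (R : realType) (L : R) (hL : 0 < L).
Local Notation eb := (eb L).
Local Notation lam := (lam L).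
Local Notation proj := (proj L).
Implicit Types u v w : vfield R.

Lemma H_L2 u : H L u -> L2 L u. Proof. by case. Qed.

Lemma sol_trig_polyD phi psi : sol_trig_poly L phi -> sol_trig_poly L psi ->
  sol_trig_poly L (phi + psi).
Proof.
move=> [tp dp mp] [tq dq mq].
have E i : (fun x => (phi + psi) x 0 i) = fun x => phi x 0 i + psi x 0 i.
  by apply/funext => x; rewrite mxE.
split=> [i|x|i].
- by rewrite E; exact: trig_polyD.
- rewrite /divergence; under eq_bigr => i _ do rewrite E (partialD i (tp i) (tq i)).
  by rewrite big_split /=; move: (dp x) (dq x); rewrite /divergence => -> ->; rewrite addr0.
- under eq_Rintegral => x _ do rewrite mxE.
  rewrite RintegralD ?mp ?mq ?addr0 //; try exact: integrable_trig.
  exact: measurable_Omega.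
Qed.

Lemma sol_trig_polyZ a phi : sol_trig_poly L phi -> sol_trig_poly L (a *: phi).
Proof.
move=> [tp dp mp].
have E i : (fun x => (a *: phi) x 0 i) = fun x => a * phi x 0 i.
  by apply/funext => x; rewrite mxE.
split=> [i|x|i].
- by rewrite E; exact: trig_polyZ.
- rewrite /divergence; under eq_bigr => i _ do rewrite E (partialZ i a (tp i)).
  by rewrite -mulr_sumr; move: (dp x); rewrite /divergence => ->; rewrite mulr0.
- under eq_Rintegral => x _ do rewrite mxE.
  rewrite RintegralZl ?mp ?mulr0 //; first exact: measurable_Omega.
  exact: integrable_trig.
Qed.

Lemma H_sol phi : sol_trig_poly L phi -> H L phi.
Proof.
move=> sp; split; first exact: sol_L2.
move=> e e0; exists phi => //; rewrite subrr /nrm ip0l ?sqrtr0 //; exact: L20.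
Qed.

Lemma HD u v : H L u -> H L v -> H L (u + v).
Proof.
move=> [Lu Hu] [Lv Hv]; split; first exact: L2D.
move=> e e0; have e2 : 0 < e / 2 by rewrite divr_gt0.
have [phi sp hp] := Hu _ e2; have [psi sq hq] := Hv _ e2.
exists (phi + psi); first exact: sol_trig_polyD.
have Lp := sol_L2 hL sp; have Lq := sol_L2 hL sq.
rewrite opprD addrACA; apply: (le_lt_trans (nrmD_le (L2B Lu Lp) (L2B Lv Lq))).
by rewrite [ltRHS]splitr; exact: ltrD.
Qed.

Lemma HZ a u : H L u -> H L (a *: u).
Proof.
move=> [Lu Hu]; split; first exact: L2Z.
move=> e e0; have e2 : 0 < e / (`|a| + 1) by rewrite divr_gt0 // ltr_wpDl.
have [phi sp hp] := Hu _ e2; exists (a *: phi); first exact: sol_trig_polyZ.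
have Lp := sol_L2 hL sp.
rewrite -scalerBr nrmZ; last exact: L2B.
move: hp; rewrite ltr_pdivlMr ?ltr_wpDl // => hp; apply: le_lt_trans hp.
by rewrite mulrC ler_wpM2l ?nrm_ge0 // lerDl.
Qed.

Lemma HN u : H L u -> H L (- u).
Proof. by move=> /(HZ (-1)); rewrite scaleN1r. Qed.

Lemma HB u v : H L u -> H L v -> H L (u - v).
Proof. by move=> Hu /HN; exact: HD. Qed.

Lemma H_eb k : H L (eb k).
Proof. by apply: H_sol; exact: sol_eb. Qed.

Lemma H0 : H L 0.
Proof. by rewrite -(scale0r (eb 0)); apply: HZ; exact: H_eb. Qed.

Lemma H_sum (I : Type) (s : seq I) (F : I -> vfield R) :
  (forall i, H L (F i)) -> H L (\sum_(i <- s) F i).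
Proof.
move=> HF; elim: s => [|i s IH]; first by rewrite big_nil; exact: H0.
by rewrite big_cons; exact: HD.
Qed.

Lemma sol_sum (I : Type) (s : seq I) (F : I -> vfield R) :
  (forall i, sol_trig_poly L (F i)) -> sol_trig_poly L (\sum_(i <- s) F i).
Proof.
move=> HF; elim: s => [|i s IH]; last by rewrite big_cons; exact: sol_trig_polyD.
rewrite big_nil -(scale0r (eb 0)); apply: sol_trig_polyZ; exact: sol_eb.
Qed.

Definition comb (M : nat) (c : int * int -> R) : vfield R :=
  \sum_(k <- modes M) c k *: eb k.

Lemma projEcomb M u : proj M u = comb M (fun k => ip L u (eb k)).
Proof. by []. Qed.

Lemma sol_comb M c : sol_trig_poly L (comb M c).
Proof. by apply: sol_sum => k; apply: sol_trig_polyZ; exact: sol_eb. Qed.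

Lemma H_comb M c : H L (comb M c).
Proof. by apply: H_sol; exact: sol_comb. Qed.

Lemma L2_comb M c : L2 L (comb M c).
Proof. by apply: H_L2; exact: H_comb. Qed.

Lemma combE M c : comb M c = \sum_(k <- modes M) c k *: eb k. Proof. by []. Qed.

Lemma ip_combr M c u : L2 L u ->
  ip L u (comb M c) = \sum_(k <- modes M) c k * ip L u (eb k).
Proof.
move=> Lu; rewrite /comb ip_sumr //; last by move=> k; apply: L2Z; exact: L2_eb.
by apply: eq_bigr => k _; rewrite ipZr //; exact: L2_eb.
Qed.

Lemma ip_combl M c u : L2 L u ->
  ip L (comb M c) u = \sum_(k <- modes M) c k * ip L u (eb k).
Proof. by move=> Lu; rewrite ipC ip_combr. Qed.

Lemma ip_comb_eb M c k : k != 0 ->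
  ip L (comb M c) (eb k) = if k \in modes M then c k else 0.
Proof.
move=> k0'; rewrite ip_combl; last exact: L2_eb.
have E l : l \in modes M -> c l * ip L (eb k) (eb l) = c l * (k == l)%:R.
  by move=> /modes_neq0 l0; rewrite ip_eb_eb.
rewrite big_seq; under eq_bigr => l lM do rewrite E //.
rewrite -big_seq; case: ifP => kM.
  rewrite (bigD1_seq k) //=; last exact: modes_uniq.
  rewrite eqxx mulr1 big1 ?addr0 // => l lk.
  by rewrite eq_sym (negbTE lk) mulr0.
rewrite big_seq big1 // => l lM; have [kl|_] := eqVneq k l; last by rewrite mulr0.
by rewrite kl lM in kM.
Qed.

Lemma ip_comb_comb M c d :
  ip L (comb M c) (comb M d) = \sum_(k <- modes M) c k * d k.
Proof.
rewrite ip_combl; last exact: L2_comb.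
rewrite big_seq [RHS]big_seq; apply: eq_bigr => k kM.
by rewrite ip_comb_eb ?kM // (modes_neq0 kM).
Qed.

Lemma ip_proj M u v : L2 L u -> L2 L v -> ip L (proj M u) v = ip L u (proj M v).
Proof.
move=> Lu Lv; rewrite !projEcomb ip_combl // ip_combr //.
by apply: eq_bigr => k _; rewrite mulrC.
Qed.

Lemma proj_comb M c : proj M (comb M c) = comb M c.
Proof.
rewrite projEcomb /comb big_seq [RHS]big_seq; apply: eq_bigr => k kM.
by rewrite ip_comb_eb ?kM // (modes_neq0 kM).
Qed.

Lemma ip_proj_combl M c u : L2 L u -> ip L (u - proj M u) (comb M c) = 0.
Proof.
move=> Lu; rewrite ipBl //; try exact: L2_comb.
by rewrite ip_proj ?proj_comb ?subrr //; exact: L2_comb.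
Qed.

Lemma nrm_proj_split M u : L2 L u ->
  nrm L u ^+ 2 = nrm L (proj M u) ^+ 2 + nrm L (u - proj M u) ^+ 2.
Proof.
move=> Lu; have LP : L2 L (proj M u) by exact: L2_comb.
have := nrmD_sqr (L2B Lu LP) LP; rewrite subrK => ->.
by rewrite ip_proj_combl // mulr0 addr0 addrC.
Qed.

Lemma nrm_proj_le M u : L2 L u -> nrm L (proj M u) <= nrm L u.
Proof.
move=> Lu; rewrite -ler_sqr ?nnegrE ?nrm_ge0 // (nrm_proj_split M Lu).
by rewrite lerDl sqr_ge0.
Qed.

Lemma nrm_coproj_le M u : L2 L u -> nrm L (u - proj M u) <= nrm L u.
Proof.
move=> Lu; rewrite -ler_sqr ?nnegrE ?nrm_ge0 // [leRHS](nrm_proj_split M Lu).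
by rewrite lerDr sqr_ge0.
Qed.

Lemma nrm_proj_best M u c : L2 L u ->
  nrm L (u - proj M u) <= nrm L (u - comb M c).
Proof.
move=> Lu; have LP : L2 L (proj M u) by exact: L2_comb.
have Lc : L2 L (comb M c) by exact: L2_comb.
have := nrmD_sqr (L2B Lu LP) (L2B LP Lc).
have -> : ip L (u - proj M u) (proj M u - comb M c) = 0.
  apply: (etrans (ipBr LP Lc (L2B Lu LP))).
  have h1 : ip L (u - proj M u) (proj M u) = 0 by rewrite {2}projEcomb; exact: ip_proj_combl.
  have h2 : ip L (u - proj M u) (comb M c) = 0 by exact: ip_proj_combl.
  by rewrite h1 h2 subr0.
by rewrite subrKA mulr0 addr0; apply: sqr_le_add; exact: nrm_ge0.
Qed.

(** By the definition of H some divergence-free polynomial is within e of u; for large M it lies in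
    the range of the projection, which gives the best approximation from there. *)
Lemma proj_cvg u : H L u -> nrm L (u - proj M u) @[M --> \oo] --> (0 : R).
Proof.
move=> [Lu Hu]; apply/cvgrPdist_lt => e e0.
have [phi sp hp] := Hu _ e0; have [M0 hM0] := sol_expand hL sp.
exists M0 => // M /= M0M; rewrite sub0r normrN (ger0_norm (nrm_ge0 _ _)).
apply: le_lt_trans hp; rewrite (hM0 M M0M) projEcomb.
exact: nrm_proj_best.
Qed.

Lemma ip_proj_cvg u v : H L u -> L2 L v ->
  ip L (proj M u) v @[M --> \oo] --> ip L u v.
Proof.
move=> Hu Lv; have Lu := H_L2 Hu.
apply/cvgrPdist_le => e e0.
have /cvgrPdist_lt/(_ (e / (nrm L v + 1))) := proj_cvg Hu.
have v1 : 0 < nrm L v + 1 by rewrite ltr_wpDl // nrm_ge0.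
case; first by rewrite divr_gt0.
move=> M0 _ h; exists M0 => // M /= M0M; have := h M M0M.
rewrite sub0r normrN ger0_norm ?nrm_ge0 // ltr_pdivlMr // => h'.
have LP : L2 L (proj M u) by exact: L2_comb.
rewrite -ipBl // (le_trans (cauchy_schwarz (L2B Lu LP) Lv)) //.
apply: le_trans (ltW h'); rewrite ler_wpM2l ?nrm_ge0 // lerDl //.
Qed.

Lemma ip_proj_cvg_sum u v : H L u -> L2 L v ->
  \sum_(k <- modes M) ip L u (eb k) * ip L v (eb k) @[M --> \oo] --> ip L u v.
Proof.
move=> Hu Lv; have := ip_proj_cvg Hu Lv.
by under eq_fun do rewrite projEcomb ip_combl //.
Qed.

Lemma H_coef_eq0 u : H L u -> (forall k, k != 0 -> ip L u (eb k) = 0) -> nrm L u = 0.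
Proof.
move=> Hu u0; have := proj_cvg Hu.
have -> : (fun M => nrm L (u - proj M u)) = fun=> nrm L u.
  apply/funext => M; rewrite projEcomb /comb big_seq big1 ?subr0 // => k kM.
  by rewrite u0 ?scale0r // (modes_neq0 kM).
by move=> /(@cvg_lim _ _) => <- //; rewrite lim_cst.
Qed.

End HSpace.

(** * A and its powers in Fourier coordinates *)

Section Operators.
Context (R : realType) (L : R) (hL : 0 < L).
Local Notation eb := (eb L).
Local Notation lam := (lam L).
Local Notation proj := (proj L).
Local Notation comb := (comb L).
Implicit Types u v w g : vfield R.

Lemma laplacian_comb M c : laplacian (comb M c) = comb M (fun k => - lam k * c k).
Proof.
have tc k : trig_poly L (cas L k) by exact: trig_poly_cas.
have E j : (fun y => comb M c y 0 j) = fun y => \sum_(k <- modes M)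
    (c k * ((Num.sqrt (ksq R k) * L)^-1 * kperp R k j)) * cas L k y.
  apply/funext => y; rewrite !combE fct_sumE; apply: eq_bigr => k _.
  by rewrite !mxE !mulrA.
have T j k : trig_poly L (fun y : R * R =>
    (c k * ((Num.sqrt (ksq R k) * L)^-1 * kperp R k j)) * cas L k y).
  by apply: trig_polyZ.
apply/funext => x; apply/matrixP => a j; rewrite (ord1 a) {a} mxE.
under eq_bigr => i _.
  rewrite E (partial_sum i (modes M) (T j)) (partial_sum (L := L) i (modes M)); last first.
    by move=> k; apply: trig_poly_partial; exact: T.
  under eq_bigr => k _.
    rewrite (partialZ i _ (tc k)) partial_cas (partialZ (L := L) i); last exact: trig_polyZ.
    rewrite (partialZ i _ (trig_poly_cas L (- k))) partial_cas opprK.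
    over.
  over.
rewrite exchange_big /= !combE fct_sumE; apply: eq_bigr => k _.
rewrite !mxE !big_ord_recl big_ord0 /kc /= addr0 !mulrNz !lamE /ksq.
by rewrite intrD !rmorphXn /=; ring.
Qed.

(** The distributional definition tests with all divergence-free polynomials; these are finite
    combinations of the [eb k], on which the Laplacian is diagonal. *)
Lemma is_A_coef u g : is_A L u g <->
  [/\ H L u, H L g & forall k, k != 0 -> ip L g (eb k) = lam k * ip L u (eb k)].
Proof.
split=> [[Hu Hg E]|[Hu Hg E]]; split=> //; have Lu := H_L2 Hu; have Lg := H_L2 Hg.
- move=> k kn0; have [M kM] := modes_exhaust kn0.
  pose c l : R := (l == k)%:R.
  have Ek : eb k = comb M c.
    rewrite !combE (bigD1_seq k) ?modes_uniq //= /c eqxx scale1r big1 ?addr0 //.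
    by move=> l /negbTE ->; rewrite scale0r.
  rewrite {1}Ek (E _ (sol_comb hL M c)) laplacian_comb.
  rewrite ipNr //; last exact: L2_comb.
  rewrite ip_combr // (bigD1_seq k) ?modes_uniq //=.
  rewrite big1 ?addr0; last by move=> l /negbTE lk; rewrite /c lk mulr0 mul0r.
  by rewrite /c eqxx mulr1n; ring.
- move=> phi sp; have [M0 /(_ M0 (leqnn _)) ->] := sol_expand hL sp.
  rewrite projEcomb laplacian_comb ip_combr //.
  rewrite ipNr //; last exact: L2_comb.
  rewrite ip_combr // -sumrN big_seq [RHS]big_seq.
  apply: eq_bigr => k kM; rewrite E ?(modes_neq0 kM) //; ring.
Qed.

Lemma is_A_eb k : k != 0 -> is_A L (eb k) (lam k *: eb k).
Proof.
move=> kn0; apply/is_A_coef; split; [exact: H_eb|by apply: HZ => //; exact: H_eb|].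
move=> l l0; rewrite ipZl; try exact: L2_eb.
by rewrite ip_eb_eb //; have [<-|_] := eqVneq k l; rewrite ?mulr0.
Qed.

Lemma eigenvector_eb k : k != 0 -> eigenvector L (lam k) (eb k).
Proof.
move=> kn0; split; [exact: H_eb| |exact: is_A_eb].
by rewrite /nrm ip_eb_eb // eqxx sqrtr1 oner_neq0.
Qed.

Lemma eigenvector_coef lambda e k : eigenvector L lambda e -> k != 0 ->
  lam k != lambda -> ip L e (eb k) = 0.
Proof.
move=> [He _ /is_A_coef[_ _ E]] kn0 ne; have := E k kn0; have Le := H_L2 He.
rewrite ipZl //; last exact: L2_eb.
move=> /eqP; rewrite -subr_eq0 -mulrBl mulf_eq0 subr_eq0 eq_sym (negbTE ne) /=.
by move/eqP.
Qed.

(** The definition quantifies over all eigenvectors e. A coefficient of e vanishes unless [lam k] is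
    its eigenvalue, so the Parseval series of [(g, e)] and of [lambda^s (u, e)] agree term by
    term. *)
Lemma is_Apow_coef s u g : is_Apow L s u g <->
  [/\ H L u, H L g & forall k, k != 0 -> ip L g (eb k) = lam k `^ s * ip L u (eb k)].
Proof.
split=> [[Hu Hg E]|[Hu Hg E]]; split=> //.
  by move=> k kn0; apply: E; exact: eigenvector_eb.
move=> lambda e ee; have He : H L e by case: ee.
have c1 := ip_proj_cvg_sum hL Hg (H_L2 He).
have c2 : (fun M => (\sum_(k <- modes M) ip L u (eb k) * ip L e (eb k)) * lambda `^ s)
    @ \oo --> ip L u e * lambda `^ s.
  by apply: cvgM; [exact: (ip_proj_cvg_sum hL Hu (H_L2 He))|exact: cvg_cst].
have {}c1 : (fun M => (\sum_(k <- modes M) ip L u (eb k) * ip L e (eb k)) * lambda `^ s)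
    @ \oo --> ip L g e.
  apply: cvg_trans c1; apply: near_eq_cvg; exists 0%N => // M _ /=.
  rewrite mulr_suml big_seq [RHS]big_seq; apply: eq_bigr => k /modes_neq0 kn0.
  rewrite E //; have [<-|ne] := eqVneq (lam k) lambda; first by ring.
  by rewrite (eigenvector_coef ee) // !mulr0 mul0r.
by rewrite mulrC; apply: (cvg_unique _ c1 c2).
Qed.
End Operators.

Section PowersOfA.
Context (R : realType) (L : R) (hL : 0 < L).
Local Notation k0 := (kappa0 L).
Local Notation eb := (eb L).
Local Notation lam := (lam L).
Local Notation proj := (proj L).
Local Notation comb := (comb L).
Implicit Types u v w g : vfield R.

Lemma H_coef_ext u v : H L u -> H L v ->
  (forall k, k != 0 -> ip L u (eb k) = ip L v (eb k)) -> nrm L (u - v) = 0.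
Proof.
move=> Hu Hv E; apply: (H_coef_eq0 hL (HB hL Hu Hv)).
move=> k kn0; rewrite ipBl ?E ?subrr //; [exact: H_L2 Hu|exact: H_L2 Hv|exact: L2_eb].
Qed.

Lemma nrmB_eq0_nrm u v : L2 L u -> L2 L v -> nrm L (u - v) = 0 -> nrm L u = nrm L v.
Proof.
move=> Lu Lv E; apply/eqP; rewrite -subr_eq0 -normr_le0 -E; exact: nrm_dist_le.
Qed.

Lemma nrmB_eq0_ip u v w : L2 L u -> L2 L v -> L2 L w -> nrm L (u - v) = 0 ->
  ip L u w = ip L v w.
Proof. by move=> Lu Lv Lw /nrmB_eq0 E; apply: eqO_ip => //; apply: E. Qed.

Lemma Apow_spec s u : domApow L s u -> is_Apow L s u (Apow L s u).
Proof. by move=> [g h]; rewrite /Apow; apply: (@xgetPex _ 0 [set g | is_Apow L s u g]); exists g. Qed.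

Lemma A_spec u : domA L u -> is_A L u (A L u).
Proof. by move=> [g h]; rewrite /A; apply: (@xgetPex _ 0 [set g | is_A L u g]); exists g. Qed.

Lemma is_Apow_unique s u g g' : is_Apow L s u g -> is_Apow L s u g' -> nrm L (g - g') = 0.
Proof.
move=> /(is_Apow_coef hL)[_ Hg E] /(is_Apow_coef hL)[_ Hg' E'].
by apply: H_coef_ext => // k kn0; rewrite E // E'.
Qed.

Lemma is_A_unique u g g' : is_A L u g -> is_A L u g' -> nrm L (g - g') = 0.
Proof.
move=> /(is_A_coef hL)[_ Hg E] /(is_A_coef hL)[_ Hg' E'].
by apply: H_coef_ext => // k kn0; rewrite E // E'.
Qed.

Lemma is_ApowD s u v g h : is_Apow L s u g -> is_Apow L s v h ->
  is_Apow L s (u + v) (g + h).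
Proof.
move=> /(is_Apow_coef hL)[Hu Hg E] /(is_Apow_coef hL)[Hv Hh E'].
have Lu := H_L2 Hu; have Lv := H_L2 Hv; have Lg := H_L2 Hg; have Lh := H_L2 Hh.
apply/(is_Apow_coef hL); split; [exact: (HD hL Hu Hv)|exact: (HD hL Hg Hh)|].
move=> k kn0; have Lk := L2_eb hL k.
by rewrite !ipDl // E // E' // mulrDr.
Qed.

Lemma is_ApowZ s a u g : is_Apow L s u g -> is_Apow L s (a *: u) (a *: g).
Proof.
move=> /(is_Apow_coef hL)[Hu Hg E]; have Lu := H_L2 Hu; have Lg := H_L2 Hg.
apply/(is_Apow_coef hL); split; [exact: (HZ hL a Hu)|exact: (HZ hL a Hg)|].
by move=> k kn0; have Lk := L2_eb hL k; rewrite !ipZl // E //; ring.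
Qed.

Lemma is_ApowB s u v g h : is_Apow L s u g -> is_Apow L s v h ->
  is_Apow L s (u - v) (g - h).
Proof.
move=> hu hv; rewrite -scaleN1r -[X in is_Apow _ _ _ (_ + X)]scaleN1r.
by apply: is_ApowD => //; exact: is_ApowZ.
Qed.

Lemma is_Apow_comb s M c : is_Apow L s (comb M c) (comb M (fun k => lam k `^ s * c k)).
Proof.
apply/(is_Apow_coef hL); split; [exact: H_comb|exact: H_comb|].
by move=> k kn0; rewrite !ip_comb_eb //; case: ifP; rewrite ?mulr0.
Qed.

Lemma is_A_comb M c : is_A L (comb M c) (comb M (fun k => lam k * c k)).
Proof.
apply/(is_A_coef hL); split; [exact: H_comb|exact: H_comb|].
by move=> k kn0; rewrite !ip_comb_eb //; case: ifP; rewrite ?mulr0.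
Qed.

Lemma is_Apow_proj s M u g : is_Apow L s u g -> is_Apow L s (proj M u) (proj M g).
Proof.
move=> /(is_Apow_coef hL)[Hu Hg E]; apply/(is_Apow_coef hL); split; [exact: H_comb|exact: H_comb|].
move=> k kn0; rewrite !projEcomb !ip_comb_eb //; case: ifP; rewrite ?mulr0 // => _.
exact: E.
Qed.

Lemma V_spec u : V L u -> is_Apow L 2^-1 u (Apow L 2^-1 u).
Proof. exact: Apow_spec. Qed.

Lemma V_H u : V L u -> H L u. Proof. by move=> /V_spec[]. Qed.

Lemma V_L2 u : V L u -> L2 L u. Proof. by move=> /V_H/H_L2. Qed.

Lemma L2_Apow u : V L u -> L2 L (Apow L 2^-1 u).
Proof. by move=> /V_spec[_ /H_L2]. Qed.

Lemma VD u v : V L u -> V L v -> V L (u + v).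
Proof. by move=> /V_spec hu /V_spec hv; eexists; exact: is_ApowD hu hv. Qed.

Lemma VZ a u : V L u -> V L (a *: u).
Proof. by move=> /V_spec hu; eexists; exact: is_ApowZ hu. Qed.

Lemma VB u v : V L u -> V L v -> V L (u - v).
Proof. by move=> /V_spec hu /V_spec hv; eexists; exact: is_ApowB hu hv. Qed.

Lemma V_comb M c : V L (comb M c).
Proof. by eexists; exact: is_Apow_comb. Qed.

Lemma V_proj M u : V L (proj M u).
Proof. by rewrite projEcomb; exact: V_comb. Qed.

Lemma domA_comb M c : domA L (comb M c).
Proof. by eexists; exact: is_A_comb. Qed.

Lemma Vnrm_eq u g : is_Apow L 2^-1 u g -> Vnrm L u = nrm L g.
Proof.
move=> hg; have hu := V_spec (ex_intro _ g hg).
apply: nrmB_eq0_nrm (is_Apow_unique hu hg).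
  by case: hu => _ /H_L2.
by case: hg => _ /H_L2.
Qed.

Lemma Vnrm_ge0 u : 0 <= Vnrm L u. Proof. exact: nrm_ge0. Qed.

Lemma VnrmD_le u v : V L u -> V L v -> Vnrm L (u + v) <= Vnrm L u + Vnrm L v.
Proof.
move=> Vu Vv; rewrite (Vnrm_eq (is_ApowD (V_spec Vu) (V_spec Vv))).
by apply: nrmD_le; exact: L2_Apow.
Qed.

Lemma VnrmZ a u : V L u -> Vnrm L (a *: u) = `|a| * Vnrm L u.
Proof.
by move=> Vu; rewrite (Vnrm_eq (is_ApowZ a (V_spec Vu))) nrmZ //; exact: L2_Apow.
Qed.

Lemma Vnrm_dist_le u v : V L u -> V L v ->
  `|Vnrm L u - Vnrm L v| <= Vnrm L (u - v).
Proof.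
move=> Vu Vv; rewrite (Vnrm_eq (is_ApowB (V_spec Vu) (V_spec Vv))).
by apply: nrm_dist_le; exact: L2_Apow.
Qed.

Lemma Vnrm_coproj_cvg u : V L u -> Vnrm L (u - proj M u) @[M --> \oo] --> (0 : R).
Proof.
move=> /V_spec hu; have Hg : H L (Apow L 2^-1 u) by case: hu.
have := proj_cvg hL Hg; apply: cvg_trans; apply: near_eq_cvg; exists 0%N => // M _ /=.
by rewrite (Vnrm_eq (is_ApowB hu (is_Apow_proj M hu))).
Qed.

Lemma Vnrm_proj_split M u : V L u ->
  Vnrm L u ^+ 2 = Vnrm L (proj M u) ^+ 2 + Vnrm L (u - proj M u) ^+ 2.
Proof.
move=> Vu; have hu := V_spec Vu; rewrite (Vnrm_eq (is_ApowB hu (is_Apow_proj M hu))).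
by rewrite (Vnrm_eq (is_Apow_proj M hu)) -nrm_proj_split //; exact: L2_Apow.
Qed.

Lemma Vnrm_proj_le M u : V L u -> Vnrm L (proj M u) <= Vnrm L u.
Proof.
move=> Vu; have hu := V_spec Vu; rewrite (Vnrm_eq (is_Apow_proj M hu)).
by apply: nrm_proj_le => //; exact: L2_Apow.
Qed.

Lemma Vnrm_coproj_le M u : V L u -> Vnrm L (u - proj M u) <= Vnrm L u.
Proof.
move=> Vu; have hu := V_spec Vu; rewrite (Vnrm_eq (is_ApowB hu (is_Apow_proj M hu))).
by apply: nrm_coproj_le => //; exact: L2_Apow.
Qed.

Lemma lam_half k : lam k `^ 2^-1 * lam k `^ 2^-1 = lam k.
Proof. by rewrite powR12_sqrt ?lam_ge0 // -expr2 sqr_sqrtr // lam_ge0. Qed.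

Lemma ip_Apow_eb u k : V L u -> k != 0 ->
  ip L (Apow L 2^-1 u) (eb k) = lam k `^ 2^-1 * ip L u (eb k).
Proof. by move=> /V_spec/(is_Apow_coef hL)[_ _]; exact. Qed.

Lemma ip_Apow_cvg u v : V L u -> V L v ->
  \sum_(k <- modes M) lam k * (ip L u (eb k) * ip L v (eb k)) @[M --> \oo] -->
  ip L (Apow L 2^-1 u) (Apow L 2^-1 v).
Proof.
move=> Vu Vv; have Hg : H L (Apow L 2^-1 u) by case: (V_spec Vu).
have := ip_proj_cvg_sum hL Hg (L2_Apow Vv).
apply: cvg_trans; apply: near_eq_cvg; exists 0%N => // M _ /=.
rewrite big_seq [RHS]big_seq; apply: eq_bigr => k /modes_neq0 kn0.
by rewrite !ip_Apow_eb // -[in RHS]lam_half; ring.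
Qed.

Lemma Vnrm_sqr u : Vnrm L u ^+ 2 = ip L (Apow L 2^-1 u) (Apow L 2^-1 u).
Proof. by rewrite /Vnrm nrm_sqr. Qed.

(** Termwise comparison of two Parseval series. With [c = k0^2] it is the usual Poincare inequality,
    with [c = (k0 M)^2] the sharper one for fields without modes up to M. *)
Lemma poincare c u : V L u -> 0 <= c ->
  (forall k, k != 0 -> lam k < c -> ip L u (eb k) = 0) ->
  c * nrm L u ^+ 2 <= Vnrm L u ^+ 2.
Proof.
move=> Vu c0 h; rewrite nrm_sqr Vnrm_sqr.
have c1 : (fun M => c * \sum_(k <- modes M) ip L u (eb k) * ip L u (eb k)) @ \oo
    --> c * ip L u u.
  by apply: cvgM; [exact: cvg_cst|exact: (ip_proj_cvg_sum hL (V_H Vu) (V_L2 Vu))].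
apply: (ler_cvg_to c1 (ip_Apow_cvg Vu Vu)); exists 0%N => // M _ /=.
rewrite mulr_sumr big_seq [leRHS]big_seq ler_sum // => k /modes_neq0 kn0.
have [lc|lc] := ltP (lam k) c; first by rewrite h // !mulr0.
by rewrite ler_wpM2r // -expr2 sqr_ge0.
Qed.

Lemma poincare_V u : V L u -> k0 * nrm L u <= Vnrm L u.
Proof.
move=> Vu; have p0 := kappa0_gt0 hL.
rewrite -ler_sqr ?nnegrE ?Vnrm_ge0 ?(mulr_ge0 (ltW p0) (nrm_ge0 L _)) // exprMn.
apply: poincare => //; first exact: sqr_ge0.
by move=> k kn0; rewrite ltNge lam_ge.
Qed.

Lemma poincare_high M u : V L u -> (forall k, k \in modes M -> ip L u (eb k) = 0) ->
  k0 * M%:R * nrm L u <= Vnrm L u.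
Proof.
move=> Vu h; have p0 := kappa0_gt0 hL.
rewrite -ler_sqr ?nnegrE ?Vnrm_ge0
  ?(mulr_ge0 (mulr_ge0 (ltW p0) (ler0n _ _)) (nrm_ge0 L _)) // exprMn.
apply: poincare => //; first exact: sqr_ge0.
by move=> k kn0 lk; apply: h; rewrite (mem_modes_lam hL) kn0 ltW.
Qed.

Lemma inverse_poincare M c : Vnrm L (comb M c) <= k0 * M%:R * nrm L (comb M c).
Proof.
have p0 := kappa0_gt0 hL.
rewrite -ler_sqr ?nnegrE ?Vnrm_ge0
  ?(mulr_ge0 (mulr_ge0 (ltW p0) (ler0n _ _)) (nrm_ge0 L _)) // exprMn.
rewrite (Vnrm_eq (is_Apow_comb 2^-1 M c)) !nrm_sqr !ip_comb_comb // mulr_sumr.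
rewrite big_seq [leRHS]big_seq ler_sum // => k; rewrite (mem_modes_lam hL) => /andP[kn0 lk].
rewrite (_ : _ * _ * _ = lam k * (c k * c k)); last by rewrite -[in RHS]lam_half; ring.
by rewrite ler_wpM2r // -expr2 sqr_ge0.
Qed.

Lemma nrm_A_comb M c : nrm L (A L (comb M c)) = nrm L (comb M (fun k => lam k * c k)).
Proof.
have hc := is_A_comb M c; have hA := A_spec (domA_comb M c).
apply: nrmB_eq0_nrm (is_A_unique hA hc); first by case: hA => _ /H_L2.
exact: L2_comb.
Qed.

End PowersOfA.

Lemma sqr_inj (R : realDomainType) (a b : R) :
  0 <= a -> 0 <= b -> a ^+ 2 = b ^+ 2 -> a = b.
Proof. by move=> a0 b0 /eqP; rewrite eqrXn2 // => /eqP. Qed.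

(** * [P_N] and [Q_N] in Fourier coordinates *)

Section Projections.
Context (R : realType) (L : R) (hL : 0 < L) (N : nat).
Local Notation eb := (eb L).
Local Notation lam := (lam L).
Local Notation proj := (proj L).
Local Notation comb := (comb L).
Implicit Types u v w q : vfield R.

Lemma PNH_H q : PNH L N q -> H L q.
Proof.
move=> [n [c [e [he ->]]]]; apply: H_sum => // i; apply: HZ => //.
by have [lambda _ []] := he i.
Qed.

Lemma PNH_L2 q : PNH L N q -> L2 L q. Proof. by move=> /PNH_H/H_L2. Qed.

Lemma PNH_coef q k : PNH L N q -> k != 0 -> k \notin modes N -> ip L q (eb k) = 0.
Proof.
move=> [n [c [e [he ->]]]] kn0 kN; have Le i : L2 L (e i).
  by have [lambda _ [/H_L2]] := he i.
rewrite ip_suml //; last exact: L2_eb.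
  apply: big1 => i _; rewrite ipZl //; last exact: L2_eb.
  have [lambda hl ee] := he i; rewrite (eigenvector_coef hL ee) ?mulr0 //.
  apply: contra kN => /eqP lk; by rewrite (mem_modes_lam hL) kn0 lk.
by move=> i; exact: L2Z.
Qed.

Lemma PNH_comb c : PNH L N (comb N c).
Proof.
pose k (i : 'I_(size (modes N))) := nth 0 (modes N) i.
exists (size (modes N)), (fun i => c (k i)), (fun i => eb (k i)); split.
  move=> i; have : k i \in modes N by exact: mem_nth.
  rewrite (mem_modes_lam hL) => /andP[kn0 lk]; exists (lam (k i)) => //.
  exact: eigenvector_eb.
by rewrite !combE (big_nth 0) big_mkord.
Qed.

(** [PNH] admits arbitrary eigenvectors, which are determined only up to null sets, so q need not
    coincide pointwise with its Fourier sum. *)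
Lemma PNH_nrm_proj q : PNH L N q -> nrm L (q - proj N q) = 0.
Proof.
move=> hq; apply: (H_coef_ext hL (PNH_H hq) (H_comb hL _ _)).
move=> k kn0; rewrite ip_comb_eb //; case: ifPn => // kN.
exact: PNH_coef.
Qed.

Lemma PNH_ip q u : PNH L N q -> L2 L u -> ip L q u = ip L (proj N q) u.
Proof.
move=> hq Lu; apply: nrmB_eq0_ip => //; [exact: PNH_L2|exact: L2_comb|].
exact: PNH_nrm_proj.
Qed.

Lemma is_Apow_PNH s q : PNH L N q ->
  is_Apow L s q (comb N (fun k => lam k `^ s * ip L q (eb k))).
Proof.
move=> hq; apply/is_Apow_coef => //; split; [exact: PNH_H|exact: H_comb|].
move=> k kn0; rewrite ip_comb_eb //; case: ifPn => // kN.
by rewrite PNH_coef // mulr0.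
Qed.

Lemma PNH_V q : PNH L N q -> V L q.
Proof. by move=> /(is_Apow_PNH 2^-1) h; eexists; exact: h. Qed.

Lemma PNH_Vnrm q : PNH L N q -> Vnrm L (proj N q) = Vnrm L q.
Proof.
move=> hq; have Vq := PNH_V hq.
have h := is_ApowB hL (V_spec Vq) (is_Apow_proj hL N (V_spec Vq)).
have := Vnrm_proj_split hL N Vq; rewrite (Vnrm_eq hL h).
have H0' : H L (Apow L 2^-1 q - proj N (Apow L 2^-1 q)) by case: h.
rewrite (H_coef_eq0 hL H0') => [|k kn0].
  rewrite expr0n addr0 => /esym; apply: sqr_inj; exact: Vnrm_ge0.
rewrite ipBl; [|exact: L2_Apow|exact: L2_comb|exact: L2_eb].
rewrite projEcomb ip_comb_eb //; case: ifPn => kN; first by rewrite subrr.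
by rewrite ip_Apow_eb // PNH_coef // mulr0 subr0.
Qed.

Lemma is_A_PNH q : PNH L N q -> is_A L q (comb N (fun k => lam k * ip L q (eb k))).
Proof.
move=> hq; apply/is_A_coef => //; split; [exact: PNH_H|exact: H_comb|].
move=> k kn0; rewrite ip_comb_eb //; case: ifPn => // kN.
by rewrite PNH_coef // mulr0.
Qed.

Lemma PN_spec u : H L u ->
  PNH L N (PN L N u) /\ forall q, PNH L N q -> ip L (PN L N u) q = ip L u q.
Proof.
move=> Hu; have Lu := H_L2 Hu; rewrite /PN.
set P := [set p | _].
have [hP1 hP2] : P (xget 0 P).
  apply: (@xgetPex _ 0 P); exists (proj N u); split; first exact: PNH_comb.
  move=> q hq; have LP : L2 L (u - proj N u) by apply: L2B => //; exact: L2_comb.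
  by rewrite ipC PNH_ip // ipC ip_proj_combl.
split=> // q hq; have Lq := PNH_L2 hq; have LP := PNH_L2 hP1.
by apply/eqP; rewrite eq_sym -subr_eq0 -ipBl // hP2.
Qed.

Lemma PN_H u : H L u -> H L (PN L N u).
Proof. by move=> /PN_spec[/PNH_H]. Qed.

Lemma QN_H u : H L u -> H L (QN L N u).
Proof. by move=> Hu; exact: (HB hL Hu (PN_H Hu)). Qed.

Lemma ip_QN_low u k : H L u -> k \in modes N -> ip L (QN L N u) (eb k) = 0.
Proof.
move=> Hu kN; have [h1 h2] := PN_spec Hu.
have Lu := H_L2 Hu; have LP := PNH_L2 h1; have Lk := L2_eb hL k.
rewrite /QN ipBl //; have -> : ip L (PN L N u) (eb k) = ip L u (eb k).
  have Ek : eb k = comb N (fun l => (l == k)%:R).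
    rewrite !combE (bigD1_seq k) ?modes_uniq //= eqxx scale1r big1 ?addr0 //.
    by move=> l /negbTE ->; rewrite scale0r.
  by rewrite Ek h2 //; exact: PNH_comb.
by rewrite subrr.
Qed.

Lemma ip_QN_high u k : H L u -> k != 0 -> k \notin modes N ->
  ip L (QN L N u) (eb k) = ip L u (eb k).
Proof.
move=> Hu kn0 kN; have [h1 h2] := PN_spec Hu.
have Lu := H_L2 Hu; have LP := PNH_L2 h1; have Lk := L2_eb hL k.
by rewrite /QN ipBl // (PNH_coef h1 kn0 kN) subr0.
Qed.

Lemma QNH_coef w k : QNH L N w -> k \in modes N -> ip L w (eb k) = 0.
Proof.
move=> [Hw E] kN; rewrite -(ip_QN_low Hw kN); apply: eqO_ip => //; first exact: H_L2.
- by apply: H_L2; exact: QN_H.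
- exact: L2_eb.
Qed.

Lemma QNH_intro w : H L w -> (forall k, k \in modes N -> ip L w (eb k) = 0) ->
  QNH L N w.
Proof.
move=> Hw h; split=> //; apply: nrmB_eq0 => //; [exact: H_L2|exact: H_L2 (QN_H Hw)|].
apply: (H_coef_ext hL Hw (QN_H Hw)).
move=> k kn0; have [kN|kN] := boolP (k \in modes N).
  by rewrite h // ip_QN_low.
by rewrite ip_QN_high.
Qed.

End Projections.

(** * Completeness of [L^2] *)

Section RieszFischer.
Context d (T : measurableType d) (R : realType) (mu : {measure set T -> \bar R}).
Context (D : set T) (mD : measurable D).

Lemma limn_einf_le (u : nat -> \bar R) (e : \bar R) (J : nat) :
  (forall j, (J <= j)%N -> (u j <= e)%E) -> (limn_einf u <= e)%E.
Proof.
move=> ue; rewrite limn_einf_lim (cvg_lim _ (@cvg_einfs_sup _ u)) //.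
apply: ge_ereal_sup => _ [n _ <-].
apply: (@le_trans _ _ (u (n + J)%N)); last by apply: ue; rewrite leq_addl.
by apply: ereal_inf_lbound; exists (n + J)%N => //=; rewrite leq_addr.
Qed.

Lemma cvgn_telescope (u : nat -> R) (v : nat -> R) :
  (forall j, 0 <= v j) -> cvgn (series v) ->
  (forall j, `|u j.+1 - u j| <= v j) -> cvgn u.
Proof.
move=> v0 cv uv.
have : cvgn (series (telescope u)).
  apply: normed_cvg; apply: (series_le_cvg _ v0 _ cv) => n /=; first exact: normr_ge0.
  exact: uv.
move=> c; have -> : u = (fun n => u 0%N + series (telescope u) n).
  by apply/funext => n; exact: eq_sum_telescope.
by apply: is_cvgD => //; exact: is_cvg_cst.
Qed.

(* Only the rate 4^-j along a subsequence matters: then the functions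
   2^j (f_(j+1) - f_j)^2 have a summable, hence a.e. finite, sum. *)
Lemma fast_cauchy_ae_cvg (f : nat -> T -> R) :
  (forall n, measurable_fun D (f n)) ->
  (forall j, (\int[mu]_(x in D) ((f j.+1 x - f j x) ^+ 2)%:E <= ((4 ^-1) ^+ j)%:E)%E) ->
  \forall x \ae mu, D x -> cvgn (f ^~ x).
Proof.
move=> mf fI.
pose h j x := ((2 ^+ j) * (f j.+1 x - f j x) ^+ 2)%:E.
have mh j : measurable_fun D (h j).
  apply/measurable_EFinP; apply: measurable_funM; first exact: measurable_cst.
  by apply: measurable_funX; exact: measurable_funB.
have h0 j x : D x -> (0 <= h j x)%E by move=> _; rewrite lee_fin mulr_ge0 ?sqr_ge0.
have Ih j : (\int[mu]_(x in D) h j x <= (geometric 1 (2^-1) j)%:E)%E.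
  under eq_integral do rewrite /h EFinM.
  rewrite ge0_integralZl //; first last.
  - by move=> x _; rewrite lee_fin sqr_ge0.
  - by apply/measurable_EFinP; apply: measurable_funX; exact: measurable_funB.
  apply: (@le_trans _ _ ((2 ^+ j)%:E * (4^-1 ^+ j)%:E)%E); first by rewrite lee_pmul2l.
  by rewrite -EFinM lee_fin /= mul1r -exprMn (_ : 2 * 4^-1 = 2^-1) //; field.
have fin : (\int[mu]_(x in D) \sum_(0 <= j <oo) h j x < +oo)%E.
  rewrite integral_nneseries //.
  apply: (@le_lt_trans _ _ (\sum_(0 <= j <oo) (geometric 1 (2^-1) j)%:E)%E).
    by apply: lee_nneseries => // j _ _; apply: integral_ge0 => x Dx; exact: h0.
  have c : cvgn (series (geometric (1 : R) 2^-1)).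
    by apply: is_cvg_geometric_series; rewrite ger0_norm // invf_lt1 // ltr1n.
  rewrite (_ : (\sum_(0 <= j <oo) _)%E = (limn (series (geometric (1 : R) 2^-1)))%:E) ?ltry //.
  rewrite -EFin_lim //; congr (limn _); apply/funext => n /=.
  by rewrite /series /= -sumEFin.
have mS : measurable_fun D (fun x => \sum_(0 <= j <oo) h j x)%E.
  by apply: ge0_emeasurable_sum => // j x Dx _; exact: h0.
have IS : mu.-integrable D (fun x => \sum_(0 <= j <oo) h j x)%E.
  apply/integrableP; split => //; apply: le_lt_trans fin.
  apply: ge0_le_integral => //; first exact: measurableT_comp.
  by move=> x Dx; rewrite gee0_abs //; apply: nneseries_ge0 => j _ _; exact: h0.
apply: filterS (integrable_ae mD IS) => x hx Dx; have {}hx := hx Dx.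
pose v j := 2 ^+ j * (f j.+1 x - f j x) ^+ 2.
have v0 j : 0 <= v j by rewrite mulr_ge0 ?sqr_ge0.
have cv : cvgn (series v).
  apply: nondecreasing_is_cvgn.
    by apply: nondecreasing_series => n _ _; exact: v0.
  exists (fine (\sum_(0 <= j <oo) h j x)%E) => _ [n _ <-].
  rewrite -lee_fin fineK // /series /= -sumEFin.
  apply: (nneseries_lim_ge n) => j _ _; exact: h0.
pose b j := v j + (2^-1) ^+ j.
apply: (@cvgn_telescope _ b).
- by move=> j; rewrite addr_ge0 ?v0 // exprn_ge0.
- have -> : b = (v + geometric 1 2^-1)%R.
    by apply/funext => j; rewrite /b -[(2^-1) ^+ j]mul1r.
  rewrite seriesD; apply: is_cvgD => //.
  by apply: is_cvg_geometric_series; rewrite ger0_norm // invf_lt1 // ltr1n.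
(* By Young's inequality [t <= 2^j t^2 + 2^-j], and both series converge. *)
- move=> j; rewrite /b /v; set t := `|_|.
  rewrite -real_normK ?num_real // -/t exprVn.
  have p0 : 0 < (2 : R) ^+ j by rewrite exprn_gt0.
  rewrite -(ler_pM2r p0) mulrDl mulVf ?gt_eqF //.
  have := sqr_ge0 (2 ^+ j * t - 1); have : 0 <= t by exact: normr_ge0.
  move: (2 ^+ j) p0 => p p0 t0; nra.
Qed.

Lemma L2_complete (f : nat -> T -> R) :
  (forall n, measurable_fun D (f n)) ->
  (forall e : R, 0 < e -> exists N, forall m n, (N <= m)%N -> (N <= n)%N ->
     (\int[mu]_(x in D) ((f m x - f n x) ^+ 2)%:E <= e%:E)%E) ->
  exists2 g : T -> R, measurable_fun D g &
    forall e : R, 0 < e -> exists N, forall n, (N <= n)%N ->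
      (\int[mu]_(x in D) ((g x - f n x) ^+ 2)%:E <= e%:E)%E.
Proof.
move=> mf fC.
have q0 j : 0 < (4^-1 : R) ^+ j by rewrite exprn_gt0.
have [r hr] := choice (fun j => fC _ (q0 j)).
(* A nondecreasing choice of indices with [r j <= n_ j], so that consecutive terms have the required
   rate, and [j <= n_ j], so that the subsequence runs to infinity. *)
pose n_ j := (\sum_(i < j.+1) (r i).+1)%N.
have n_r j : (r j <= n_ j)%N by rewrite /n_ big_ord_recr /= (leq_trans (leqnSn _)) // leq_addl.
have n_S j : (n_ j <= n_ j.+1)%N by rewrite /n_ [leqRHS]big_ord_recr /= leq_addr.
have n_ge : forall j, (j <= n_ j)%N.
  elim=> [//|i IH]; rewrite /n_ big_ord_recr /= addnS ltnS.
  exact: leq_trans IH (leq_addr _ _).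
pose F j := f (n_ j).
have := @fast_cauchy_ae_cvg F (fun j => mf _).
case; first by move=> j; apply: hr; rewrite // (leq_trans (n_r j)) // n_S.
move=> A [mA A0 sA].
(* Setting the functions to 0 on the null set A makes the sequence converge at every point of D, as
   the measurability of the limit requires. *)
pose F' j x := F j x * \1_(~` A) x.
have mF' j : measurable_fun D (F' j).
  apply: measurable_funM; first exact: mf.
  by apply: measurable_indic; exact: measurableC.
have F'A j x : ~ A x -> F' j x = F j x.
  by move=> xA; rewrite /F' indicE mem_set // mulr1.
have cF' x : D x -> F' ^~ x @ \oo --> limn (F' ^~ x).
  move=> Dx; have [xA|xA] := pselect (A x).
    have -> : F' ^~ x = cst 0.
      by apply/funext => j; rewrite /F' indicE memNset ?mulr0 // => /(_ xA).
    by rewrite lim_cst //; exact: cvg_cst.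
  have -> : F' ^~ x = F ^~ x by apply/funext => j; exact: F'A.
  have cFx : cvgn (F ^~ x).
    by apply: contrapT => nc; apply: xA; apply: sA => /= h; apply: nc; exact: h.
  exact: cFx.
have mg : measurable_fun D (fun x => limn (F' ^~ x)).
  exact: (measurable_fun_cvg mF' cF').
exists (fun x => limn (F' ^~ x)) => // e e0.
have [N hN] := fC e e0; exists N => m Nm.
have mh j : measurable_fun D (fun x => ((F' j x - f m x) ^+ 2)%:E).
  by apply/measurable_EFinP; apply: measurable_funX; exact: measurable_funB.
have h0 j x : D x -> (0 <= ((F' j x - f m x) ^+ 2)%:E)%E.
  by move=> _; rewrite lee_fin sqr_ge0.
(* The squared distance from the limit to [f m] is at most the lower limit of the squared distances
   between terms of the sequence. *)
have := fatou mu mD mh h0.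
have -> : (\int[mu]_(x in D) limn_einf (fun j => ((F' j x - f m x) ^+ 2)%:E) =
    \int[mu]_(x in D) ((limn (F' ^~ x) - f m x) ^+ 2)%:E)%E.
  apply: eq_integral => x; rewrite inE => Dx.
  have c : (fun j => ((F' j x - f m x) ^+ 2)%:E) @ \oo -->
      ((limn (F' ^~ x) - f m x) ^+ 2)%:E.
    apply/cvg_EFin; first exact: nearW.
    have cB : (fun j => F' j x - f m x) @ \oo --> limn (F' ^~ x) - f m x.
      by apply: cvgB; [exact: cF'|exact: cvg_cst].
    rewrite expr2; under eq_fun do rewrite expr2.
    exact: (cvgM cB cB).
  by rewrite (cvg_limn_einf_sup c).
move/le_trans; apply; apply: (@limn_einf_le _ _ N) => j Nj.
rewrite (_ : (\int[mu]_(x in D) _)%E =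
    (\int[mu]_(x in D) ((F j x - f m x) ^+ 2)%:E)%E); first exact: hN (leq_trans Nj (n_ge j)) Nm.
apply: ae_eq_integral => //.
  by apply/measurable_EFinP; apply: measurable_funX; apply: measurable_funB; exact: mf.
exists A; split=> // x /= nx; apply: contrapT => xA; apply: nx => Dx.
by rewrite F'A.
Qed.

End RieszFischer.

(** * Weak derivatives of fields in V *)

Section WeakPartial.
Context (R : realType) (L : R) (hL : 0 < L).
Local Notation mu := (@leb2 R).
Local Notation D := (Omega L).
Local Notation k0 := (kappa0 L).
Local Notation eb := (eb L).
Local Notation lam := (lam L).
Local Notation proj := (proj L).
Local Notation comb := (comb L).
Implicit Types u v w y : vfield R.

Lemma EFin_ips f g : L2s L f -> L2s L g ->
  (\int[mu]_(x in D) (f x * g x)%:E)%E = (ips L f g)%:E.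
Proof.
move=> Lf Lg; rewrite /ips /Rintegral fineK //.
apply: integrable_fin_num; first exact: measurable_Omega.
exact: integrable_mul.
Qed.

Lemma ips_mul_bound (b f : R * R -> R) (C : R) : measurable_fun D b ->
  (forall x, `|b x| <= C) -> L2s L f ->
  ips L (fun x => b x * f x) (fun x => b x * f x) <= C ^+ 2 * ips L f f.
Proof.
move=> mb bC Lf; have Lbf := L2sM mb bC Lf; have mD := measurable_Omega L.
have LCf := L2sZ C Lf.
rewrite [leRHS](_ : _ = ips L (fun x => C * f x) (fun x => C * f x)); last first.
  by rewrite ipsZl // ipsZr // expr2 mulrA.
apply: le_Rintegral => //; try exact: integrable_mul.
move=> x _; rewrite -!expr2 !exprMn ler_wpM2r ?sqr_ge0 //.
rewrite -[b x ^+ 2]real_normK ?num_real // ler_sqr ?nnegrE ?normr_ge0 //.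
by rewrite (le_trans (normr_ge0 _) (bC x)).
Qed.

Lemma ips_comp_le u i : ips L (fun x => u x 0 i) (fun x => u x 0 i) <= nrm L u ^+ 2.
Proof.
rewrite nrm_sqr ipE (bigD1 i) //= lerDl sumr_ge0 // => j _; exact: ips_ge0.
Qed.

Lemma comb_comp M c j : (fun x => comb M c x 0 j) = fun x =>
  \sum_(k <- modes M) (c k * ((Num.sqrt (ksq R k) * L)^-1 * kperp R k j)) * cas L k x.
Proof.
apply/funext => x; rewrite !combE fct_sumE; apply: eq_bigr => k _.
by rewrite !mxE !mulrA.
Qed.

Lemma trig_poly_comb M c j : trig_poly L (fun x => comb M c x 0 j).
Proof. by have [] := sol_comb hL M c. Qed.

Lemma partial_comb M c i j : partial i (fun x => comb M c x 0 j) = fun x =>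
  \sum_(k <- modes M)
   (c k * ((Num.sqrt (ksq R k) * L)^-1 * kperp R k j) * (k0 * kc R k i)) * cas L (- k) x.
Proof.
have tc k : trig_poly L (cas L k) by exact: trig_poly_cas.
rewrite comb_comp (@partial_sum R L); last by move=> k; exact: trig_polyZ.
apply/funext => x; apply: eq_bigr => k _.
by rewrite (partialZ i _ (tc k)) partial_cas; ring.
Qed.

Lemma ips_sum_casN M (d : int * int -> R) :
  ips L (fun x => \sum_(k <- modes M) d k * cas L (- k) x)
        (fun x => \sum_(k <- modes M) d k * cas L (- k) x) =
  \sum_(k <- modes M) L ^+ 2 * d k ^+ 2.
Proof.
have Lc k : L2s L (fun x => d k * cas L (- k) x) by apply: L2sZ; exact: L2s_cas.
rewrite ips_suml //; last exact: L2s_sum.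
rewrite big_seq [RHS]big_seq; apply: eq_bigr => k kM.
rewrite ipsC ips_suml // (bigD1_seq k) ?modes_uniq //= big1 ?addr0.
  by rewrite ipsZl ?ipsZr ?ips_cas ?eqxx //; try exact: L2s_cas; rewrite mulr1; ring.
move=> l lk; rewrite ipsZl ?ipsZr ?ips_cas //; try exact: L2s_cas.
by rewrite eqr_opp (negbTE lk) !mulr0.
Qed.

Lemma kperp_le k j : kperp R k j ^+ 2 <= ksq R k.
Proof. by rewrite -(kperp_sq R k) (bigD1 j) //= lerDl sumr_ge0 // => i _; exact: sqr_ge0. Qed.

Lemma kc_le k i : kc R k i ^+ 2 <= ksq R k.
Proof.
rewrite /kc /ksq intrD !rmorphXn /=; case: ifP => _; rewrite ?lerDl ?lerDr sqr_ge0 //.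
Qed.

(** Parseval for one entry of the gradient: the direction contributes [(k^perp_j)^2 / |k|^2 <= 1]
    and the derivative [k_i^2 <= |k|^2]. *)
Lemma ips_partial_comb_le M c i j :
  ips L (partial i (fun x => comb M c x 0 j)) (partial i (fun x => comb M c x 0 j))
  <= \sum_(k <- modes M) lam k * c k ^+ 2.
Proof.
rewrite partial_comb ips_sum_casN big_seq [leRHS]big_seq ler_sum // => k /modes_neq0 kn0.
have q0 := ksq_gt0 R kn0.
have s0 : Num.sqrt (ksq R k) != 0 by rewrite gt_eqF // sqrtr_gt0.
have E : L ^+ 2 * (c k * ((Num.sqrt (ksq R k) * L)^-1 * kperp R k j) * (k0 * kc R k i)) ^+ 2
    = (k0 ^+ 2 * c k ^+ 2) * (kperp R k j ^+ 2 / ksq R k * kc R k i ^+ 2).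
  move: s0 (sqrt_ksq_sqr R k); set s := Num.sqrt _ => s0 <-.
  by field; rewrite s0 gt_eqF.
rewrite E !lamE [leRHS](_ : _ = (k0 ^+ 2 * c k ^+ 2) * (1 * ksq R k)); last by ring.
apply: ler_wpM2l; first by rewrite mulr_ge0 // sqr_ge0.
apply: ler_pM; [by rewrite divr_ge0 ?sqr_ge0 // ltW|exact: sqr_ge0| |exact: kc_le].
by rewrite ler_pdivrMr // mul1r kperp_le.
Qed.

Lemma proj_diff M M' y : (M <= M')%N -> proj M' y - proj M y =
  comb M' (fun k => if k \in modes M then 0 else ip L y (eb k)).
Proof.
move=> MM'; apply/eqP; rewrite subr_eq; apply/eqP.
have -> : proj M y = comb M' (fun k => if k \in modes M then ip L y (eb k) else 0).
  apply/funext => x; apply/matrixP => a b; rewrite (ord1 a) !fct_sumE.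
  transitivity (\sum_(k <- modes M) (ip L y (eb k) *: eb k) x 0 b); first by [].
  under [RHS]eq_bigr => k _ do rewrite !mxE.
  rewrite (big_modesS _ MM') [X in _ = _ + X]big1 ?addr0.
    rewrite big_seq [RHS]big_seq; apply: eq_bigr => k kM.
    by rewrite kM !mxE.
  by move=> k /negbTE ->; rewrite mul0r.
rewrite !projEcomb !combE -big_split /=; apply: eq_bigr => k _.
by case: ifP => _; rewrite scale0r ?add0r ?addr0.
Qed.

(** Supplies the witness without which [weak_partial] would be 0, and so gives [Bform] its meaning
    on V. The derivatives of the partial sums of y form a Cauchy sequence in [L^2], and their limit
    is the weak derivative. *)
Lemma weak_partial_exists y i j : V L y ->
  exists g, is_weak_partial L i (fun x => y x 0 j) g.
Proof.
move=> Vy; have Hy := V_H Vy; have Ly := H_L2 Hy.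
pose f M := partial i (fun x => proj M y x 0 j).
have tp M : trig_poly L (fun x => proj M y x 0 j) by exact: trig_poly_comb.
have tf M : trig_poly L (f M) by apply: trig_poly_partial; exact: tp.
have Lf M : L2s L (f M) by exact: trig_poly_L2s.
pose S M := \sum_(k <- modes M) lam k * (ip L y (eb k) * ip L y (eb k)).
have cS := ip_Apow_cvg hL Vy Vy; rewrite -/S in cS.
(* [S M] is the partial sum of the series of [||y||^2]; its increments bound the distances between
   the derivatives. *)
have fS M M' : (M <= M')%N ->
    ips L (fun x => f M' x - f M x) (fun x => f M' x - f M x) <= S M' - S M.
  move=> MM'; have -> : (fun x => f M' x - f M x) =
      partial i (fun x => (proj M' y - proj M y) x 0 j).
    have -> : (fun x => (proj M' y - proj M y) x 0 j) =
        (fun x => proj M' y x 0 j + -1 * proj M y x 0 j).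
      by apply/funext => x; rewrite !mxE mulN1r.
    rewrite (partialD i (tp M') (trig_polyZ (-1) (tp M))) (partialZ i _ (tp M)).
    by apply/funext => x; rewrite mulN1r.
  rewrite (proj_diff y MM') (le_trans (ips_partial_comb_le _ _ _ _)) // /S.
  rewrite (big_modesS _ MM') [in leRHS](big_modesS _ MM') addrAC subrr add0r.
  rewrite big_seq big1 ?add0r; last by move=> k ->; rewrite expr0n mulr0.
  by apply: ler_sum => k /negbTE ->; rewrite expr2.
have [] := @L2_complete _ _ R mu D (measurable_Omega L) f.
- by move=> n; exact: L2s_measurable.
- move=> e e0; have /cvgrPdist_le/(_ (e / 2)) := cS.
  case; first by rewrite divr_gt0.
  move=> N _ hN; exists N.
  have fS' m n : (N <= m)%N -> (m <= n)%N ->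
      (\int[mu]_(x in D) ((f n x - f m x) ^+ 2)%:E <= e%:E)%E.
    move=> Nm mn; under eq_integral do rewrite expr2.
    rewrite EFin_ips ?lee_fin; try exact: L2sB.
    apply: le_trans (fS _ _ mn) _.
    have := hN m Nm; have := hN n (leq_trans Nm mn); rewrite /= !ler_norml.
    move=> /andP[h1 h2] /andP[h3 h4]; lra.
  move=> m n Nm Nn; have [mn|/ltnW nm] := leqP m n; last exact: fS'.
  under eq_integral do rewrite -sqrrN opprB.
  exact: fS'.
move=> g mg hg.
have Lgf n : (\int[mu]_(x in D) ((g x - f n x) ^+ 2)%:E < +oo)%E ->
    L2s L (fun x => g x - f n x).
  move=> fin; apply/L2sP; have mgf : measurable_fun D (fun x => g x - f n x).
    by apply: measurable_funB => //; exact: L2s_measurable.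
  split=> //; apply/integrableP; split.
    by apply/measurable_EFinP; exact: measurable_funX.
  apply: le_lt_trans fin; rewrite le_eqVlt; apply/orP; left; apply/eqP.
  by apply: eq_integral => x _; rewrite gee0_abs // lee_fin sqr_ge0.
have Lg : L2s L g.
  have [N /(_ N (leqnn _)) h] := hg 1 ltr01.
  have := L2sD (Lgf N (le_lt_trans h (ltry _))) (Lf N); congr (L2s L _).
  by apply/funext => x /=; rewrite subrK.
exists g; split=> [|//|]; first exact: Ly j.
move=> chi tchi; have Lchi := trig_poly_L2s hL tchi.
have tpc := trig_poly_partial i tchi; have Lpc := trig_poly_L2s hL tpc.
(* Both sides of the integration by parts are limits of those for the partial sums. *)
have c1 : ips L (f n) chi @[n --> \oo] --> ips L g chi.
  apply/cvgrPdist_le => e e0.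
  pose q := Num.sqrt (ips L chi chi) + 1.
  have q0 : 0 < q by rewrite ltr_wpDl // sqrtr_ge0.
  have eq0 : 0 < (e / q) ^+ 2 by rewrite exprn_gt0 // divr_gt0.
  have [N hN] := hg _ eq0; exists N => // n /= Nn; have := hN n Nn.
  move=> h; have Ld := Lgf n (le_lt_trans h (ltry _)).
  rewrite -ipsBl // (le_trans (ips_abs_le Ld Lchi)) //.
  move: h; under eq_integral do rewrite expr2.
  rewrite EFin_ips // lee_fin => h.
  have h' : Num.sqrt (ips L (fun x => g x - f n x) (fun x => g x - f n x)) <= e / q.
    rewrite -[leRHS]ger0_norm; last by apply: divr_ge0; exact: ltW.
    by rewrite -sqrtr_sqr ler_wsqrtr.
  have <- : e / q * q = e by rewrite divfK // gt_eqF.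
  by apply: ler_pM; rewrite ?sqrtr_ge0 // /q lerDl.
have c2 : ips L (f n) chi @[n --> \oo] -->
    - ips L (fun x => y x 0 j) (partial i chi).
  have E n : ips L (f n) chi = - ips L (fun x => proj n y x 0 j) (partial i chi).
    exact: ips_partial.
  under eq_fun do rewrite E.
  apply: cvgN; apply/cvgrPdist_le => e e0.
  pose q := Num.sqrt (ips L (partial i chi) (partial i chi)) + 1.
  have q0 : 0 < q by rewrite ltr_wpDl // sqrtr_ge0.
  have /cvgrPdist_le/(_ (e / q)) := proj_cvg hL Hy.
  case; first by rewrite divr_gt0.
  move=> N _ hN; exists N => // n /= Nn; have := hN n Nn.
  rewrite sub0r normrN ger0_norm ?nrm_ge0 // => h.
  have Lyj := Ly j; have Lpj := trig_poly_L2s hL (tp n).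
  rewrite -ipsBl // (le_trans (ips_abs_le (L2sB Lyj Lpj) Lpc)) //.
  have h' : Num.sqrt (ips L (fun x => y x 0 j - proj n y x 0 j)
      (fun x => y x 0 j - proj n y x 0 j)) <= e / q.
    apply: le_trans h; have := ips_comp_le (y - proj n y) j.
    rewrite (_ : (fun x => (y - proj n y) x 0 j) = (fun x => y x 0 j - proj n y x 0 j)).
      move=> h1; rewrite -[leRHS]ger0_norm ?nrm_ge0 // -sqrtr_sqr.
      exact: ler_wsqrtr.
    by apply/funext => x; rewrite !mxE.
  have <- : e / q * q = e by rewrite divfK // gt_eqF.
  by apply: ler_pM; rewrite ?sqrtr_ge0 // /q lerDl.
exact: (cvg_unique _ c1 c2).
Qed.

End WeakPartial.

(** * The trilinear form with a smooth last argument *)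

Section Trilinear.
Context (R : realType) (L : R) (hL : 0 < L).
Local Notation mu := (@leb2 R).
Local Notation D := (Omega L).
Implicit Types u v w z : vfield R.

Definition trig_field z := forall i : 'I_2, trig_poly L (fun x => z x 0 i).

(* (B(u,v), z) with the derivatives moved onto the smooth field z. *)
Definition tri u v z : R :=
  - \sum_(j < 2) \sum_(i < 2)
      ips L (fun x => partial i (fun y => z y 0 j) x * u x 0 i) (fun x => v x 0 j).

Lemma triE u v z : tri u v z = - \sum_(j < 2) \sum_(i < 2)
    ips L (fun x => partial i (fun y => z y 0 j) x * u x 0 i) (fun x => v x 0 j).
Proof. by []. Qed.

Lemma weak_partialP i psi : (exists g, is_weak_partial L i psi g) ->
  is_weak_partial L i psi (weak_partial L i psi).
Proof. by move=> [g hg]; apply: (@xgetPex _ 0 [set g | is_weak_partial L i psi g]); exists g. Qed.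

Lemma weak_partial_V v i j : V L v ->
  is_weak_partial L i (fun x => v x 0 j) (weak_partial L i (fun x => v x 0 j)).
Proof. by move=> Vv; apply: weak_partialP; exact: weak_partial_exists. Qed.

Lemma L2s_weak_partial v i j : V L v -> L2s L (weak_partial L i (fun x => v x 0 j)).
Proof. by move=> Vv; have [] := weak_partial_V i j Vv. Qed.

Lemma trig_field_eb k : trig_field (eb L k).
Proof. by move=> i; exact: trig_poly_eb. Qed.

Lemma trig_field_comb M c : trig_field (comb L M c).
Proof. by move=> i; exact: trig_poly_comb. Qed.

Lemma Omega_RintegralD (f g : R * R -> R) :
  mu.-integrable D (EFin \o f) -> mu.-integrable D (EFin \o g) ->
  \int[mu]_(x in D) (f x + g x) = \int[mu]_(x in D) f x + \int[mu]_(x in D) g x.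
Proof. by move=> If Ig; apply: RintegralD => //; exact: measurable_Omega. Qed.

Lemma Bform_sum u v z : L2 L u -> V L v -> trig_field z -> Bform L u v z =
  \sum_(j < 2) \sum_(i < 2)
    ips L (fun x => z x 0 j * u x 0 i) (weak_partial L i (fun x => v x 0 j)).
Proof.
move=> Lu Vv tz; rewrite /Bform ipE; apply: eq_bigr => j _.
have Lw i := L2s_weak_partial i j Vv.
have Lzu i : L2s L (fun x => z x 0 j * u x 0 i) by apply: L2sM_trig.
pose g i := weak_partial L i (fun x => v x 0 j).
pose f (i : 'I_2) x := z x 0 j * u x 0 i.
rewrite -[RHS]/(\sum_(i < 2) ips L (f i) (g i)) big_ord_recl big_ord1.
have If i : mu.-integrable D (EFin \o (fun x => f i x * g i x)).
  exact: integrable_mul (Lzu i) (Lw i).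
transitivity (\int[mu]_(x in D) (f ord0 x * g ord0 x +
  f (lift ord0 ord0) x * g (lift ord0 ord0) x)).
  have E (a b c e h : R) : (a * b + c * e) * h = h * a * b + h * c * e by ring.
  apply: eq_Rintegral => x _; rewrite /advection mxE big_ord_recl big_ord1.
  exact: E.
exact: (Omega_RintegralD (If ord0) (If (lift ord0 ord0))).
Qed.

(** Extends integrations by parts from polynomials to all of H by density. *)
Lemma H_dense_zero (F : vfield R -> R) (C : R) : 0 <= C ->
  (forall u v, L2 L u -> L2 L v -> F (u - v) = F u - F v) ->
  (forall u, L2 L u -> `|F u| <= C * nrm L u) ->
  (forall phi, sol_trig_poly L phi -> F phi = 0) ->
  forall u, H L u -> F u = 0.
Proof.
move=> C0 FB Fb F0 u [Lu Hu].
apply/eqP; rewrite -normr_le0; apply/ler_addgt0Pl => e e0; rewrite addr0.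
have C1 : 0 < C + 1 by rewrite ltr_wpDl.
have eC : 0 < e / (C + 1) by rewrite divr_gt0.
have [phi sp hp] := Hu _ eC; have Lphi := sol_L2 hL sp.
have := FB _ _ Lu Lphi; rewrite (F0 _ sp) subr0 => <-.
apply: (le_trans (Fb _ (L2B Lu Lphi))).
have -> : e = (C + 1) * (e / (C + 1)) by rewrite mulrC divfK // gt_eqF.
by apply: ler_pM; rewrite ?nrm_ge0 ?lerDl // ltW.
Qed.

Lemma vcompB u v i : (fun x => (u - v) x 0 i) = (fun x => u x 0 i - v x 0 i).
Proof. by apply/funext => x; rewrite !mxE. Qed.

Lemma vcompD u v i : (fun x => (u + v) x 0 i) = (fun x => u x 0 i + v x 0 i).
Proof. by apply/funext => x; rewrite !mxE. Qed.

Lemma vcompZ a u i : (fun x => (a *: u) x 0 i) = (fun x => a * u x 0 i).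
Proof. by apply/funext => x; rewrite !mxE. Qed.

Lemma ips_mulB b f f' g : trig_poly L b -> L2s L f -> L2s L f' -> L2s L g ->
  ips L (fun x => b x * (f x - f' x)) g =
  ips L (fun x => b x * f x) g - ips L (fun x => b x * f' x) g.
Proof.
move=> tb Lf Lf' Lg; rewrite -ipsBl //; try exact: L2sM_trig.
by congr ips; apply/funext => x; rewrite mulrBr.
Qed.

Lemma sqrt_ips_comp u i : Num.sqrt (ips L (fun x => u x 0 i) (fun x => u x 0 i)) <= nrm L u.
Proof.
rewrite -[leRHS]ger0_norm ?nrm_ge0 // -sqrtr_sqr; apply: ler_wsqrtr; exact: ips_comp_le.
Qed.

Lemma div_free_weak u psi : H L u -> trig_poly L psi ->
  \sum_(i < 2) ips L (fun x => u x 0 i) (partial i psi) = 0.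
Proof.
move=> Hu tpsi; have tp i := trig_poly_partial i tpsi.
have Lp i := trig_poly_L2s hL (tp i).
apply: (@H_dense_zero (fun w => \sum_(i < 2) ips L (fun x => w x 0 i) (partial i psi))
  (\sum_(i < 2) Num.sqrt (ips L (partial i psi) (partial i psi)))) => //.
- by apply: sumr_ge0 => i _; exact: sqrtr_ge0.
- by move=> v w Lv Lw; rewrite -sumrB; apply: eq_bigr => i _; rewrite vcompB ipsBl.
- move=> w Lw; rewrite (le_trans (ler_norm_sum _ _ _)) // mulr_suml.
  apply: ler_sum => i _; apply: (le_trans (ips_abs_le (Lw i) (Lp i))).
  by rewrite mulrC ler_wpM2l ?sqrtr_ge0 // sqrt_ips_comp.
- move=> phi sp; have Lphi := sol_L2 hL sp; have [tphi dphi _] := sp.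
  have : ips L (divergence phi) psi = 0.
    rewrite /ips; under eq_Rintegral do rewrite dphi mul0r.
    by rewrite Rintegral_cst ?mul0r //; exact: measurable_Omega.
  rewrite /divergence ips_suml //; last exact: trig_poly_L2s.
    move=> E; apply/eqP; rewrite -oppr_eq0 -sumrN; apply/eqP; apply: (etrans _ E).
    by apply: eq_bigr => i _; rewrite ips_partial.
  by move=> i; apply: trig_poly_L2s => //; exact: trig_poly_partial.
Qed.

Lemma ips_mul_le (b f g : R * R -> R) : trig_poly L b -> exists2 C, 0 <= C &
  forall f g, L2s L f -> L2s L g ->
   `|ips L (fun x => b x * f x) g| <= C * Num.sqrt (ips L f f) * Num.sqrt (ips L g g).
Proof.
move=> tb; have [C bC] := trig_poly_bounded tb.
have C0 : 0 <= C by exact: le_trans (normr_ge0 _) (bC (0, 0)).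
exists C => // {}f {}g Lf Lg; have Lbf := L2sM_trig tb Lf.
rewrite (le_trans (ips_abs_le Lbf Lg)) // ler_wpM2r ?sqrtr_ge0 //.
rewrite -{1}(ger0_norm C0) -sqrtr_sqr -sqrtrM ?sqr_ge0 //; apply: ler_wsqrtr.
exact: ips_mul_bound (trig_poly_measurableD tb) bC Lf.
Qed.

(** With the derivatives on the smooth field, the form is bounded in the [L^2] norms of the other
    two; hence [L^2] continuity of a curve in time passes to the nonlinear term of each mode. *)
Lemma tri_bound z : trig_field z -> exists2 C, 0 <= C &
  forall u v, L2 L u -> L2 L v -> `|tri u v z| <= C * nrm L u * nrm L v.
Proof.
move=> tz.
have H (j i : 'I_2) := ips_mul_le (fun=> 0) (fun=> 0) (trig_poly_partial i (tz j)).
(* A constant is only known to exist for each pair of indices; [choice] selects them so that they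
   can be summed. *)
have [C hC] := choice (fun ji : 'I_2 * 'I_2 => let: ex_intro2 C C0 h := H ji.1 ji.2 in
  ex_intro (fun C => 0 <= C /\ _) C (conj C0 h)).
exists (\sum_(j < 2) \sum_(i < 2) C (j, i)).
  by apply: sumr_ge0 => j _; apply: sumr_ge0 => i _; case: (hC (j, i)).
move=> u v Lu Lv; rewrite /tri normrN (le_trans (ler_norm_sum _ _ _)) // !mulr_suml.
apply: ler_sum => j _; rewrite (le_trans (ler_norm_sum _ _ _)) // !mulr_suml.
apply: ler_sum => i _; have [C0 h] := hC (j, i).
apply: (le_trans (h _ _ (Lu i) (Lv j))).
apply: ler_pM; rewrite ?sqrtr_ge0 ?sqrt_ips_comp ?mulr_ge0 ?sqrtr_ge0 //.
by rewrite ler_wpM2l ?sqrt_ips_comp.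
Qed.

End Trilinear.

Section TrilinearForm.
Context (R : realType) (L : R) (hL : 0 < L).
Local Notation tri := (tri L).
Local Notation trig_field := (trig_field L).
Local Notation lam := (lam L).
Local Notation comb := (comb L).
Implicit Types u v w z : vfield R.

(** For a polynomial u the weak derivative of v may be tested with [z_j u_i], and the term with the
    divergence of u vanishes. Both sides are bounded in u in [L^2], which extends the identity to
    H. *)
Lemma Bform_tri u v z : H L u -> V L v -> trig_field z -> Bform L u v z = tri u v z.
Proof.
move=> Hu Vv tz; have Lu := H_L2 Hu; have Lv := V_L2 Vv.
rewrite Bform_sum //.
pose g i j := weak_partial L i (fun x => v x 0 j).
have wg i j : is_weak_partial L i (fun x => v x 0 j) (g i j) by exact: weak_partial_V.
have Lg i j : L2s L (g i j) by have [] := wg i j.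
pose F1 w := \sum_(j < 2) \sum_(i < 2) ips L (fun x => z x 0 j * w x 0 i) (g i j).
suff : F1 u - tri u v z = 0 by move/eqP; rewrite subr_eq0 => /eqP.
have tp i j := trig_poly_partial i (tz j).
have Ltp i j w : L2 L w ->
    L2s L (fun x => partial i (fun y => z y 0 j) x * w x 0 i).
  by move=> Lw; apply: L2sM_trig; [exact: tp|exact: Lw].
have F1b : exists2 C, 0 <= C & forall w, L2 L w -> `|F1 w| <= C * nrm L w.
  have [C hC] := choice (fun j : 'I_2 =>
    let: ex_intro2 C C0 h := ips_mul_le (fun=> 0) (fun=> 0) (tz j) in
    ex_intro (fun C => 0 <= C /\ _) C (conj C0 h)).
  pose q i j := Num.sqrt (ips L (g i j) (g i j)).
  exists (\sum_(j < 2) \sum_(i < 2) C j * q i j).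
    apply: sumr_ge0 => j _; apply: sumr_ge0 => i _; rewrite mulr_ge0 ?sqrtr_ge0 //.
    by have [] := hC j.
  move=> w Lw; rewrite (le_trans (ler_norm_sum _ _ _)) // !mulr_suml.
  apply: ler_sum => j _; rewrite (le_trans (ler_norm_sum _ _ _)) // !mulr_suml.
  apply: ler_sum => i _; have [C0 h] := hC j.
  apply: (le_trans (h _ _ (Lw i) (Lg i j))); rewrite -/(q i j) -!mulrA.
  rewrite ler_wpM2l // mulrC ler_wpM2l ?sqrtr_ge0 //; exact: sqrt_ips_comp.
have [C1 C10 hC1] := F1b; have [C2 C20 hC2] := tri_bound tz.
have L1 w w' : L2 L w -> L2 L w' -> F1 (w - w') = F1 w - F1 w'.
  move=> Lw Lw'; rewrite /F1 -sumrB; apply: eq_bigr => j _.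
  rewrite -sumrB; apply: eq_bigr => i _.
  rewrite -ips_mulB //; congr ips; apply/funext => x; by rewrite !mxE.
have L2' w w' : L2 L w -> L2 L w' -> tri (w - w') v z = tri w v z - tri w' v z.
  move=> Lw Lw'; rewrite !triE -opprD; congr (- _).
  rewrite -sumrB; apply: eq_bigr => j _; rewrite -sumrB; apply: eq_bigr => i _.
  rewrite -ips_mulB //; congr ips; apply/funext => x; by rewrite !mxE.
apply: (@H_dense_zero R L hL (fun w => F1 w - tri w v z) (C1 + C2 * nrm L v)) => //.
- by rewrite addr_ge0 // mulr_ge0 // nrm_ge0.
- by move=> w w' Lw Lw'; rewrite L1 // L2' //; ring.
- move=> w Lw; rewrite (le_trans (ler_normB _ _)) // mulrDl lerD ?hC1 //.
  by rewrite (le_trans (hC2 _ _ Lw Lv)) // mulrAC.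
move=> phi sp; have [tphi dphi _] := sp; have Lphi := sol_L2 hL sp.
rewrite /F1 !triE opprK -big_split /= big1 // => j _.
(* The product rule for [z_j phi_i] yields the term of [tri] and a multiple of [partial i phi_i];
   the latter sums over i to the divergence. *)
have E i : ips L (fun x => z x 0 j * phi x 0 i) (g i j) +
    ips L (fun x => partial i (fun y => z y 0 j) x * phi x 0 i) (fun x => v x 0 j) =
    - ips L (fun x => z x 0 j * partial i (fun y => phi y 0 i) x) (fun x => v x 0 j).
  have [_ _ /(_ _ (trig_polyM (tz j) (tphi i)))] := wg i j.
  rewrite -/(ips L (g i j) _) ipsC => ->.
  rewrite -/(ips L (fun x => v x 0 j) _) (partialM i (tz j) (tphi i)) ipsC ipsDl //.
  - by ring.
  - exact: Ltp.
  - apply: L2sM_trig; first exact: tz.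
    by apply: trig_poly_L2s => //; exact: trig_poly_partial.
rewrite -big_split /=; under eq_bigr => i _ do rewrite E.
rewrite sumrN -ips_suml //; last first.
  move=> i; apply: L2sM_trig; first exact: tz.
  by apply: trig_poly_L2s => //; exact: trig_poly_partial.
rewrite /ips; under eq_Rintegral => x _.
  rewrite -mulr_sumr (_ : \sum_(i < 2) _ = divergence phi x) // dphi mulr0 mul0r; over.
by rewrite Rintegral_cst ?mul0r ?oppr0 //; exact: measurable_Omega.
Qed.

Lemma triBl u u' v z : L2 L u -> L2 L u' -> L2 L v -> trig_field z ->
  tri (u - u') v z = tri u v z - tri u' v z.
Proof.
move=> Lu Lu' Lv tz; rewrite !triE -opprD; congr (- _).
rewrite -sumrB; apply: eq_bigr => j _; rewrite -sumrB; apply: eq_bigr => i _.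
rewrite -ips_mulB //; last exact: trig_poly_partial.
by congr ips; apply/funext => x; rewrite !mxE.
Qed.

Lemma triBm u v v' z : L2 L u -> L2 L v -> L2 L v' -> trig_field z ->
  tri u (v - v') z = tri u v z - tri u v' z.
Proof.
move=> Lu Lv Lv' tz; rewrite !triE -opprD; congr (- _).
rewrite -sumrB; apply: eq_bigr => j _; rewrite -sumrB; apply: eq_bigr => i _.
rewrite vcompB ipsBr //; apply: L2sM_trig => //; exact: trig_poly_partial.
Qed.

Lemma triDr u v z z' : L2 L u -> L2 L v -> trig_field z -> trig_field z' ->
  tri u v (z + z') = tri u v z + tri u v z'.
Proof.
move=> Lu Lv tz tz'; rewrite !triE -opprD; congr (- _).
rewrite -big_split /=; apply: eq_bigr => j _; rewrite -big_split /=; apply: eq_bigr => i _.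
rewrite vcompD (partialD i (tz j) (tz' j)) -ipsDl //.
- by congr ips; apply/funext => x; rewrite mulrDl.
- by apply: L2sM_trig => //; exact: trig_poly_partial.
- by apply: L2sM_trig => //; exact: trig_poly_partial.
Qed.

Lemma triZr a u v z : L2 L u -> L2 L v -> trig_field z ->
  tri u v (a *: z) = a * tri u v z.
Proof.
move=> Lu Lv tz; rewrite !triE mulrN; congr (- _).
rewrite mulr_sumr; apply: eq_bigr => j _; rewrite mulr_sumr; apply: eq_bigr => i _.
rewrite vcompZ (partialZ i a (tz j)) -ipsZl //.
- by congr ips; apply/funext => x; rewrite mulrA.
- by apply: L2sM_trig => //; exact: trig_poly_partial.
Qed.

Lemma tri_comb u v M c : L2 L u -> L2 L v ->
  tri u v (comb M c) = \sum_(k <- modes M) c k * tri u v (eb L k).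
Proof.
move=> Lu Lv; rewrite !combE; elim: (modes M) => [|k s IH].
  have -> : \sum_(k <- [::]) c k *: eb L k = 0 *: eb L 0 by rewrite big_nil scale0r.
  by rewrite big_nil triZr ?mul0r //; exact: trig_field_eb.
have ts : trig_field (\sum_(j <- s) c j *: eb L j).
  have [] : sol_trig_poly L (\sum_(j <- s) c j *: eb L j); last by [].
  by apply: sol_sum => // j; apply: sol_trig_polyZ => //; exact: sol_eb.
rewrite !big_cons triDr // ?triZr ?IH //; first exact: trig_field_eb.
by move=> i; rewrite vcompZ; apply: trig_polyZ; exact: trig_poly_eb.
Qed.

(** Twice the form is, up to sign, the integral of [u . grad |z|^2], which vanishes for
    divergence-free u. *)
Lemma tri_self u z : H L u -> trig_field z -> tri u z z = 0.
Proof.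
move=> Hu tz; have Lu := H_L2 Hu.
have E j : \sum_(i < 2) ips L (fun x => partial i (fun y => z y 0 j) x * u x 0 i)
    (fun x => z x 0 j) = 0.
  have := div_free_weak hL Hu (trig_polyM (tz j) (tz j)).
  rewrite (eq_bigr (fun i => 2 * ips L (fun x => partial i (fun y => z y 0 j) x * u x 0 i)
    (fun x => z x 0 j))); first by rewrite -mulr_sumr => /eqP; rewrite mulf_eq0 pnatr_eq0 => /eqP.
  move=> i _; rewrite (partialM i (tz j) (tz j)) -ipsZl; first last.
  - exact: trig_poly_L2s.
  - by apply: L2sM_trig; [exact: trig_poly_partial|exact: Lu].
  by rewrite /ips; apply: eq_Rintegral => x _; ring.
by rewrite !triE big1 ?oppr0.
Qed.

End TrilinearForm.

(** * The vanishing of [B(p, p, A p)] in two dimensions *)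

Section Enstrophy.
Context (R : realType) (L : R) (hL : 0 < L).
Local Notation mu := (@leb2 R).
Local Notation D := (Omega L).
Local Notation tri := (tri L).
Local Notation lam := (lam L).
Local Notation comb := (comb L).

Lemma partial_comm i k f : trig_poly L f -> partial i (partial k f) = partial k (partial i f).
Proof.
move=> /trig_polyP[s ->]; rewrite !partial_casform.
apply/funext => x; rewrite /casform /dcas !big_map; apply: eq_bigr => m _ /=.
rewrite /kc; congr (_ * _); case: ifP => _; case: ifP => _ /=; rewrite !mulrNz; ring.
Qed.

Lemma integral_trig_sum (F : 'I_2 -> R * R -> R) : (forall i, trig_poly L (F i)) ->
  \sum_(i < 2) \int[mu]_(x in D) F i x = \int[mu]_(x in D) \sum_(i < 2) F i x.
Proof.
move=> tF; rewrite big_ord_recl big_ord1 -Omega_RintegralD; try exact: integrable_trig.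
by apply: eq_Rintegral => x _; rewrite big_ord_recl big_ord1.
Qed.

Lemma sum_traceless (g : 'I_2 -> 'I_2 -> R) :
  g ord0 ord0 + g (lift ord0 ord0) (lift ord0 ord0) = 0 ->
  \sum_(j < 2) \sum_(i < 2) \sum_(k < 2) g k i * g i j * g k j = 0.
Proof.
move=> /eqP; rewrite addr_eq0 => /eqP h.
by rewrite !big_ord_recl !big_ord0 !addr0 h; ring.
Qed.

(* In two dimensions the gradient G of a divergence-free field is traceless,
   so G^2 is scalar and tr (G^2 G^T) vanishes pointwise. *)
Lemma tri_enstrophy M c : tri (comb M c) (comb M c) (comb M (fun k => lam k * c k)) = 0.
Proof.
set p := comb M c; set z := comb M _.
have sp : sol_trig_poly L p by exact: sol_comb.
have Hp : H L p by exact: H_comb.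
have tp i : trig_poly L (fun x => p x 0 i) by exact: trig_poly_comb.
have tz i : trig_poly L (fun x => z x 0 i) by exact: trig_poly_comb.
pose G i j := partial i (fun x => p x 0 j).
have tG i j : trig_poly L (G i j) by exact: trig_poly_partial.
have tdG k i j : trig_poly L (partial k (G i j)) by exact: trig_poly_partial.
(* [z = A p] is minus the Laplacian of p. *)
have Ez j : (fun x => z x 0 j) = fun x => \sum_(k < 2) - partial k (G k j) x.
  apply/funext => x; rewrite sumrN; have := laplacian_comb L M c.
  move=> /(congr1 (fun v : vfield R => v x 0 j)); rewrite /laplacian mxE => ->.
  by rewrite !fct_sumE -sumrN; apply: eq_bigr => k _; rewrite !mxE; ring.
(* As p is divergence-free, the derivative returns from z to the middle argument. *)
have E1 j : \sum_(i < 2) ips L (fun x => partial i (fun y => z y 0 j) x * p x 0 i)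
    (fun x => p x 0 j) =
    - \sum_(i < 2) ips L (fun x => p x 0 i * G i j x) (fun x => z x 0 j).
  apply/eqP; rewrite -addr_eq0 -big_split /=; apply/eqP.
  rewrite -[RHS](div_free_weak hL Hp (trig_polyM (tz j) (tp j))).
  apply: eq_bigr => i _; rewrite (partialM i (tz j) (tp j)) /ips -Omega_RintegralD.
  - apply: eq_Rintegral => x _; rewrite -/(G i j).
    by move: (partial _ _ x) (G i j x) (p x 0 i) (p x 0 j) (z x 0 j) => *; ring.
  - apply: integrable_trig => //; apply: trig_polyM => //; apply: trig_polyM => //.
    exact: trig_poly_partial.
  - by apply: integrable_trig => //; apply: trig_polyM => //; apply: trig_polyM.
(* A second integration by parts moves one derivative of the Laplacian onto [p_i G i j];
   [partial_comm] then puts the second derivatives of p in transport form. *)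
have E2 i j : ips L (fun x => p x 0 i * G i j x) (fun x => z x 0 j) =
    \sum_(k < 2) (ips L (fun x => G k i x * G i j x) (G k j) +
                  ips L (fun x => p x 0 i * partial i (G k j) x) (G k j)).
  have tpG : trig_poly L (fun x => p x 0 i * G i j x) by exact: trig_polyM.
  rewrite Ez ipsC ips_suml //; first last.
  - exact: trig_poly_L2s.
  - by move=> k; apply: L2sN; exact: trig_poly_L2s.
  apply: eq_bigr => k _; rewrite ipsNl; try exact: trig_poly_L2s.
  rewrite (ips_partial hL) // opprK (partialM k (tp i) (tG i j)) ipsC -/(G k i).
  rewrite (partial_comm k i (tp j)) -/(G k j) ipsDl //; apply: trig_poly_L2s => //;
    exact: trig_polyM.
(* The transport term is half the integral of [p . grad (G k j)^2]. *)
have E3 k j : \sum_(i < 2) ips L (fun x => p x 0 i * partial i (G k j) x) (G k j) = 0.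
  have Z := div_free_weak hL Hp (trig_polyM (tG k j) (tG k j)).
  apply: (mulfI (_ : (2 : R) != 0)); first by rewrite pnatr_eq0.
  rewrite mulr0 mulr_sumr -[RHS]Z; apply: eq_bigr => i _.
  rewrite (partialM i (tG k j) (tG k j)) -ipsZl; first last.
  - exact: trig_poly_L2s.
  - by apply: trig_poly_L2s => //; exact: trig_polyM.
  have E (a b e : R) : 2 * (b * a) * e = b * (a * e + e * a) by ring.
  by rewrite /ips; apply: eq_Rintegral => x _; exact: E.
have tGGG i j k : trig_poly L (fun x => G k i x * G i j x * G k j x).
  by apply: trig_polyM => //; exact: trig_polyM.
have E4 : \sum_(j < 2) \sum_(i < 2) \sum_(k < 2)
    ips L (fun x => G k i x * G i j x) (G k j) = 0.
  under eq_bigr => j _.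
    under eq_bigr => i _ do rewrite /ips integral_trig_sum //.
    rewrite integral_trig_sum; last by move=> i; exact: trig_poly_sum.
    over.
  rewrite /= integral_trig_sum; last first.
    by move=> j; do 2!apply: trig_poly_sum => ?.
  rewrite -[RHS](mul0r (fine (mu D))) -(Rintegral_cst mu (measurable_Omega L) 0).
  apply: eq_Rintegral => x _; apply: (sum_traceless (g := fun i j => G i j x)).
  by have [_ /(_ x) + _] := sp; rewrite /divergence big_ord_recl big_ord1.
have E5 : \sum_(j < 2) \sum_(i < 2) \sum_(k < 2)
    ips L (fun x => p x 0 i * partial i (G k j) x) (G k j) = 0.
  by apply: big1 => j _; rewrite exchange_big; apply: big1 => k _; exact: E3.
have E6 j : \sum_(i < 2) ips L (fun x => p x 0 i * G i j x) (fun x => z x 0 j) =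
    (\sum_(i < 2) \sum_(k < 2) ips L (fun x => G k i x * G i j x) (G k j)) +
    (\sum_(i < 2) \sum_(k < 2) ips L (fun x => p x 0 i * partial i (G k j) x) (G k j)).
  by rewrite -big_split; apply: eq_bigr => i _; rewrite E2 big_split.
apply/eqP; rewrite oppr_eq0; apply/eqP.
transitivity (- ((\sum_(j < 2) \sum_(i < 2) \sum_(k < 2)
    ips L (fun x => G k i x * G i j x) (G k j)) +
  (\sum_(j < 2) \sum_(i < 2) \sum_(k < 2)
    ips L (fun x => p x 0 i * partial i (G k j) x) (G k j)))).
  by rewrite -big_split -sumrN; apply: eq_bigr => j _; rewrite E1 E6.
have Z (a b : R) : a = 0 -> b = 0 -> - (a + b) = 0 by move=> -> ->; rewrite addr0 oppr0.
exact: Z E4 E5.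
Qed.

End Enstrophy.

(** * Calculus in time *)

Section TimeCalculus.
Context (R : realType).
Local Notation leb := (@lebesgue_measure R).
Implicit Types (W g : R -> R) (a b : R).

Lemma continuous_integrable g a b : continuous g -> leb.-integrable `[a, b] (EFin \o g).
Proof.
move=> cg; apply: continuous_compact_integrable; first exact: segment_compact.
by apply: continuous_subspaceT.
Qed.

(** The weak equation gives increments only as time integrals; with a continuous integrand each
    Fourier coefficient becomes a classical solution. Near s, W is the constant [W (s - 1)] plus the
    primitive that starts at [s - 1]. *)
Lemma is_derive_of_increments W g : continuous g ->
  (forall a b, a <= b -> W b - W a = \int[leb]_(s in `[a, b]) g s) ->
  forall s : R, is_derive s 1 W (g s).
Proof.
move=> cg E s.
have ss : s - 1 < s by rewrite ltrBlDr ltrDl.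
have [dF FE] := @continuous_FTC1_closed R g (s - 1) s (s + 1)
  (ltac:(by rewrite ltrDl)) (continuous_integrable (s - 1) (s + 1) cg) ss (cg s).
set F := fun x => _ in dF FE.
have h : is_derive s 1 (cst (W (s - 1)) + F) (g s).
  rewrite -[g s]add0r -FE derive1E; apply: is_deriveD; exact: DeriveDef dF erefl.
apply: near_eq_is_derive h; near=> t.
have st : s - 1 <= t.
  by near: t; apply: (@filterS _ _ _ _ _ _ (lt_nbhsr ss)) => t /ltW.
by rewrite -[LHS]/(W (s - 1) + F t) -[F t](E _ _ st) subrKC.
Unshelve. all: by end_near. Qed.

Lemma continuous_of_derive W g : (forall s : R, is_derive s 1 W (g s)) -> continuous W.
Proof.
move=> dW s; apply: differentiable_continuous; apply/derivable1_diffP.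
exact: (@ex_derive _ _ _ _ _ _ _ (dW s)).
Qed.

Lemma increment_integral W g a b : a < b -> continuous g ->
  (forall s : R, is_derive s 1 W (g s)) -> \int[leb]_(s in `[a, b]) g s = W b - W a.
Proof.
move=> ab cg dW; have cW := continuous_of_derive dW.
rewrite /Rintegral (@continuous_FTC2 _ g W a b ab) //.
- exact: continuous_subspaceT.
- split; first by move=> t _; exact: (@ex_derive _ _ _ _ _ _ _ (dW t)).
    by apply: cvg_at_right_filter; exact: cW.
  by apply: cvg_at_left_filter; exact: cW.
- by move=> t _; rewrite derive1E (@derive_val _ _ _ _ _ _ _ (dW t)).
Qed.

(* Dominated convergence replaces a uniform bound on the derivatives. *)
Lemma increment_limsup (y d : nat -> R -> R) (a b eta E : R) : a < b ->
  (forall M (s : R), is_derive s 1 (y M) (d M s)) ->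
  (forall M, continuous (d M)) ->
  (forall M s, a <= s <= b -> d M s <= E) ->
  (forall s e, a <= s <= b -> 0 < e ->
     exists M0, forall M, (M0 <= M)%N -> d M s <= - eta + e) ->
  forall e, 0 < e -> exists M0, forall M, (M0 <= M)%N ->
    y M b - y M a <= - eta * (b - a) + e.
Proof.
move=> ab dy cd dE deta e e0.
(* The positive part of the excess of [d M s] over [- eta]. On [[a, b]] it tends to 0 pointwise and
   is bounded by a constant, so its integral tends to 0, while [d M <= - eta + r M]. *)
pose r M s := Num.max 0 (d M s + eta).
have cr M : continuous (r M).
  move=> s; apply: (@continuous_max R R (fun=> 0) (fun s => d M s + eta)).
    exact: cvg_cst.
  by apply: cvgD; [exact: cd|exact: cvg_cst].
have mI : measurable (`[a, b]%classic : set R) by exact: measurable_itv.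
have mr M : measurable_fun `[a, b] (EFin \o r M).
  by have /integrableP[] := continuous_integrable a b (cr M) : leb.-integrable `[a, b] _.
have r0 M s : 0 <= r M s by rewrite /r le_max lexx.
have [] := @dominated_convergence _ _ R leb `[a, b] mI (fun M => EFin \o r M)
   (cst 0%E) (cst (`|E| + `|eta|)%:E) mr.
- exact: measurable_cst.
- apply: aeW => s; rewrite /= in_itv /= => sab.
  apply/cvg_EFin; first exact: nearW.
  apply/cvgrPdist_le => h h0; have [M0 hM0] := deta s h sab h0.
  exists M0 => // M /= /hM0 hM; rewrite sub0r normrN ger0_norm //.
  by rewrite /r ge_max (ltW h0) /= -lerBrDr addrC.
- by apply: (@continuous_integrable (cst (`|E| + `|eta|))) => s; exact: cvg_cst.
- apply: aeW => s M; rewrite /= in_itv /= => sab; rewrite lee_fin ger0_norm //.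
  by rewrite /r ge_max addr_ge0 //= lerD ?ler_norm // (le_trans (dE _ _ sab)) // ler_norm.
move=> _ _; rewrite integral0.
move=> /fine_cvgP[_ /cvgrPdist_le/(_ e e0)[M0 _ hM0]].
exists M0 => M /hM0 /=; rewrite sub0r normrN => hI.
rewrite -(increment_integral ab (cd M) (dy M)).
have Id := continuous_integrable a b (cd M) : leb.-integrable `[a, b] _.
have Ir := continuous_integrable a b (cr M) : leb.-integrable `[a, b] _.
have Ie : leb.-integrable `[a, b] (EFin \o cst (- eta)).
  by apply: continuous_integrable => s; exact: cvg_cst.
apply: (@le_trans _ _ (\int[leb]_(s in `[a, b]) (- eta + r M s))).
  apply: le_Rintegral => //.
    apply: (@continuous_integrable (fun s => - eta + r M s)) => s.
    by apply: cvgD; [exact: cvg_cst|exact: cr].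
  by move=> s _; rewrite -lerBlDl opprK /r le_max lexx orbT.
rewrite RintegralD // lerD //; last by apply: le_trans hI; exact: ler_norm.
by rewrite Rintegral_cst //= lebesgue_measure_itv /= lte_fin ab.
Qed.

End TimeCalculus.

(** * Continuity of curves in [L^2], and of the cutoff *)

Section Curves.
Context (R : realType) (L : R) (hL : 0 < L).
Implicit Types (U W : R -> vfield R) (z : vfield R).

Definition nrm_continuous U :=
  forall s : R, nrm L (U t - U s) @[t --> s] --> (0 : R).

Lemma cvg0_le (s l : R) (f g : R -> R) : (forall t, `|f t - l| <= g t) ->
  g t @[t --> s] --> (0 : R) -> f t @[t --> s] --> l.
Proof.
move=> fg /cvgrPdist_lt g0; apply/cvgrPdist_lt => e e0.
apply: filterS (g0 _ e0) => t; rewrite sub0r normrN distrC => h.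
by apply: le_lt_trans (fg t) _; exact: le_lt_trans (ler_norm _) h.
Qed.

Lemma nrm_continuous_nrm U : (forall s, L2 L (U s)) -> nrm_continuous U ->
  continuous (fun s => nrm L (U s)).
Proof.
move=> LU cU s; by apply: (cvg0_le _ (cU s)) => t; exact: nrm_dist_le.
Qed.

Lemma nrm_continuous_ip U z : (forall s, L2 L (U s)) -> nrm_continuous U -> L2 L z ->
  continuous (fun s => ip L (U s) z).
Proof.
move=> LU cU Lz s.
apply: (@cvg0_le _ _ _ (fun t => nrm L (U t - U s) * nrm L z)).
  move=> t; rewrite -ipBl //; apply: cauchy_schwarz => //; exact: L2B.
rewrite -[X in _ --> X](mul0r (nrm L z)); apply: cvgM; [exact: cU|exact: cvg_cst].
Qed.

Lemma nrm_continuousD U W : (forall s, L2 L (U s)) -> (forall s, L2 L (W s)) ->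
  nrm_continuous U -> nrm_continuous W -> nrm_continuous (fun s => U s + W s).
Proof.
move=> LU LW cU cW s.
apply: (@cvg0_le _ _ _ (fun t => nrm L (U t - U s) + nrm L (W t - W s))).
  move=> t; rewrite subr0 ger0_norm ?nrm_ge0 // opprD addrACA.
  by apply: nrmD_le; exact: L2B.
by rewrite -[X in _ --> X](addr0 (0 : R)); apply: cvgD; [exact: cU|exact: cW].
Qed.

Lemma nrm_continuousZ (phi : R -> R) U : (forall s, L2 L (U s)) -> continuous phi ->
  nrm_continuous U -> nrm_continuous (fun s => phi s *: U s).
Proof.
move=> LU cphi cU s.
apply: (@cvg0_le _ _ _ (fun t => `|phi t| * nrm L (U t - U s) + `|phi t - phi s| * nrm L (U s))).
  move=> t; rewrite subr0 ger0_norm ?nrm_ge0 //.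
  have -> : phi t *: U t - phi s *: U s =
      phi t *: (U t - U s) + (phi t - phi s) *: U s.
    by rewrite scalerBr scalerBl addrA subrK.
  have Lts := L2B (LU t) (LU s).
  by rewrite (le_trans (nrmD_le (L2Z _ Lts) (L2Z _ (LU s)))) // !nrmZ.
have -> : (0 : R) = `|phi s| * 0 + `|phi s - phi s| * nrm L (U s).
  by rewrite subrr normr0 mulr0 mul0r addr0.
apply: cvgD; apply: cvgM; [|exact: cU| |exact: cvg_cst].
- by apply: cvg_norm; exact: cphi.
- by apply: cvg_norm; apply: cvgB; [exact: cphi|exact: cvg_cst].
Qed.

Lemma nrm_continuous_tri U z : (forall s, L2 L (U s)) -> nrm_continuous U ->
  trig_field L z -> continuous (fun s => tri L (U s) (U s) z).
Proof.
move=> LU cU tz s; have [C C0 hC] := tri_bound tz.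
apply: (@cvg0_le _ _ _ (fun t => C * nrm L (U t - U s) * nrm L (U t) +
    C * nrm L (U s) * nrm L (U t - U s))).
  move=> t; have Lts := L2B (LU t) (LU s).
  have -> : tri L (U t) (U t) z - tri L (U s) (U s) z =
      tri L (U t - U s) (U t) z + tri L (U s) (U t - U s) z.
    rewrite triBl // triBm //.
    by move: (tri L (U t) (U t) z) (tri L (U s) (U t) z) (tri L (U s) (U s) z) => *; ring.
  by rewrite (le_trans (ler_normD _ _)) // lerD // hC.
have -> : (0 : R) = C * 0 * nrm L (U s) + C * nrm L (U s) * 0.
  by rewrite !mulr0 mul0r addr0.
have cn := nrm_continuous_nrm LU cU.
apply: cvgD; first by apply: cvgM (cn s); apply: cvgM (cU s); exact: cvg_cst.
by apply: cvgM (cU s); exact: cvg_cst.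
Qed.

End Curves.

Section Cutoff.
Context (R : realType) (G : R) (G0 : 0 < G).

(** With a formula free of cases, continuity across the breakpoints is that of the minimum, the
    maximum and the absolute value. *)
Lemma cutoffE xi : cutoff G xi = Num.max 0 (Num.min 1 (3 - `|xi| / G)).
Proof.
rewrite /cutoff; case: ifPn => [h|]; last rewrite -ltNge => h2.
  rewrite (min_idPl _) ?(max_idPr _) ?ler01 // lerBrDr -lerBrDl.
  by rewrite ler_pdivrMr //; apply: le_trans h _; lra.
case: ifPn => [h|]; last rewrite -ltNge => h3.
  have h' : 3 - `|xi| / G <= 0 by rewrite subr_le0 ler_pdivlMr.
  by rewrite (min_idPr _) ?(max_idPl _) // (le_trans h').
have h' : 0 <= 3 - `|xi| / G by rewrite subr_ge0 ler_pdivrMr // ltW.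
have h2' : 3 - `|xi| / G <= 1.
  by rewrite lerBlDr -lerBlDl ler_pdivlMr //; apply: le_trans (ltW h2); lra.
by rewrite (min_idPr h2') (max_idPr h').
Qed.

Lemma cutoff_ge0 xi : 0 <= cutoff G xi.
Proof. by rewrite cutoffE le_max lexx. Qed.

Lemma cutoff_le1 xi : cutoff G xi <= 1.
Proof. by rewrite cutoffE ge_max ler01 /= ge_min lexx. Qed.

Lemma cutoff1 xi : `|xi| <= 2 * G -> cutoff G xi = 1.
Proof. by rewrite /cutoff => ->. Qed.

Lemma continuous_cutoff : continuous (cutoff G).
Proof.
have -> : cutoff G = fun xi => Num.max 0 (Num.min 1 (3 - `|xi| / G)).
  by apply/funext => xi; exact: cutoffE.
move=> s; apply: (@continuous_max R R (fun=> 0) (fun xi => Num.min 1 (3 - `|xi| / G))); first exact: cvg_cst.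
apply: (@continuous_min R R (fun=> 1) (fun xi => 3 - `|xi| / G)); first exact: cvg_cst.
apply: cvgB; first exact: cvg_cst.
by apply: cvgM; [apply: cvg_norm; exact: cvg_id|exact: cvg_cst].
Qed.

End Cutoff.

(** * The two equations mode by mode *)

Section ModeEquations.
Context (R : realType) (L : R) (hL : 0 < L) (N : nat).
Local Notation D := (Omega L).
Local Notation eb := (eb L).
Local Notation lam := (lam L).
Local Notation comb := (comb L).
Implicit Types u v w z f : vfield R.

(** [(u . grad) v] need not be square-integrable, so [eqO_ip] does not apply; measurability of the
    advection term is enough to replace q by an equal field. *)
Lemma Bform_eqO u v q q' : L2 L u -> V L v -> L2 L q -> L2 L q' -> eqO L q q' ->
  Bform L u v q = Bform L u v q'.
Proof.
move=> Lu Vv Lq Lq' E; rewrite /Bform !ipE; apply: eq_bigr => j _.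
have ma : measurable_fun D (fun x => advection L u v x 0 j).
  have mw i : measurable_fun D (weak_partial L i (fun x => v x 0 j)).
    by apply: L2s_measurable; exact: L2s_weak_partial.
  have -> : (fun x => advection L u v x 0 j) = (fun x =>
      u x 0 ord0 * weak_partial L ord0 (fun x => v x 0 j) x +
      u x 0 (lift ord0 ord0) * weak_partial L (lift ord0 ord0) (fun x => v x 0 j) x).
    by apply/funext => x; rewrite /advection mxE big_ord_recl big_ord1.
  apply: measurable_funD; apply: measurable_funM; try exact: mw;
    exact: L2s_measurable.
rewrite /ips /Rintegral; congr fine; apply: ae_eq_integral.
- exact: measurable_Omega.
- by apply/measurable_EFinP; apply: measurable_funM => //; exact: L2s_measurable.
- by apply/measurable_EFinP; apply: measurable_funM => //; exact: L2s_measurable.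
by apply: ae_leb2S E => x h Dx; rewrite /= h.
Qed.

Lemma eb_comb k M : k \in modes M -> eb k = comb M (fun l => (l == k)%:R).
Proof.
move=> kM; rewrite !combE (bigD1_seq k) ?modes_uniq //= eqxx scale1r big1 ?addr0 //.
by move=> l /negbTE ->; rewrite scale0r.
Qed.

Lemma PNH_eb k : k \in modes N -> PNH L N (eb k).
Proof. by move=> kN; rewrite (eb_comb kN); exact: PNH_comb. Qed.

Lemma Bform_PNH u q : V L u -> PNH L N q ->
  Bform L u u q = \sum_(k <- modes N) ip L q (eb k) * tri L u u (eb k).
Proof.
move=> Vu hq; have Lu := V_L2 Vu.
have Lq := PNH_L2 hL hq; have Lp : L2 L (proj L N q) by exact: L2_comb.
rewrite (Bform_eqO Lu Vu Lq Lp (nrmB_eq0 Lq Lp (PNH_nrm_proj hL hq))).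
rewrite Bform_tri //; [|exact: V_H|exact: trig_field_comb].
by rewrite projEcomb tri_comb.
Qed.

(** For q in the range of [P_N] the form depends on finitely many coefficients of q, so the
    combination of the [eb k] with coefficients [tri L u u (eb k)] represents it. *)
Lemma PNB_spec u : V L u -> PNH L N (PNB L N u) /\
  forall q, PNH L N q -> ip L (PNB L N u) q = Bform L u u q.
Proof.
move=> Vu; rewrite /PNB; set P := [set p | _].
suff : P (xget 0 P) by [].
apply: (@xgetPex _ 0 P); exists (comb N (fun k => tri L u u (eb k))); split.
  exact: PNH_comb.
move=> q hq; rewrite (ip_combl hL _ _ (PNH_L2 hL hq)).
by rewrite Bform_PNH //; apply: eq_bigr => k _; rewrite mulrC.
Qed.

Lemma low_mode_eq nu f v u k : H L f -> V L u -> PNH L N v -> k \in modes N ->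
  eqO L (nu *: A L v) (PN L N f - PNB L N u) ->
  nu * (lam k * ip L v (eb k)) = ip L f (eb k) - tri L u u (eb k).
Proof.
move=> Hf Vu hv kN E; have hk := PNH_eb kN; have Lk := L2_eb hL k.
have kn0 := modes_neq0 kN; have Lf := H_L2 Hf.
have hA := A_spec (ex_intro _ _ (is_A_PNH hL hv)).
have LA : L2 L (A L v) by case: hA => _ /H_L2.
have [hB EB] := PNB_spec Vu; have [hP EP] := PN_spec hL N Hf.
have LB := PNH_L2 hL hB; have LP := PNH_L2 hL hP.
have := eqO_ip (L2Z nu LA) (L2B LP LB) Lk E.
rewrite ipZl // ipBl // EP // EB // (_ : ip L (A L v) (eb k) = lam k * ip L v (eb k)).
  by move=> ->; rewrite Bform_tri //; [exact: V_H|exact: trig_field_eb].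
by have [_ _ ->] := (is_A_coef hL _ _).1 hA.
Qed.

Lemma is_Apow_eb s k : k != 0 -> is_Apow L s (eb k) (lam k `^ s *: eb k).
Proof.
move=> kn0; apply/is_Apow_coef => //; split; first exact: H_eb.
  by apply: HZ => //; exact: H_eb.
move=> l l0; rewrite ipZl; try exact: L2_eb.
by rewrite ip_eb_eb //; have [<-|_] := eqVneq k l; rewrite ?mulr0.
Qed.

Lemma V_eb k : k != 0 -> V L (eb k).
Proof. by move=> kn0; eexists; exact: is_Apow_eb. Qed.

Lemma ip_Apow_Apow_eb u k : V L u -> k != 0 ->
  ip L (Apow L 2^-1 u) (Apow L 2^-1 (eb k)) = lam k * ip L u (eb k).
Proof.
move=> Vu kn0; have Vk := V_eb kn0; have h := is_Apow_unique hL (V_spec Vk) (is_Apow_eb 2^-1 kn0).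
have Lk := L2_eb hL k; have Lu := L2_Apow Vu; have LZ := L2Z (lam k `^ 2^-1) Lk.
rewrite ipC (nrmB_eq0_ip (L2_Apow Vk) LZ Lu h) ipZl // ipC ip_Apow_eb //.
by rewrite mulrA lam_half.
Qed.

Lemma QNH_eb k : k != 0 -> k \notin modes N -> QNH L N (eb k).
Proof.
move=> kn0 kN; apply: QNH_intro => //; first exact: H_eb.
move=> l lN; rewrite ip_eb_eb ?(modes_neq0 lN) //.
by have [kl|//] := eqVneq k l; rewrite kl lN in kN.
Qed.

End ModeEquations.

Section SumDerive.
Context (R : realType).

Lemma is_derive_seq_sum (I : eqType) (r : seq I) (h : I -> R -> R) (dh : I -> R -> R) (s : R) :
  (forall k, k \in r -> is_derive s 1 (h k) (dh k s)) ->
  is_derive s 1 (fun t => \sum_(k <- r) h k t) (\sum_(k <- r) dh k s).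
Proof.
elim: r => [_|k r IH H].
  have -> : (fun t => \sum_(k <- [::]) h k t) = cst 0.
    by apply/funext => t; rewrite big_nil.
  by rewrite big_nil; exact: is_derive_cst.
have -> : (fun t => \sum_(j <- k :: r) h j t) = h k + (fun t => \sum_(j <- r) h j t).
  by apply/funext => t; rewrite big_cons.
rewrite big_cons; apply: is_deriveD; first by apply: H; rewrite inE eqxx.
by apply: IH => j jr; apply: H; rewrite inE jr orbT.
Qed.

Lemma continuous_seq_sum (I : Type) (r : seq I) (h : I -> R -> R) :
  (forall k, continuous (h k)) -> continuous (fun t => \sum_(k <- r) h k t).
Proof.
move=> ch; elim: r => [|k r IH].
  have -> : (fun t => \sum_(k <- [::]) h k t) = cst 0.
    by apply/funext => t; rewrite big_nil.
  by move=> s; exact: cvg_cst.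
have -> : (fun t => \sum_(j <- k :: r) h j t) = (fun t => h k t + \sum_(j <- r) h j t).
  by apply/funext => t; rewrite big_cons.
by move=> s; apply: cvgD; [exact: ch|exact: IH].
Qed.

Lemma is_derive_half_sqr (h : R -> R) (d s : R) : is_derive s 1 h d ->
  is_derive s 1 (fun t => 2^-1 * h t ^+ 2) (h s * d).
Proof.
move=> dh; have h1 := is_deriveM dh dh.
have h2 := is_deriveZ 2^-1 h1.
have -> : (fun t => 2^-1 * h t ^+ 2) = 2^-1 *: (h * h)%R.
  by apply/funext => t; rewrite expr2.
have -> : h s * d = 2^-1 *: (h s *: d + h s *: d); last exact: h2.
by rewrite /GRing.scale /=; field.
Qed.

End SumDerive.

(** * Scalar inequalities behind the estimates *)

Lemma eq_ler (R : realDomainType) (a b : R) : a = b -> a <= b.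
Proof. by move=> ->. Qed.

(** In scaled variables x is the norm of [v0], y that of [w0], p the cutoff and n is N. If
    [x > 2 G], the forcing pays for at most half of [p x^2], so the first inequality makes y and
    [p x] of order [G / n]. Then the nonlinear term of the second is at most [25/48 G x], and
    [x <= 73/48 G] is a contradiction. *)
Lemma cutoff_arith_scaled (R : realType) (G c n p x y : R) : 0 < G -> 0 <= c -> 1 <= n -> 0 <= p ->
  0 <= x -> 0 <= y -> 3 * c * G < n ->
  p * x ^+ 2 + y ^+ 2 <= G * (p * x + y / n) ->
  x ^+ 2 <= G * x + c * (p * x + y) ^+ 2 * x -> x <= 2 * G.
Proof.
move=> G0 c0 n1 p0 x0 y0 hc h1 h2; rewrite leNgt; apply/negP => xG.
have n0 : 0 < n by lra.
have h1' : n * (p * x * G + y ^+ 2) <= G * y.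
  have : p * x ^+ 2 - p * x * G >= p * x * G.
    have -> : p * x ^+ 2 - p * x * G = p * x * (x - G) by ring.
    by apply: ler_wpM2l; [rewrite mulr_ge0|lra].
  move=> h; have : p * x * G + y ^+ 2 <= G * (y / n) by move: h h1; rewrite mulrDr; nra.
  by rewrite mulrA ler_pdivlMr // mulrC.
have px0 : 0 <= p * x by rewrite mulr_ge0.
have ny : n * y <= G.
  have [->|yn0] := eqVneq y 0; first by rewrite mulr0 ltW.
  have y1 : 0 < y by rewrite lt_neqAle eq_sym yn0.
  rewrite -(ler_pM2r y1); apply: le_trans h1'.
  have : 0 <= n * (p * x * G) by rewrite !mulr_ge0 // ltW.
  by rewrite mulrDr -[n * y * y]mulrA -expr2 lerDr.
move: (p * x) px0 h1' h2 => q q0 h1' h2.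
(* Completing the square: [4 n y G - 4 (n y)^2 <= G^2]. *)
have hz : 4 * n * q <= G.
  have h : 4 * (n * (n * q)) <= G.
    rewrite -(ler_pM2r G0); have := sqr_ge0 (2 * (n * y) - G).
    have : n * (n * (q * G + y ^+ 2)) <= n * (G * y) by rewrite ler_wpM2l // ltW.
    by nra.
  have : n * q <= n * (n * q) by rewrite ler_peMl // mulr_ge0 // ltW.
  by lra.
have xx : x <= G + c * (q + y) ^+ 2.
  have x1 : 0 < x by lra.
  by rewrite -(ler_pM2r x1) mulrDl -expr2.
have h : n * (q + y) <= 5 / 4 * G by rewrite mulrDr; lra.
(* [25/48] is [(5/4)^2 / 3], the factor [1/3] coming from [3 c G < n]. *)
have h3 : n * (c * (q + y) ^+ 2) <= G * (25 / 48).
  rewrite -(ler_pM2l n0).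
  have h4 : (n * (q + y)) ^+ 2 <= (5 / 4 * G) ^+ 2.
    by rewrite ler_pXn2r // nnegrE; rewrite ?mulr_ge0 ?addr_ge0 // ltW.
  have h5 := ler_wpM2l c0 h4.
  have h6 : 3 * c * G * G <= n * G by rewrite ler_pM2r // ltW.
  move: h5 h6; set z := q + y.
  rewrite (_ : n * (n * (c * z ^+ 2)) = c * (n * z) ^+ 2); last by ring.
  by lra.
have : c * (q + y) ^+ 2 <= n * (c * (q + y) ^+ 2).
  by rewrite ler_peMl // mulr_ge0 // sqr_ge0.
by lra.
Qed.

(** Dimensional form: the norms are divided by [nu k0], both inequalities by [nu^3 k0^2]. *)
Lemma cutoff_arith (R : realType) (nu k0 F c n p V W : R) : 0 < nu -> 0 < k0 -> 0 < F -> 0 <= c -> 1 <= n ->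
  0 <= p -> 0 <= V -> 0 <= W -> 3 * c * (F / (nu ^+ 2 * k0 ^+ 2)) < n ->
  nu * (p * V ^+ 2) + nu * W ^+ 2 <= F * (p * (k0^-1 * V) + k0^-1 * n^-1 * W) ->
  nu * V ^+ 2 <= F * (k0^-1 * V) + c * (p * V + W) ^+ 2 * (k0^-1 * V) ->
  V / (nu * k0) <= 2 * (F / (nu ^+ 2 * k0 ^+ 2)).
Proof.
move=> nu0 k00 F0 c0 n1 p0 V0 W0 hc h1 h2.
have nn : nu != 0 by rewrite gt_eqF. have kn : k0 != 0 by rewrite gt_eqF.
have nN : n != 0 by rewrite gt_eqF //; lra.
have d0 : 0 < nu ^+ 3 * k0 ^+ 2 by rewrite mulr_gt0 // exprn_gt0.
have nk : 0 <= nu * k0 by rewrite mulr_ge0 // ltW.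
apply: (@cutoff_arith_scaled R _ c n p _ (W / (nu * k0))) => //.
- by rewrite divr_gt0 // mulr_gt0 // exprn_gt0.
- by rewrite divr_ge0.
- by rewrite divr_ge0.
- rewrite -(ler_pM2l d0).
  rewrite [leLHS](_ : _ = nu * (p * V ^+ 2) + nu * W ^+ 2); last by field; apply/andP.
  rewrite [leRHS](_ : _ = F * (p * (k0^-1 * V) + k0^-1 * n^-1 * W)) //.
  by field; apply/and3P.
rewrite -(ler_pM2l d0).
rewrite [leLHS](_ : _ = nu * V ^+ 2); last by field; apply/andP.
rewrite [leRHS](_ : _ = F * (k0^-1 * V) + c * (p * V + W) ^+ 2 * (k0^-1 * V)) //.
by field; apply/andP.
Qed.

Lemma le_pdivl (R : realFieldType) (x y z : R) : 0 < x -> x * y <= z -> y <= x^-1 * z.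
Proof. by move=> x0; rewrite ler_pdivlMl. Qed.

(** Here a and b are the two norms of the tail, z and y those of [A p], and k is [kappa0 M]. The
    hypotheses on k give [a y <= z b], in which k has cancelled. *)
Lemma enstrophy_arith1 (R : rcfType) (c k a b V z y t : R) : 0 <= a -> 0 <= b -> 0 <= V -> 0 <= z -> 0 <= y ->
  k * a <= b -> y <= k * z ->
  t <= c * Num.sqrt a * Num.sqrt b * V * Num.sqrt z * Num.sqrt y ->
  t <= `|c| * V * z * b.
Proof.
move=> a0 b0 V0 z0 y0 h1 h2 h; apply: (le_trans h).
have -> : c * Num.sqrt a * Num.sqrt b * V * Num.sqrt z * Num.sqrt y =
    c * (V * (Num.sqrt a * Num.sqrt b * Num.sqrt z * Num.sqrt y)) by ring.
have -> : `|c| * V * z * b = `|c| * (V * (z * b)) by ring.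
have q0 : 0 <= Num.sqrt a * Num.sqrt b * Num.sqrt z * Num.sqrt y by rewrite !mulr_ge0 ?sqrtr_ge0.
apply: (@le_trans _ _ (`|c| * (V * (Num.sqrt a * Num.sqrt b * Num.sqrt z * Num.sqrt y)))).
  by apply: ler_wpM2r; rewrite ?ler_norm // mulr_ge0.
apply: ler_wpM2l => //; apply: ler_wpM2l => //.
rewrite -!sqrtrM ?mulr_ge0 //.
have zb : 0 <= z * b by rewrite mulr_ge0.
rewrite -[leRHS]ger0_norm // -sqrtr_sqr; apply: ler_wsqrtr.
have -> : a * b * z * y = (a * y) * (z * b) by ring.
rewrite expr2; apply: ler_wpM2r => //.
apply: (@le_trans _ _ (a * (k * z))); first exact: ler_wpM2l.
have -> : a * (k * z) = z * (k * a) by ring.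
exact: ler_wpM2l.
Qed.

Lemma enstrophy_arith2 (R : rcfType) (c p u z b t : R) : 0 <= p -> p <= u -> 0 <= z -> 0 <= b ->
  t <= c * Num.sqrt p * Num.sqrt z * b * z -> t <= `|c| * Num.sqrt u * (Num.sqrt z * z) * b.
Proof.
move=> p0 pu z0 b0 h; apply: (le_trans h).
have -> : c * Num.sqrt p * Num.sqrt z * b * z = c * (Num.sqrt p * (Num.sqrt z * z * b)) by ring.
have -> : `|c| * Num.sqrt u * (Num.sqrt z * z) * b = `|c| * (Num.sqrt u * (Num.sqrt z * z * b)) by ring.
have q0 : 0 <= Num.sqrt z * z * b by rewrite !mulr_ge0 ?sqrtr_ge0.
apply: (@le_trans _ _ (`|c| * (Num.sqrt p * (Num.sqrt z * z * b)))).
  by apply: ler_wpM2r; rewrite ?ler_norm // mulr_ge0 ?sqrtr_ge0.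
by apply: ler_wpM2l => //; apply: ler_wpM2r => //; exact: ler_wsqrtr.
Qed.

(** z stands for [|A p|]; both z and [z^(3/2)] are at most [1 + z^2], a quantity that the viscous
    term controls. *)
Lemma enstrophy_arith3 (R : rcfType) (a1 a2 V B u D z b : R) : 0 <= a1 -> 0 <= a2 -> 0 <= V -> V <= B ->
  u <= D -> 0 <= z -> 0 <= b ->
  a1 * V * z * b + a2 * Num.sqrt u * (Num.sqrt z * z) * b <=
  (a1 * B + a2 * Num.sqrt D) * b * (1 + z ^+ 2).
Proof.
move=> a10 a20 V0 VB uD z0 b0.
have z1 : z <= 1 + z ^+ 2 by nra.
have z2 : Num.sqrt z * z <= 1 + z ^+ 2.
  have [zz|/ltW zz] := leP z 1.
    have : Num.sqrt z <= 1 by rewrite -sqrtr1; exact: ler_wsqrtr.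
    by move: (Num.sqrt z) (sqrtr_ge0 z) => q q0 q1; nra.
  have : Num.sqrt z <= z.
    rewrite -[leRHS]ger0_norm // -sqrtr_sqr; apply: ler_wsqrtr; nra.
  by move: (Num.sqrt z) (sqrtr_ge0 z) => q q0 q1; nra.
have z3 : 0 <= 1 + z ^+ 2 by rewrite addr_ge0 // sqr_ge0.
have sD : Num.sqrt u <= Num.sqrt D by exact: ler_wsqrtr.
have qz : 0 <= Num.sqrt z * z by rewrite mulr_ge0 ?sqrtr_ge0.
rewrite [leRHS](_ : _ = a1 * B * (1 + z ^+ 2) * b + a2 * Num.sqrt D * (1 + z ^+ 2) * b); last by ring.
have aB : a1 * V * z <= a1 * B * (1 + z ^+ 2).
  rewrite -!mulrA; apply: ler_wpM2l => //; exact: ler_pM.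
apply: lerD; apply: ler_wpM2r => //.
by rewrite -!mulrA; apply: ler_wpM2l => //; apply: ler_pM; rewrite ?sqrtr_ge0.
Qed.

(** [al] is [|A u_M|], [rho] the tail, T the nonlinear term and X the work of the force. As
    [C e <= nu / 2], half of the viscous term absorbs [C rho al^2], and a quarter absorbs [F al].
    The last quarter bounds [al^2] by [4 / nu (F^2 / nu + 1 + nu / 2)], independently of M, so the
    total error is of order e. *)
Lemma rate_bound_arith (R : realType) (nu C F al rho e T X S I : R) : 0 < nu -> 0 <= C -> 0 <= al ->
  0 < e -> e <= 1 -> C * e <= nu / 2 -> 0 <= rho -> rho <= e ->
  `|T| <= C * rho * (1 + al ^+ 2) -> X <= F * al -> - e <= X - nu * al ^+ 2 - T ->
  4 * nu * I <= S + 4 * nu * (nu * al ^+ 2 - X) ->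
  4 * nu * I <= S + 4 * nu * e * (1 + C * (1 + 4 / nu * (F ^+ 2 / nu + 1 + nu / 2))).
Proof.
move=> nu0 C0 al0 e0 e1 Ce r0 re hT hX hd hY; apply: (le_trans hY); rewrite lerD2l -[leRHS]mulrA.
apply: ler_wpM2l; first by rewrite mulr_ge0 // ltW.
have hT' : - T <= C * e * (1 + al ^+ 2).
  apply: (le_trans (ler_norm _)); rewrite normrN (le_trans hT) //.
  by apply: ler_wpM2r; [rewrite addr_ge0 // sqr_ge0|exact: ler_wpM2l].
have h : nu * al ^+ 2 - X <= e + C * e * (1 + al ^+ 2) by lra.
apply: (le_trans h).
have -> : e * (1 + C * (1 + 4 / nu * (F ^+ 2 / nu + 1 + nu / 2))) =
  e + C * e * (1 + 4 / nu * (F ^+ 2 / nu + 1 + nu / 2)) by ring.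
rewrite lerD2l; apply: ler_wpM2l; first by rewrite mulr_ge0 // ltW.
rewrite lerD2l.
have h1 : C * e * (1 + al ^+ 2) <= nu / 2 * (1 + al ^+ 2).
  by apply: ler_wpM2r => //; rewrite addr_ge0 // sqr_ge0.
have h2 : F * al <= nu / 4 * al ^+ 2 + F ^+ 2 / nu.
  rewrite -subr_ge0 (_ : _ - _ = nu * (al / 2 - F / nu) ^+ 2); last by field; rewrite gt_eqF.
  by rewrite mulr_ge0 ?sqr_ge0 // ltW.
rewrite mulrAC ler_pdivlMr //.
by move: (F ^+ 2 / nu) (al ^+ 2) (F * al) (C * e * _) h h1 h2 hX => *; lra.
Qed.

Lemma ler_sqr_mono (R : realDomainType) (x y : R) : 0 <= x -> x <= y -> x ^+ 2 <= y ^+ 2.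
Proof. by move=> x0 xy; rewrite ler_pXn2r // nnegrE (le_trans x0). Qed.

(** * The given solution: coefficients and energy balance *)

Section Solution.
Context (R : realType) (nu L cA cB cL cT : R) (N : nat) (f : vfield R)
  (v0 w0 : R -> vfield R) (sigma0 sigma1 : R).
Context (hnu : 0 < nu) (hL : 0 < L) (hN : (0 < N)%N)
  (hc : absolute_constants cA cB cL cT)
  (hf : H L f) (hf0 : 0 < nrm L f)
  (hv0 : X L N v0) (hw0 : is_W nu L N f v0 w0)
  (heqv : forall s, eqO L (nu *: A L (v0 s))
            (PN L N f - PNB L N (trunc nu L f v0 s + w0 s)))
  (heqw : weak_eq nu L N f v0 w0)
  (hmono : forall s t, sigma0 < s -> s <= t -> t < sigma1 ->
             nrm L (w0 s) <= nrm L (w0 t)).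
Local Notation k0 := (kappa0 L).
Local Notation eb := (eb L).
Local Notation lam := (lam L).
Local Notation proj := (proj L).
Local Notation comb := (comb L).
Local Notation G := (Grashof nu L f).
Local Notation leb := (@lebesgue_measure R).

Definition phi (s : R) : R := cutoff G (Vnrm L (v0 s) / (nu * k0)).
Definition Utr (s : R) : vfield R := trunc nu L f v0 s + w0 s.
Definition ca (k : int * int) (s : R) : R := ip L (v0 s) (eb k).
Definition cb (k : int * int) (s : R) : R := ip L (w0 s) (eb k).
Definition cT_ (k : int * int) (s : R) : R := tri L (Utr s) (Utr s) (eb k).
Definition fk (k : int * int) : R := ip L f (eb k).
(** The right-hand side of the ordinary differential equation for [cb k] when k lies beyond
    [modes N]. *)
Definition gk (k : int * int) (s : R) : R := fk k - nu * (lam k * cb k s) - cT_ k s.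

Lemma G_gt0 : 0 < G.
Proof. by rewrite /Grashof divr_gt0 // mulr_gt0 // exprn_gt0 // kappa0_gt0. Qed.

Lemma v_PNH s : PNH L N (v0 s). Proof. by case: hv0. Qed.
Lemma v_V s : V L (v0 s). Proof. exact: PNH_V (v_PNH s). Qed.
Lemma v_L2 s : L2 L (v0 s). Proof. exact: V_L2 (v_V s). Qed.
Lemma w_QNH s : QNH L N (w0 s). Proof. by case: hw0 => -[]. Qed.
Lemma w_V s : V L (w0 s). Proof. by case: hw0. Qed.
Lemma w_L2 s : L2 L (w0 s). Proof. exact: V_L2 (w_V s). Qed.
Lemma w_H s : H L (w0 s). Proof. exact: V_H (w_V s). Qed.
Lemma f_L2 : L2 L f. Proof. exact: H_L2 hf. Qed.

Lemma Utr_V s : V L (Utr s).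
Proof. by apply: VD => //; [apply: VZ => //; exact: v_V|exact: w_V]. Qed.
Lemma Utr_L2 s : L2 L (Utr s). Proof. exact: V_L2 (Utr_V s). Qed.
Lemma Utr_H s : H L (Utr s). Proof. exact: V_H (Utr_V s). Qed.

Lemma v_continuous : nrm_continuous L v0.
Proof.
move=> s; have [_ _ /(_ s) h] := hv0.
have p0 := kappa0_gt0 hL.
apply: (@cvg0_le _ _ _ _ (fun t => k0^-1 * Vnrm L (v0 t - v0 s))).
  move=> t; rewrite subr0 ger0_norm ?nrm_ge0 // ler_pdivlMl //.
  apply: poincare_V => //; apply: VB => //; exact: v_V.
rewrite -[X in _ --> X](mulr0 k0^-1); apply: cvgM; [exact: cvg_cst|exact: h].
Qed.

Lemma v_Vnrm_continuous : continuous (fun s => Vnrm L (v0 s)).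
Proof.
move=> s; have [_ _ /(_ s) h] := hv0; apply: (cvg0_le _ h) => t.
by apply: Vnrm_dist_le => //; exact: v_V.
Qed.

Lemma w_continuous : nrm_continuous L w0.
Proof. by move=> s; case: hw0 => -[_ _ h] _ _ _; exact: h. Qed.

Lemma phi_continuous : continuous phi.
Proof.
move=> s; apply: (@continuous_comp _ _ _ (fun s => Vnrm L (v0 s) / (nu * k0)) (cutoff G)).
  by apply: cvgM; [exact: v_Vnrm_continuous|exact: cvg_cst].
exact: continuous_cutoff G_gt0 _.
Qed.

Lemma phi_ge0 s : 0 <= phi s. Proof. exact: cutoff_ge0 G_gt0 _. Qed.
Lemma phi_le1 s : phi s <= 1. Proof. exact: cutoff_le1 G_gt0 _. Qed.

Lemma Utr_continuous : nrm_continuous L Utr.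
Proof.
apply: nrm_continuousD.
- by move=> s; apply: L2Z; exact: v_L2.
- exact: w_L2.
- by apply: nrm_continuousZ; [exact: v_L2|exact: phi_continuous|exact: v_continuous].
- exact: w_continuous.
Qed.

Lemma ca_high k s : k != 0 -> k \notin modes N -> ca k s = 0.
Proof. exact: PNH_coef hL _ _ _ (v_PNH s). Qed.

Lemma cb_low k s : k \in modes N -> cb k s = 0.
Proof. exact: QNH_coef hL _ _ _ (w_QNH s). Qed.

Lemma Utr_coef k s : ip L (Utr s) (eb k) = phi s * ca k s + cb k s.
Proof.
have Lk := L2_eb hL k; rewrite /Utr ipDl ?ipZl //; first exact: v_L2.
- by apply: L2Z; exact: v_L2.
- exact: w_L2.
Qed.

Lemma cb_continuous k : continuous (cb k).
Proof. by apply: nrm_continuous_ip; [exact: w_L2|exact: w_continuous|exact: L2_eb]. Qed.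

Lemma cT_continuous k : continuous (cT_ k).
Proof. by apply: nrm_continuous_tri; [exact: Utr_L2|exact: Utr_continuous|exact: trig_field_eb]. Qed.

Lemma gk_continuous k : continuous (gk k).
Proof.
move=> s; apply: cvgB; last exact: cT_continuous.
apply: cvgB; first exact: cvg_cst.
apply: cvgM; first exact: cvg_cst.
by apply: cvgM; [exact: cvg_cst|exact: cb_continuous].
Qed.

Lemma low_eq k s : k \in modes N -> nu * (lam k * ca k s) = fk k - cT_ k s.
Proof. by move=> kN; apply: (low_mode_eq hL hf (Utr_V s) (v_PNH s) kN); exact: heqv. Qed.

(** Testing with a single eigenfunction makes the nonlinear term continuous in time, so the
    integrated equation can be differentiated. *)
Lemma high_eq k : k != 0 -> k \notin modes N ->
  forall s : R, is_derive s 1 (cb k) (gk k s).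
Proof.
move=> kn0 kN; apply: is_derive_of_increments; first exact: gk_continuous.
move=> a b ab; have := heqw (V_eb hL kn0) (QNH_eb hL kn0 kN) ab.
rewrite ip_QN_high // -/(fk k) -/(cb k a) -/(cb k b).
have Ic (c : R) : leb.-integrable `[a, b] (EFin \o cst c).
  by apply: continuous_integrable => s; exact: cvg_cst.
pose h s := nu * (lam k * cb k s) + cT_ k s.
have ch : continuous h.
  move=> s; apply: cvgD; last exact: cT_continuous.
  apply: cvgM; first exact: cvg_cst.
  by apply: cvgM; [exact: cvg_cst|exact: cb_continuous].
have -> : \int[leb]_(s in `[a, b])
    (nu * ip L (Apow L 2^-1 (w0 s)) (Apow L 2^-1 (eb k)) +
     Bform L (trunc nu L f v0 s + w0 s) (trunc nu L f v0 s + w0 s) (eb k)) =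
    \int[leb]_(s in `[a, b]) h s.
  apply: eq_Rintegral => s _; rewrite /h ip_Apow_Apow_eb //; last exact: w_V.
  congr (_ + _); apply: (Bform_tri hL (Utr_H s) (Utr_V s)); exact: trig_field_eb.
have -> : \int[leb]_(s in `[a, b]) gk k s =
    \int[leb]_(s in `[a, b]) fk k - \int[leb]_(s in `[a, b]) h s.
  rewrite -RintegralB //; last exact: continuous_integrable.
  - by apply: eq_Rintegral => s _; rewrite /gk /h opprD addrA.
  - exact: Ic.
rewrite Rintegral_cst //= lebesgue_measure_itv /=.
have -> : fine (if (a%:E < b%:E)%E then b%:E - a%:E else 0)%E = b - a.
  rewrite lte_fin; case: ifPn => //; rewrite -leNgt => ba.
  by have -> : a = b by [apply/eqP; rewrite eq_le ab]; rewrite subrr.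
by rewrite [fk k * _]mulrC => <-; rewrite addrK.
Qed.

(** Valid for every nonzero k: on the modes of [P_N] the coefficient [cb k] is identically 0,
    although [gk k] need not vanish there. *)
Lemma energy_derive k (s : R) : k != 0 ->
  is_derive s 1 (fun t => 2^-1 * cb k t ^+ 2) (cb k s * gk k s).
Proof.
move=> kn0; have [kN|kN] := boolP (k \in modes N).
  have -> : (fun t => 2^-1 * cb k t ^+ 2) = cst 0.
    by apply/funext => t; rewrite cb_low // expr0n mulr0.
  by rewrite cb_low // mul0r; exact: is_derive_cst.
by apply: is_derive_half_sqr; exact: high_eq.
Qed.

Lemma VD_proj_sqr M u : V L u ->
  Vnrm L (proj M u) ^+ 2 = \sum_(k <- modes M) lam k * ip L u (eb k) ^+ 2.
Proof.
move=> Vu; rewrite projEcomb (Vnrm_eq hL (is_Apow_comb hL 2^-1 M _)) nrm_sqr.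
rewrite ip_comb_comb //; apply: eq_bigr => k _; rewrite -[in RHS](lam_half L k).
by move: (lam k `^ 2^-1) (ip L u (eb k)) => *; ring.
Qed.

Lemma v_Vnrm_sqr M s : (N <= M)%N ->
  Vnrm L (v0 s) ^+ 2 = \sum_(k <- modes M) lam k * ca k s ^+ 2.
Proof.
move=> NM; rewrite -(PNH_Vnrm hL (v_PNH s)) VD_proj_sqr; last exact: v_V.
rewrite (big_modesS _ NM) [X in _ = _ + X]big_seq_cond [X in _ = _ + X]big1 ?addr0 //.
by move=> k /andP[/modes_neq0 kn0 kN]; rewrite ca_high // expr0n mulr0.
Qed.

Lemma w_Vnrm_proj_sqr M s :
  Vnrm L (proj M (w0 s)) ^+ 2 = \sum_(k <- modes M) lam k * cb k s ^+ 2.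
Proof. exact: VD_proj_sqr (w_V s). Qed.

Lemma tri_Utr_proj M s :
  tri L (Utr s) (Utr s) (proj M (Utr s)) = \sum_(k <- modes M) (phi s * ca k s + cb k s) * cT_ k s.
Proof.
rewrite projEcomb tri_comb //; try exact: Utr_L2.
by apply: eq_bigr => k _; rewrite Utr_coef.
Qed.

Lemma f_Utr_proj M s :
  ip L f (proj M (Utr s)) = \sum_(k <- modes M) (phi s * ca k s + cb k s) * fk k.
Proof.
rewrite projEcomb ip_combr //; last exact: f_L2.
by apply: eq_bigr => k _; rewrite Utr_coef.
Qed.

(* Testing the truncated system with U = phi v + w: the equation for v, which
   holds for every s, is multiplied by phi. *)
Lemma energy_identity M s : (N <= M)%N ->
  \sum_(k <- modes M) cb k s * gk k s =
  ip L f (proj M (Utr s)) - tri L (Utr s) (Utr s) (proj M (Utr s))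
  - nu * (phi s * Vnrm L (v0 s) ^+ 2) - nu * Vnrm L (proj M (w0 s)) ^+ 2.
Proof.
move=> NM; transitivity (
  \sum_(k <- modes M) (phi s * ca k s + cb k s) * fk k
  - \sum_(k <- modes M) (phi s * ca k s + cb k s) * cT_ k s
  - nu * (phi s * \sum_(k <- modes M) lam k * ca k s ^+ 2)
  - nu * \sum_(k <- modes M) lam k * cb k s ^+ 2); last first.
  congr (_ - _ - nu * (phi s * _) - nu * _); apply: esym.
  - exact: f_Utr_proj.
  - exact: tri_Utr_proj.
  - exact: v_Vnrm_sqr.
  - exact: w_Vnrm_proj_sqr.
rewrite !mulr_sumr -!sumrB big_seq [RHS]big_seq; apply: eq_bigr => k kM.
rewrite /gk; have kn0 := modes_neq0 kM.
have [kN|kN] := boolP (k \in modes N).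
  have := low_eq s kN; rewrite cb_low //.
  move: (phi s) (lam k) (ca k s) (fk k) (cT_ k s) => p l a ff t E.
  have -> : ff = nu * (l * a) + t by rewrite E subrK.
  by ring.
rewrite ca_high //.
by move: (phi s) (lam k) (cb k s) (fk k) (cT_ k s) => *; ring.
Qed.

Lemma Bform_cL u v w : V L u -> V L v -> V L w -> `|Bform L u v w| <=
  cL * Num.sqrt (nrm L u) * Num.sqrt (Vnrm L u) * Vnrm L v *
  Num.sqrt (nrm L w) * Num.sqrt (Vnrm L w).
Proof. by move=> Vu Vv Vw; have [_ [h _] _] := hc hL; exact: h. Qed.

Lemma bilinear_arith (c V b i a1 a2 a3 a4 : R) :
  a1 <= i -> a2 <= b -> a3 <= i -> a4 <= b ->
  0 <= a1 -> 0 <= a2 -> 0 <= a3 -> 0 <= a4 -> 0 <= V ->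
  c * a1 * a2 * V * a3 * a4 <= `|c| * (i * b) ^+ 2 * V.
Proof.
move=> h1 h2 h3 h4 s1 s2 s3 s4 V0.
rewrite (_ : c * a1 * a2 * V * a3 * a4 = c * ((a1 * a2) * (a3 * a4) * V)); last by ring.
rewrite -[leRHS]mulrA; apply: (@le_trans _ _ (`|c| * ((a1 * a2) * (a3 * a4) * V))).
  by rewrite ler_wpM2r ?ler_norm // !mulr_ge0.
apply: ler_wpM2l => //; apply: ler_wpM2r => //.
by rewrite expr2; apply: ler_pM; rewrite ?mulr_ge0 //; apply: ler_pM.
Qed.

Lemma Bform_bounded B u v w : V L u -> V L v -> V L w ->
  Vnrm L u <= B -> Vnrm L w <= B ->
  `|Bform L u v w| <= `|cL| * (Num.sqrt (k0^-1 * B) * Num.sqrt B) ^+ 2 * Vnrm L v.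
Proof.
move=> Vu Vv Vw uB wB; apply: (le_trans (Bform_cL Vu Vv Vw)).
have p0 := kappa0_gt0 hL.
have h z : V L z -> Vnrm L z <= B -> Num.sqrt (nrm L z) <= Num.sqrt (k0^-1 * B).
  by move=> Vz zB; apply: ler_wsqrtr; exact: (le_pdivl p0 (le_trans (poincare_V hL Vz) zB)).
exact: bilinear_arith (h u Vu uB) (ler_wsqrtr uB) (h w Vw wB) (ler_wsqrtr wB)
  (sqrtr_ge0 _) (sqrtr_ge0 _) (sqrtr_ge0 _) (sqrtr_ge0 _) (Vnrm_ge0 L v).
Qed.

Lemma Utr_bound : exists2 B, 0 <= B & forall s, Vnrm L (Utr s) <= B.
Proof.
have [_ [Mv hMv] _] := hv0; have [_ _ [Mw hMw] _] := hw0.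
exists (Mv + Mw) => [|s].
  by rewrite addr_ge0 // (le_trans (Vnrm_ge0 _ _) (hMv 0), le_trans (Vnrm_ge0 _ _) (hMw 0)).
have Vp := VZ hL (phi s) (v_V s).
apply: (le_trans (VnrmD_le hL Vp (w_V s))); apply: lerD; last exact: hMw.
rewrite VnrmZ //; last exact: v_V.
rewrite ger0_norm ?phi_ge0 // (le_trans _ (hMv s)) //.
by rewrite ler_piMl ?Vnrm_ge0 // phi_le1.
Qed.

(** [B(U, p, p) = 0] for the projection p of U, so the middle argument may be replaced by the tail
    [U - p]; the other two are bounded in V uniformly in time. *)
Lemma tri_tail : exists2 C, 0 <= C & forall M s,
  `|tri L (Utr s) (Utr s) (proj M (Utr s))| <= C * Vnrm L (Utr s - proj M (Utr s)).
Proof.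
have [B B0 hB] := Utr_bound.
exists (`|cL| * (Num.sqrt (k0^-1 * B) * Num.sqrt B) ^+ 2); first by rewrite mulr_ge0 // sqr_ge0.
move=> M s; have VU := Utr_V s; have VP := V_proj hL M (Utr s).
have tP : trig_field L (proj M (Utr s)) by exact: trig_field_comb.
have LU := Utr_L2 s; have LP := V_L2 VP.
have E : tri L (Utr s) (Utr s) (proj M (Utr s)) =
    Bform L (Utr s) (Utr s - proj M (Utr s)) (proj M (Utr s)).
  rewrite (Bform_tri hL (Utr_H s) (VB hL VU VP) tP).
  by rewrite triBm // (tri_self hL (Utr_H s) tP) subr0.
rewrite E; apply: (Bform_bounded VU (VB hL VU VP) VP (hB s)).
exact: (le_trans (Vnrm_proj_le hL M VU) (hB s)).
Qed.

Lemma Vnrm_proj_cvg u : V L u ->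
  Vnrm L (proj M u) ^+ 2 @[M --> \oo] --> Vnrm L u ^+ 2.
Proof.
move=> Vu; have E : ip L (Apow L 2^-1 u) (Apow L 2^-1 u) = Vnrm L u ^+ 2.
  by apply: esym; exact: Vnrm_sqr.
have := ip_Apow_cvg hL Vu Vu; rewrite E.
apply: cvg_trans; apply: near_eq_cvg; exists 0%N; first by [].
move=> M _; apply: esym; apply: (etrans (VD_proj_sqr M Vu)).
by apply: eq_bigr => k _; rewrite expr2.
Qed.

Lemma Vnrm_proj_mono K M u : V L u -> (K <= M)%N ->
  Vnrm L (proj K u) ^+ 2 <= Vnrm L (proj M u) ^+ 2.
Proof.
move=> Vu KM; apply: (@le_trans _ _ (\sum_(k <- modes M) lam k * ip L u (eb k) ^+ 2)).
  apply: (le_trans (eq_ler (VD_proj_sqr K Vu))); rewrite (big_modesS _ KM) lerDl sumr_ge0 // => k _.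
  by rewrite mulr_ge0 ?lam_ge0 // sqr_ge0.
exact: eq_ler (esym (VD_proj_sqr M Vu)).
Qed.

Definition psi (K : nat) (s : R) : R := ip L f (Utr s)
  - nu * (phi s * Vnrm L (v0 s) ^+ 2) - nu * Vnrm L (proj K (w0 s)) ^+ 2.

Lemma psi_continuous K : continuous (psi K).
Proof.
have c1 : continuous (fun s => ip L f (Utr s)).
  under eq_fun do rewrite ipC.
  by apply: nrm_continuous_ip; [exact: Utr_L2|exact: Utr_continuous|exact: f_L2].
have c2 : continuous (fun s => Vnrm L (v0 s) ^+ 2).
  by move=> s; apply: cvgM; exact: v_Vnrm_continuous.
have c3 : continuous (fun s => \sum_(k <- modes K) lam k * cb k s ^+ 2).
  apply: continuous_seq_sum => k s; apply: cvgM; first exact: cvg_cst.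
  by apply: cvgM; exact: cb_continuous.
have -> : psi K = fun s => ip L f (Utr s) - nu * (phi s * Vnrm L (v0 s) ^+ 2)
    - nu * \sum_(k <- modes K) lam k * cb k s ^+ 2.
  by apply/funext => s; congr (_ - nu * _); exact: w_Vnrm_proj_sqr.
move=> s; apply: cvgB; last by apply: cvgM; [exact: cvg_cst|exact: c3].
apply: cvgB; first exact: c1.
apply: cvgM; first exact: cvg_cst.
by apply: cvgM; [exact: phi_continuous|exact: c2].
Qed.

Lemma rate_arith (C a1 a2 a3 a4 a5 a6 a7 a8 : R) :
  a1 <= a3 + a4 * a8 -> - a2 <= C * a8 -> a5 <= a6 ->
  a1 - a2 - a7 - a6 <= a3 - a7 - a5 + (a4 + C) * a8.
Proof. by rewrite mulrDl => h1 h2 h3; lra. Qed.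

Lemma energy_rate_le : exists2 C, 0 <= C & forall K M s, (N <= K)%N -> (K <= M)%N ->
  \sum_(k <- modes M) cb k s * gk k s <=
  psi K s + C * Vnrm L (Utr s - proj M (Utr s)).
Proof.
have [C C0 hC] := tri_tail; have p0 := kappa0_gt0 hL.
exists (nrm L f * k0^-1 + C); first by rewrite addr_ge0 // mulr_ge0 ?nrm_ge0 // invr_ge0 ltW.
move=> K M s NK KM; rewrite (energy_identity s (leq_trans NK KM)) /psi.
set r := Utr s - proj M (Utr s).
have Vr : V L r by apply: VB => //; [exact: Utr_V|exact: V_proj].
have h1 : ip L f (proj M (Utr s)) <= ip L f (Utr s) + nrm L f * k0^-1 * Vnrm L r.
  have LP : L2 L (proj M (Utr s)) by exact: L2_comb.
  have E := ipBr (Utr_L2 s) LP f_L2.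
  rewrite -lerBlDl -[leLHS]opprB -E -/r (le_trans (ler_norm _)) // normrN.
  apply: (le_trans (cauchy_schwarz f_L2 (V_L2 Vr))); rewrite -mulrA ler_wpM2l ?nrm_ge0 //.
  by rewrite ler_pdivlMl //; exact: poincare_V.
have h2 : - tri L (Utr s) (Utr s) (proj M (Utr s)) <= C * Vnrm L r.
  by apply: le_trans (hC M s); rewrite -normrN ler_norm.
have h3 := ler_wpM2l (ltW hnu) (Vnrm_proj_mono (w_V s) KM).
exact: rate_arith h1 h2 h3.
Qed.

Lemma half_arith (p q e : R) : p = - e - e -> - e < p - q -> q <= - e.
Proof. by move=> -> h; lra. Qed.

Lemma neg_arith (eta C x B p : R) : 0 < eta -> 0 <= C -> x <= B -> p <= - eta -> p + C * x <= C * B.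
Proof. by move=> h0 h1 h2 h3; have := ler_wpM2l h1 h2; lra. Qed.

Lemma small_arith (eta C x e p : R) : 0 <= C -> 0 <= e -> x <= e / (C + 1) -> p <= - eta ->
  p + C * x <= - eta + e.
Proof.
move=> C0; have C1 : 0 < C + 1 by lra.
rewrite ler_pdivlMr // => h1 h2.
by have : C * x <= e; [have [x0|/ltW x0] := leP 0 x; nra|lra].
Qed.

Lemma final_arith (a b eta x y : R) : b < a -> 0 < eta * (a - b) / 2 -> 0 <= y -> y <= x ->
  2^-1 * x ^+ 2 - 2^-1 * y ^+ 2 <= - eta * (a - b) + eta * (a - b) / 2 -> False.
Proof.
move=> _; rewrite mulNr; move: (eta * (a - b)) => z z0 y0 yx h.
have : y ^+ 2 <= x ^+ 2 by rewrite ler_pXn2r // nnegrE ?(le_trans y0).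
by lra.
Qed.

Lemma half_sum_cvg s :
  \sum_(k <- modes M) 2^-1 * cb k s ^+ 2 @[M --> \oo] --> 2^-1 * nrm L (w0 s) ^+ 2.
Proof.
have h := ip_proj_cvg_sum hL (w_H s) (w_L2 s); rewrite nrm_sqr.
have -> : (fun M => \sum_(k <- modes M) 2^-1 * cb k s ^+ 2) =
    (fun M => 2^-1 * \sum_(k <- modes M) ip L (w0 s) (eb k) * ip L (w0 s) (eb k)).
  by apply/funext => M; rewrite mulr_sumr.
by apply: cvgM; [exact: cvg_cst|exact: h].
Qed.

(** If [psi K a < 0], the rate stays below a negative constant on an interval to the left of a, and
    integration makes [|w0|] decrease there, against [hmono]. The full dissipation is recovered by
    letting K tend to infinity. *)
Lemma energy_ineq a : sigma0 < a < sigma1 ->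
  nu * (phi a * Vnrm L (v0 a) ^+ 2) + nu * Vnrm L (w0 a) ^+ 2 <= ip L f (Utr a).
Proof.
move=> /andP[sa as1].
suff H K : (N <= K)%N -> 0 <= psi K a.
  have c : psi K a @[K --> \oo] --> ip L f (Utr a)
     - nu * (phi a * Vnrm L (v0 a) ^+ 2) - nu * Vnrm L (w0 a) ^+ 2.
    apply: cvgB; first exact: cvg_cst.
    by apply: cvgM; [exact: cvg_cst|exact: Vnrm_proj_cvg (w_V a)].
  have : 0 <= ip L f (Utr a) - nu * (phi a * Vnrm L (v0 a) ^+ 2) - nu * Vnrm L (w0 a) ^+ 2.
    apply: (ler_cvg_to (@cvg_cst _ _ _ _ _) c).
    by exists N => // K; exact: H.
  by move: (nu * (phi a * _)) (nu * Vnrm L (w0 a) ^+ 2) => a1 a2 h; rewrite -subr_ge0 opprD addrA.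
move=> NK; rewrite leNgt; apply/negP => neg.
(* Half of the deficit, so that continuity keeps [psi K] below [- eta] near a. *)
pose eta := - psi K a / 2; have eta0 : 0 < eta by rewrite divr_gt0 // oppr_gt0.
have [e1 /= e10 he1] : exists2 e1 : R, 0 < e1 & forall s, `|a - s| < e1 -> psi K s <= - eta.
  have /cvgrPdist_lt/(_ eta eta0)[e1 e10 he1] := @psi_continuous K a.
  exists e1 => // s /he1 /=; rewrite ltr_norml => /andP[h _].
  have E : psi K a = - eta - eta by rewrite /eta; field.
  exact: half_arith E h.
(* To the left of a, inside the interval of continuity, and still to the right of [sigma0]. *)
pose b := Num.max (a - e1 / 2) ((a + sigma0) / 2).
have ba : b < a by rewrite /b gt_max; apply/andP; split; lra.
have sb : sigma0 < b by rewrite /b lt_max; apply/orP; right; lra.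
have be1 : a - e1 < b by rewrite /b lt_max; apply/orP; left; lra.
have hpsi s : b <= s <= a -> psi K s <= - eta.
  by move=> /andP[bs sa']; apply: he1; rewrite ger0_norm; lra.
have [C C0 hC] := energy_rate_le; have [B B0 hB] := Utr_bound.
have hd M s : \sum_(k <- modes (K + M)) cb k s * gk k s <=
    psi K s + C * Vnrm L (Utr s - proj (K + M) (Utr s)).
  by apply: hC => //; exact: leq_addr.
have ab0 : 0 < a - b by rewrite subr_gt0.
have e0 : 0 < eta * (a - b) / 2 by rewrite divr_gt0 // mulr_gt0.
(* Half of the drop [eta (a - b)] is given up as the error of the limit in M. The index [K + M]
   guarantees at least the K modes kept in [psi K]. *)
have [M0 hM0] : exists M0 : nat, forall M, (M0 <= M)%N ->
    \sum_(k <- modes (K + M)) 2^-1 * cb k a ^+ 2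
    - \sum_(k <- modes (K + M)) 2^-1 * cb k b ^+ 2 <= - eta * (a - b) + eta * (a - b) / 2.
  apply: (@increment_limsup R
    (fun M s => \sum_(k <- modes (K + M)) 2^-1 * cb k s ^+ 2)
    (fun M s => \sum_(k <- modes (K + M)) cb k s * gk k s) b a eta (C * B) ba) => //.
  - move=> M s; exact: (@is_derive_seq_sum R _ (modes (K + M))
      (fun k t => 2^-1 * cb k t ^+ 2) (fun k t => cb k t * gk k t) s
      (fun k kM => energy_derive s (modes_neq0 kM))).
  - move=> M; apply: continuous_seq_sum => k s.
    by apply: cvgM; [exact: cb_continuous|exact: gk_continuous].
  - move=> M s bsa; apply: (le_trans (hd M s)).
    have h1 : Vnrm L (Utr s - proj (K + M) (Utr s)) <= B.
      exact: (le_trans (Vnrm_coproj_le hL (K + M) (Utr_V s)) (hB s)).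
    have h2 := hpsi s bsa.
    exact: neg_arith eta0 C0 h1 h2.
  - move=> s e bsa e_gt0.
    have C1 : 0 < C + 1 by rewrite ltr_pwDr.
    have /cvgrPdist_le/(_ (e / (C + 1)) (divr_gt0 e_gt0 C1))[M0 _ hM0] :=
      Vnrm_coproj_cvg hL (Utr_V s).
    exists M0 => M MM; apply: (le_trans (hd M s)).
    have := hM0 (K + M)%N (leq_trans MM (leq_addl _ _)); rewrite /= sub0r normrN.
    move=> /(le_trans (ler_norm _)) h1; have h2 := hpsi s bsa.
    exact: small_arith C0 (ltW e_gt0) h1 h2.
pose D := fun M => \sum_(k <- modes M) 2^-1 * cb k a ^+ 2 - \sum_(k <- modes M) 2^-1 * cb k b ^+ 2.
have cD : D M @[M --> \oo] --> 2^-1 * nrm L (w0 a) ^+ 2 - 2^-1 * nrm L (w0 b) ^+ 2.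
  by apply: cvgB; exact: half_sum_cvg.
have : 2^-1 * nrm L (w0 a) ^+ 2 - 2^-1 * nrm L (w0 b) ^+ 2 <= - eta * (a - b) + eta * (a - b) / 2.
  apply: (ler_cvg_to cD (@cvg_cst _ _ _ _ _)).
  exists (K + M0)%N => // M /= KM.
  have KM' : (K <= M)%N by exact: leq_trans (leq_addr _ _) KM.
  have hM : (M0 <= M - K)%N by rewrite leq_subRL.
  by have := hM0 _ hM; rewrite (subnKC KM').
have := hmono sb (ltW ba) as1; have := nrm_ge0 L (w0 b); move: ba e0.
exact: final_arith.
Qed.

(** * Removing the cutoff *)

Lemma low_energy s : nu * Vnrm L (v0 s) ^+ 2 =
  ip L f (proj N (v0 s)) - Bform L (Utr s) (Utr s) (proj N (v0 s)).
Proof.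
have tp : trig_field L (proj N (v0 s)) by exact: trig_field_comb.
have -> : Bform L (Utr s) (Utr s) (proj N (v0 s)) = tri L (Utr s) (Utr s) (proj N (v0 s)).
  by apply: (Bform_tri hL (Utr_H s) (Utr_V s)).
rewrite projEcomb tri_comb //; try exact: Utr_L2.
rewrite ip_combr //; last exact: f_L2.
transitivity (nu * \sum_(k <- modes N) lam k * ca k s ^+ 2).
  congr (_ * _); exact: v_Vnrm_sqr (leqnn N).
rewrite mulr_sumr -sumrB big_seq [RHS]big_seq; apply: eq_bigr => k kN.
have := low_eq s kN; rewrite -/(ca k s) -/(fk k) -/(cT_ k s).
move: (lam k) (ca k s) (fk k) (cT_ k s) => l a ff t E.
have -> : ff = nu * (l * a) + t by rewrite E subrK.
by ring.
Qed.

(** By the Poincare inequality each product [|.|^(1/2) ||.||^(1/2)] is at most [kappa0^(-1/2)] times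
    the V norm. The maximum with 0 appears because the constant c comes without a sign. *)
Lemma ladyzhenskaya_arith (k c a b d e g U : R) : 0 < k -> 0 <= U ->
  a <= k^-1 * U -> b <= k^-1 * d -> 0 <= a -> 0 <= b -> d <= e ->
  g <= c * Num.sqrt a * Num.sqrt U * U * Num.sqrt b * Num.sqrt d -> 0 <= d ->
  g <= Num.max c 0 * U ^+ 2 * (k^-1 * e).
Proof.
move=> k0 U0 aU bd a0 b0 de h d0; apply: (le_trans h).
have ki : 0 <= k^-1 by rewrite invr_ge0 ltW.
apply: (@le_trans _ _ (Num.max c 0 * ((Num.sqrt a * Num.sqrt U) * U * (Num.sqrt b * Num.sqrt d)))).
  rewrite (_ : c * _ * _ * _ * _ * _ = c * ((Num.sqrt a * Num.sqrt U) * U * (Num.sqrt b * Num.sqrt d))); last by ring.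
  by apply: ler_wpM2r; rewrite ?mulr_ge0 ?sqrtr_ge0 // le_max lexx.
have m0 : 0 <= Num.max c 0 by rewrite le_max lexx orbT.
rewrite -[leRHS]mulrA; apply: ler_wpM2l => //.
have X (x y : R) : 0 <= x -> 0 <= y -> x <= k^-1 * y ->
    Num.sqrt x * Num.sqrt y <= Num.sqrt k^-1 * y.
  move=> x0 y0 xy; rewrite -sqrtrM //.
  apply: (@le_trans _ _ (Num.sqrt (k^-1 * y ^+ 2))).
    by apply: ler_wsqrtr; rewrite expr2 mulrA ler_wpM2r.
  by rewrite sqrtrM // sqrtr_sqr ger0_norm.
have h1 := X a U a0 U0 aU; have h2 := X b d b0 d0 bd.
have sk : Num.sqrt k^-1 * Num.sqrt k^-1 = k^-1 by rewrite -expr2 sqr_sqrtr.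
have -> : U ^+ 2 * (k^-1 * e) = (Num.sqrt k^-1 * U) * U * (Num.sqrt k^-1 * e).
  by move: (Num.sqrt k^-1) sk => q <-; ring.
apply: ler_pM; rewrite ?mulr_ge0 ?sqrtr_ge0 //.
  by apply: ler_wpM2r.
by apply: (le_trans h2); apply: ler_wpM2l; rewrite ?sqrtr_ge0.
Qed.

Lemma low_bound_arith (A1 B1 F c U S V i : R) : A1 <= F * (i * V) -> `|B1| <= c * U ^+ 2 * (i * V) ->
  U <= S -> 0 <= c -> 0 <= U -> 0 <= V -> 0 <= i ->
  A1 - B1 <= F * (i * V) + c * S ^+ 2 * (i * V).
Proof.
move=> h1 h2 h3 c0 U0 V0 i0; apply: lerD => //.
apply: (le_trans (ler_norm _)); rewrite normrN (le_trans h2) //.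
apply: ler_wpM2r; first by rewrite mulr_ge0.
by apply: ler_wpM2l => //; rewrite ler_pXn2r // nnegrE // (le_trans U0).
Qed.

(** Two inequalities enter [cutoff_arith]: the energy inequality, where [w0] gains a factor [1 / N]
    from the Poincare inequality on high modes, and the equation for [v0] tested with [v0]. *)
Lemma cutoff_eq1 a : 3 * cL * G < N%:R -> sigma0 < a < sigma1 -> phi a = 1.
Proof.
move=> hN1 ha; apply: cutoff1.
have p0 := kappa0_gt0 hL.
have V0 := Vnrm_ge0 L (v0 a); have W0 := Vnrm_ge0 L (w0 a).
have q0 := divr_ge0 V0 (ltW (mulr_gt0 hnu p0)).
apply: (le_trans (eq_ler (ger0_norm q0))).
have n1 : 1 <= N%:R :> R by rewrite ler1n.
have hw : nrm L (w0 a) <= k0^-1 * N%:R^-1 * Vnrm L (w0 a).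
  have n0 : 0 < N%:R :> R by rewrite ltr0n.
  have h : k0 * N%:R * nrm L (w0 a) <= Vnrm L (w0 a).
    by apply: (poincare_high hL (w_V a)) => k; exact: cb_low.
  have := le_pdivl (mulr_gt0 p0 n0) h; rewrite invfM; exact.
have hv : nrm L (v0 a) <= k0^-1 * Vnrm L (v0 a).
  exact: (le_pdivl p0 (poincare_V hL (v_V a))).
apply: (@cutoff_arith R nu k0 (nrm L f) (Num.max cL 0) N%:R (phi a) _ (Vnrm L (w0 a))) => //.
- by rewrite le_max lexx orbT.
- exact: phi_ge0.
- case: (leP 0 cL) => c0; first exact: hN1.
  by rewrite mulr0 mul0r ltr0n.
- apply: (le_trans (energy_ineq ha)).
  have LU := Utr_L2 a.
  apply: (le_trans (cauchy_schwarz_le f_L2 LU)); apply: ler_wpM2l; first exact: nrm_ge0.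
  apply: (le_trans (nrmD_le (L2Z (phi a) (v_L2 a)) (w_L2 a))); apply: lerD hw.
  rewrite nrmZ; last exact: v_L2.
  rewrite (ger0_norm (phi_ge0 a)); exact: (ler_wpM2l (phi_ge0 a) hv).
(* The test field is [v0] and not [phi v0], so that the estimate keeps its force where phi is small
   or 0. *)
rewrite low_energy; set z := proj N (v0 a).
have Vz : V L z by exact: V_proj.
have zv : Vnrm L z <= Vnrm L (v0 a) by exact: Vnrm_proj_le (v_V a).
have hz : nrm L z <= k0^-1 * Vnrm L z by exact: (le_pdivl p0 (poincare_V hL Vz)).
have hU : nrm L (Utr a) <= k0^-1 * Vnrm L (Utr a).
  exact: (le_pdivl p0 (poincare_V hL (Utr_V a))).
have h1 : ip L f z <= nrm L f * (k0^-1 * Vnrm L (v0 a)).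
  apply: (le_trans (cauchy_schwarz_le f_L2 (V_L2 Vz))); apply: ler_wpM2l; first exact: nrm_ge0.
  by apply: le_trans hv; exact: nrm_proj_le (v_L2 a).
have h2 := ladyzhenskaya_arith p0 (Vnrm_ge0 L (Utr a)) hU hz (nrm_ge0 L _) (nrm_ge0 L _) zv
  (Bform_cL (Utr_V a) (Utr_V a) Vz) (Vnrm_ge0 L z).
have hU2 : Vnrm L (Utr a) <= phi a * Vnrm L (v0 a) + Vnrm L (w0 a).
  apply: (le_trans (VnrmD_le hL (VZ hL (phi a) (v_V a)) (w_V a))).
  have E := VnrmZ hL (phi a) (v_V a); rewrite (ger0_norm (phi_ge0 a)) in E.
  exact: (lerD (eq_ler E) (lexx _)).
have c0 : 0 <= Num.max cL 0 by rewrite le_max lexx orbT.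
have U0 := Vnrm_ge0 L (Utr a).
have ki : 0 <= k0^-1 by rewrite invr_ge0 ltW.
exact: low_bound_arith h1 h2 hU2 c0 U0 V0 ki.
Qed.

(** * Enstrophy balance of the projected solution *)

Definition Aproj (M : nat) (u : vfield R) : vfield R :=
  comb M (fun k => lam k * ip L u (eb k)).

(* B(p, p, A p) = 0 for p = u_M, so one argument of each remaining term is the
   tail U - u_M; the factor M lost by the inverse Poincare inequality for A p is
   gained by the Poincare inequality for the tail. *)
Lemma enstrophy_tail U M : V L U -> (0 < M)%N ->
  `|tri L U U (Aproj M U)| <=
    `|cL| * Vnrm L U * nrm L (Aproj M U) * Vnrm L (U - proj M U) +
    `|cA| * Num.sqrt (nrm L U) * (Num.sqrt (nrm L (Aproj M U)) * nrm L (Aproj M U)) *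
      Vnrm L (U - proj M U).
Proof.
move=> VU M0; set Z := Aproj M U; set r := U - proj M U; have p0 := kappa0_gt0 hL.
pose p := comb M (fun k => ip L U (eb k)).
have rE : r = U - p by rewrite /r projEcomb.
have Vp : V L p by exact: V_comb.
have Vr : V L r by apply: VB => //; exact: V_proj.
have VZ_ : V L Z by exact: V_comb.
have LU := V_L2 VU; have Lp := V_L2 Vp; have Lr := V_L2 Vr.
have tZ : trig_field L Z by exact: trig_field_comb.
have E : tri L U U Z = Bform L r U Z + Bform L p r Z.
  rewrite (Bform_tri hL (V_H Vr) VU tZ) (Bform_tri hL (V_H Vp) Vr tZ) rE.
  rewrite (triBl LU Lp LU tZ) (triBm Lp LU Lp tZ).
  by rewrite /p (tri_enstrophy hL M _) subr0 subrK.
rewrite E; apply: (le_trans (ler_normD _ _)); apply: lerD.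
  have hr : k0 * M%:R * nrm L r <= Vnrm L r.
    apply: (poincare_high hL Vr) => k kM; have kn0 := modes_neq0 kM.
    by rewrite rE ipBl ?ip_comb_eb // ?kM ?subrr //; exact: L2_eb.
  exact: enstrophy_arith1 (nrm_ge0 L _) (Vnrm_ge0 L _) (Vnrm_ge0 L _) (nrm_ge0 L _) (Vnrm_ge0 L _)
    hr (inverse_poincare hL M _) (Bform_cL Vr VU VZ_).
(* In the second term the tail is the middle argument, so its V norm appears directly; the [cA]
   estimate spends [|A p|] on the first argument, and [|A p| = |Z|]. *)
have [_ _ [h _ _ _]] := hc hL.
have := h p r Z (domA_comb hL M _) Vr (V_H VZ_).
rewrite nrm_A_comb // -/Z => h1.
have pU : nrm L p <= nrm L U by rewrite /p -projEcomb; exact: nrm_proj_le.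
exact: enstrophy_arith2 (nrm_ge0 L _) pU (nrm_ge0 L _) (Vnrm_ge0 L _) h1.
Qed.

Lemma ca_cb k s : k != 0 -> ca k s * cb k s = 0.
Proof.
move=> kn0; have [kN|kN] := boolP (k \in modes N); first by rewrite cb_low // mulr0.
by rewrite ca_high // mul0r.
Qed.

(** The cross terms vanish since [v0] and [w0] have no common frequency. *)
Lemma Vnrm_proj_Utr M s : (N <= M)%N ->
  Vnrm L (proj M (Utr s)) ^+ 2 = phi s ^+ 2 * Vnrm L (v0 s) ^+ 2 + Vnrm L (proj M (w0 s)) ^+ 2.
Proof.
move=> NM; apply: (etrans (VD_proj_sqr M (Utr_V s))).
transitivity (phi s ^+ 2 * (\sum_(k <- modes M) lam k * ca k s ^+ 2) +
  \sum_(k <- modes M) lam k * cb k s ^+ 2); last first.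
  congr (_ * _ + _); apply: esym; [exact: v_Vnrm_sqr|exact: w_Vnrm_proj_sqr].
rewrite mulr_sumr -big_split /= big_seq [RHS]big_seq; apply: eq_bigr => k kM.
rewrite Utr_coef; have := ca_cb s (modes_neq0 kM).
move: (phi s) (lam k) (ca k s) (cb k s) => p l a b E.
rewrite (_ : l * _ ^+ 2 = p ^+ 2 * (l * a ^+ 2) + l * b ^+ 2 + 2 * l * p * (a * b)); last by ring.
by rewrite E mulr0 addr0.
Qed.

Lemma Vnrm_Utr_sqr s :
  Vnrm L (Utr s) ^+ 2 = phi s ^+ 2 * Vnrm L (v0 s) ^+ 2 + Vnrm L (w0 s) ^+ 2.
Proof.
have h1 := Vnrm_proj_cvg (Utr_V s).
have h2 : phi s ^+ 2 * Vnrm L (v0 s) ^+ 2 + Vnrm L (proj M (w0 s)) ^+ 2 @[M --> \oo] -->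
    phi s ^+ 2 * Vnrm L (v0 s) ^+ 2 + Vnrm L (w0 s) ^+ 2.
  by apply: cvgD; [exact: cvg_cst|exact: Vnrm_proj_cvg (w_V s)].
have h3 : Vnrm L (proj M (Utr s)) ^+ 2 @[M --> \oo] -->
    phi s ^+ 2 * Vnrm L (v0 s) ^+ 2 + Vnrm L (w0 s) ^+ 2.
  apply: cvg_trans h2; apply: near_eq_cvg.
  by exists N => // M /= NM; apply: esym; exact: Vnrm_proj_Utr.
exact: (cvg_unique (@Rhausdorff R) h1 h3).
Qed.

Lemma sub_arith (R' : zmodType) (x y p a b r : R') : x = p + y -> x = a + r -> a = p + b -> r = y - b.
Proof. by move=> -> /esym E Ea; rewrite -[r](addKr a) E Ea opprD addrACA addNr add0r addrC. Qed.

Lemma Vnrm_coproj_Utr M s : (N <= M)%N ->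
  Vnrm L (Utr s - proj M (Utr s)) ^+ 2 = Vnrm L (w0 s) ^+ 2 - Vnrm L (proj M (w0 s)) ^+ 2.
Proof.
move=> NM.
exact: sub_arith (Vnrm_Utr_sqr s) (Vnrm_proj_split hL M (Utr_V s)) (Vnrm_proj_Utr s NM).
Qed.

Lemma Utr_eq s : phi s = 1 -> Utr s = v0 s + w0 s.
Proof. by move=> p1; rewrite /Utr /trunc -/(phi s) p1 scale1r. Qed.

Lemma energy_bound a : 3 * cL * G < N%:R -> sigma0 < a < sigma1 ->
  nu * Vnrm L (v0 a + w0 a) ^+ 2 <= nrm L f * nrm L (v0 a + w0 a).
Proof.
move=> hN1 ha; have p1 := cutoff_eq1 hN1 ha; rewrite -(Utr_eq p1).
apply: le_trans (cauchy_schwarz_le f_L2 (Utr_L2 a)).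
apply: le_trans (energy_ineq ha); apply: eq_ler.
rewrite [phi a]p1 mul1r -mulrDr; congr (_ * _).
by apply: (etrans (Vnrm_Utr_sqr a)); rewrite [phi a]p1 expr1n mul1r.
Qed.

(** * Left continuity in V at [s0] and the variational inequality *)

Lemma tail_arith (x y z t e : R) : 0 < e -> 0 <= x -> x ^+ 2 = y - z -> t <= z -> y - e ^+ 2 <= t -> x <= e.
Proof.
move=> e0 x0 h1 h2 h3; have : x ^+ 2 <= e ^+ 2 by lra.
by rewrite ler_pXn2r // nnegrE ltW.
Qed.

Lemma tail_arith2 (ys0 ys w2 ws e2 : R) : `|ys0 - ys| < e2 / 2 -> `|w2 - ys0| < e2 / 2 ->
  ws <= w2 -> ws - e2 <= ys.
Proof. by rewrite !ltr_norml => /andP[_ h1] /andP[_ h2] h3; lra. Qed.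

(* Strong continuity of w0 in V at s0 from the left: the norm cannot exceed its
   value at s0, and finitely many modes carry almost all of that value. *)
Lemma Vnrm_tail_small a0 s0 : a0 < s0 ->
  (forall s, a0 < s -> s <= s0 -> Vnrm L (w0 s) ^+ 2 <= Vnrm L (w0 s0) ^+ 2) ->
  forall e, 0 < e -> exists2 d : R, 0 < d & exists M1 : nat, forall s M, a0 < s -> s0 - d < s -> s <= s0 ->
    (M1 <= M)%N -> Vnrm L (Utr s - proj M (Utr s)) <= e.
Proof.
move=> as0 hV e e0.
have e20 : 0 < e ^+ 2 / 2 by rewrite divr_gt0 // exprn_gt0.
have /cvgrPdist_lt/(_ _ e20)[M0 _ hM0] := Vnrm_proj_cvg (w_V s0).
pose M1 := maxn M0 N; have h0 := hM0 M1 (leq_maxl _ _).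
pose y s := \sum_(k <- modes M1) lam k * cb k s ^+ 2.
have cy : continuous y.
  apply: continuous_seq_sum => k s; apply: cvgM; first exact: cvg_cst.
  by apply: cvgM; exact: cb_continuous.
have /cvgrPdist_lt/(_ _ e20)[d d0 hd] := cy s0.
exists d => //; exists M1 => s M a_s ds ss MM.
have h1 : `|y s0 - y s| < e ^+ 2 / 2 by apply: hd; rewrite /= ger0_norm; lra.
have NM : (N <= M)%N by rewrite (leq_trans (leq_maxr _ _) MM).
have E0 : Vnrm L (proj M1 (w0 s0)) ^+ 2 = y s0 by exact: w_Vnrm_proj_sqr.
have E1 : Vnrm L (proj M1 (w0 s)) ^+ 2 = y s by exact: w_Vnrm_proj_sqr.
have h2 := hV s a_s ss; have h3 := Vnrm_proj_mono (w_V s) MM.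
apply: (tail_arith e0 (Vnrm_ge0 L _) (Vnrm_coproj_Utr s NM) h3).
have h4 : `|Vnrm L (w0 s0) ^+ 2 - y s0| < e ^+ 2 / 2.
  by apply: le_lt_trans h0; apply: eq_ler; congr (`| _ - _ |); exact: esym E0.
apply: le_trans (eq_ler (esym E1)).
exact: tail_arith2 h1 h4 h2.
Qed.

(** The equation for [v0], multiplied by [lam k] and the coefficient of [v0], adds 0; with [phi = 1]
    it completes the dissipation of [w0] to [nu |A u_M|^2]. *)
Lemma enstrophy_identity M s : (N <= M)%N -> phi s = 1 ->
  \sum_(k <- modes M) lam k * (cb k s * gk k s) =
  ip L f (Aproj M (Utr s)) - nu * nrm L (Aproj M (Utr s)) ^+ 2
  - tri L (Utr s) (Utr s) (Aproj M (Utr s)).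
Proof.
move=> NM p1.
have -> : nrm L (Aproj M (Utr s)) ^+ 2 = \sum_(k <- modes M) (lam k * (ca k s + cb k s)) ^+ 2.
  rewrite nrm_sqr ip_comb_comb //; apply: eq_bigr => k _.
  by rewrite Utr_coef p1 mul1r.
have -> : ip L f (Aproj M (Utr s)) = \sum_(k <- modes M) lam k * (ca k s + cb k s) * fk k.
  rewrite ip_combr //; last exact: f_L2.
  by apply: eq_bigr => k _; rewrite Utr_coef p1 mul1r.
have -> : tri L (Utr s) (Utr s) (Aproj M (Utr s)) =
    \sum_(k <- modes M) lam k * (ca k s + cb k s) * cT_ k s.
  rewrite tri_comb //; try exact: Utr_L2.
  by apply: eq_bigr => k _; rewrite Utr_coef p1 mul1r.
rewrite mulr_sumr -!sumrB big_seq [RHS]big_seq; apply: eq_bigr => k kM.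
rewrite /gk; have kn0 := modes_neq0 kM.
have [kN|kN] := boolP (k \in modes N).
  have := low_eq s kN; rewrite cb_low //.
  move: (lam k) (ca k s) (fk k) (cT_ k s) => l a ff t E.
  have -> : ff = nu * (l * a) + t by rewrite E subrK.
  by ring.
rewrite ca_high //.
by move: (lam k) (cb k s) (fk k) (cT_ k s) => *; ring.
Qed.

(** Expansion of [|2 nu Z - (p + f)|^2 >= 0]. For [Z = A u_M] the last bracket is what the enstrophy
    balance makes almost nonpositive. *)
Lemma young Z p : L2 L Z -> L2 L p ->
  4 * nu * ip L Z p <= nrm L (p + f) ^+ 2 + 4 * nu * (nu * nrm L Z ^+ 2 - ip L f Z).
Proof.
move=> LZ Lp; have L2Z := L2Z (2 * nu) LZ; have Lpf := L2D Lp f_L2.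
have := sqr_ge0 (nrm L (2 * nu *: Z - (p + f))).
rewrite (nrmB_sqr L2Z Lpf) (ipZl _ LZ Lpf) (ipDr Lp f_L2 LZ) (ipC L f Z) nrmZ // exprMn.
rewrite ger0_norm; last by rewrite mulr_ge0 // ltW.
move: (nrm L Z ^+ 2) (ip L Z p) (ip L Z f) (nrm L (p + f) ^+ 2) => *; lra.
Qed.

Lemma ip_Aproj M0 M q u : L2 L u -> (M0 <= M)%N ->
  ip L u (comb M0 (fun k => lam k * q k)) = ip L (Aproj M u) (comb M0 q).
Proof.
move=> Lu M0M; rewrite !ip_combr //; last exact: L2_comb.
rewrite big_seq [RHS]big_seq; apply: eq_bigr => k kM.
rewrite ip_comb_eb ?(modes_neq0 kM) // (modesS M0M kM).
by rewrite mulrCA mulrA.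
Qed.

Lemma enstrophy_tail_bound : exists2 C, 0 <= C & forall M s, (0 < M)%N ->
  `|tri L (Utr s) (Utr s) (Aproj M (Utr s))| <=
  C * Vnrm L (Utr s - proj M (Utr s)) * (1 + nrm L (Aproj M (Utr s)) ^+ 2).
Proof.
have [B B0 hB] := Utr_bound; have p0 := kappa0_gt0 hL.
exists (`|cL| * B + `|cA| * Num.sqrt (k0^-1 * B)).
  by rewrite addr_ge0 // mulr_ge0 // sqrtr_ge0.
move=> M s M0; apply: (le_trans (enstrophy_tail (Utr_V s) M0)).
have h : nrm L (Utr s) <= k0^-1 * B.
  exact: (le_pdivl p0 (le_trans (poincare_V hL (Utr_V s)) (hB s))).
exact: enstrophy_arith3 (normr_ge0 cL) (normr_ge0 cA) (Vnrm_ge0 L _) (hB s) h (nrm_ge0 L _) (Vnrm_ge0 L _).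
Qed.

Lemma enstrophy_derive M (s : R) :
  is_derive s 1 (fun t => \sum_(k <- modes M) lam k * (2^-1 * cb k t ^+ 2))
    (\sum_(k <- modes M) lam k * (cb k s * gk k s)).
Proof.
apply: (@is_derive_seq_sum R _ (modes M) (fun k t => lam k * (2^-1 * cb k t ^+ 2))
   (fun k t => lam k * (cb k t * gk k t)) s) => k kM.
have d := energy_derive s (modes_neq0 kM).
have -> : (fun t => lam k * (2^-1 * cb k t ^+ 2)) = lam k *: (fun t => 2^-1 * cb k t ^+ 2).
  by apply/funext.
exact: is_deriveZ.
Qed.

Lemma mvt_arith (b s e w2 wb y0 yb d : R) : b < s -> 0 < e -> `|w2 - 2 * y0| < e * (s - b) ->
  wb <= w2 -> 2 * yb <= wb -> y0 - yb = d * (s - b) -> - e <= d.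
Proof.
move=> bs e0; have sb : 0 < s - b by rewrite subr_gt0.
rewrite ltr_norml => /andP[_ h1] h2 h3 E.
rewrite -(ler_pM2r sb) -E mulNr; nra.
Qed.

Lemma enstrophy_rate_small a0 s0 : a0 < s0 ->
  (forall s, a0 < s -> s <= s0 -> Vnrm L (w0 s) ^+ 2 <= Vnrm L (w0 s0) ^+ 2) ->
  forall b e, a0 < b -> b < s0 -> 0 < e -> exists M1 : nat, forall M, (M1 <= M)%N ->
    exists2 t, b < t < s0 & - e <= \sum_(k <- modes M) lam k * (cb k t * gk k t).
Proof.
move=> as0 hV b e ab bs0 e0.
have ed : 0 < e * (s0 - b) by rewrite mulr_gt0 // subr_gt0.
have /cvgrPdist_lt/(_ _ ed)[M1 _ hM1] := Vnrm_proj_cvg (w_V s0).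
exists M1 => M MM; pose y t := \sum_(k <- modes M) lam k * (2^-1 * cb k t ^+ 2).
have dy (t : R) := enstrophy_derive M t.
have yE t : Vnrm L (proj M (w0 t)) ^+ 2 = 2 * y t.
  apply: (etrans (w_Vnrm_proj_sqr M t)); rewrite /y mulr_sumr; apply: eq_bigr => k _.
  by field.
have [t tb E] := @MVT R y (fun t => \sum_(k <- modes M) lam k * (cb k t * gk k t)) b s0 bs0
  (fun t _ => dy t) (derivable_within_continuous (fun t _ => @ex_derive _ _ _ _ _ _ _ (dy t))).
exists t; first by move: tb; rewrite in_itv.
have h1 := hM1 M MM.
have h2 := hV b ab (ltW bs0).
have h3 : Vnrm L (proj M (w0 b)) ^+ 2 <= Vnrm L (w0 b) ^+ 2.
  exact: (ler_sqr_mono (Vnrm_ge0 L _) (Vnrm_proj_le hL M (w_V b))).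
have h3' := le_trans (eq_ler (esym (yE b))) h3.
have h1' : `|Vnrm L (w0 s0) ^+ 2 - 2 * y s0| < e * (s0 - b).
  by apply: le_lt_trans h1; apply: eq_ler; congr (`| _ - _ |); exact: esym (yE s0).
exact: mvt_arith bs0 e0 h1' h2 h3' E.
Qed.

Lemma key_arith (n4 I S e I0 c : R) : 0 < n4 -> n4 * I <= S + n4 * e * c ->
  `|I0 - I| < e -> n4 * I0 <= S + n4 * e * c + n4 * e.
Proof.
move=> n0 h; rewrite ltr_norml => /andP[_ h2].
have : n4 * (I0 - I) <= n4 * e by rewrite ler_pM2l // ltW.
by rewrite mulrBr; lra.
Qed.

Lemma small_exists (n C K x S : R) : 0 < n -> 0 <= C -> 0 <= K -> S < x ->
  exists e, [/\ 0 < e, e <= 1, C * e <= n / 2 & S + 4 * n * e * K + 4 * n * e < x].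
Proof.
move=> n0 C0 K0 Sx.
have d1 : 0 < n / 2 / (C + 1) by rewrite divr_gt0 ?divr_gt0 // ltr_pwDr.
have d2 : 0 < (x - S) / 2 / (4 * n * (K + 1)).
  by rewrite !divr_gt0 ?subr_gt0 // !mulr_gt0 // ltr_pwDr.
pose e := Num.min 1 (Num.min (n / 2 / (C + 1)) ((x - S) / 2 / (4 * n * (K + 1)))).
exists e; split.
- by rewrite /e !lt_min ltr01 d1 d2.
- by rewrite /e ge_min lexx.
- have : e <= n / 2 / (C + 1) by rewrite /e !ge_min lexx orbT.
  rewrite ler_pdivlMr ?ltr_pwDr // => h; have : 0 < e by rewrite /e !lt_min ltr01 d1 d2.
  by move=> e0; lra.
- have : e <= (x - S) / 2 / (4 * n * (K + 1)) by rewrite /e !ge_min lexx !orbT.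
  rewrite ler_pdivlMr; last by rewrite !mulr_gt0 // ltr_pwDr.
  by lra.
Qed.

(** The enstrophy balance is used at a time t that depends on e and M, and no bound on [|A u_M|] at
    [s0] is available. After Young's inequality only the pairing of U with a fixed polynomial is
    left; it is continuous in time, so it can be carried from t to [s0]. *)
Lemma variational_ineq a0 s0 : a0 < s0 ->
  (forall s, a0 < s -> s <= s0 -> phi s = 1) ->
  (forall s, a0 < s -> s <= s0 -> Vnrm L (w0 s) ^+ 2 <= Vnrm L (w0 s0) ^+ 2) ->
  forall M0 q, 4 * nu * ip L (Utr s0) (comb M0 (fun k => lam k * q k)) <=
    nrm L (comb M0 q + f) ^+ 2.
Proof.
move=> as0 hphi hV M0 q; have [C C0 hC] := enstrophy_tail_bound.
set Q := comb M0 (fun k => lam k * q k); set S := nrm L (comb M0 q + f) ^+ 2.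
pose K := 1 + C * (1 + 4 / nu * (nrm L f ^+ 2 / nu + 1 + nu / 2)).
have nu4 : 0 < 4 * nu by rewrite mulr_gt0.
have K0 : 0 <= K.
  rewrite addr_ge0 // mulr_ge0 // addr_ge0 // mulr_ge0 ?divr_ge0 ?(ltW hnu) //.
  by rewrite !addr_ge0 ?divr_ge0 ?sqr_ge0 ?(ltW hnu).
have step e : 0 < e -> e <= 1 -> C * e <= nu / 2 ->
    4 * nu * ip L (Utr s0) Q <= S + 4 * nu * e * K + 4 * nu * e.
  move=> e0 e1 Ce; have [d d0 [M1 hM1]] := Vnrm_tail_small as0 hV e0.
  have cI := @nrm_continuous_ip R L Utr Q Utr_L2 Utr_continuous (L2_comb hL M0 _) s0.
  have /cvgrPdist_lt/(_ e e0)[d2 d20 hd2] := cI.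
  (* Close enough to [s0] for the tail bound ([d]) and for the continuity of the pairing ([d2]). *)
  pose b := Num.max ((a0 + s0) / 2) (Num.max (s0 - d) (s0 - d2)).
  have bs0 : b < s0.
    by rewrite /b !gt_max; apply/andP; split; [|apply/andP; split]; move: d0 d20 => /=; lra.
  have ab : a0 < b by rewrite /b lt_max; apply/orP; left; lra.
  have db : s0 - d <= b by rewrite /b !le_max lexx orbT.
  have db2 : s0 - d2 <= b by rewrite /b !le_max lexx !orbT.
  have [M2 hM2] := enstrophy_rate_small as0 hV ab bs0 e0.
  pose M := (maxn (maxn M1 M2) (maxn N M0)).
  have MM1 : (M1 <= M)%N by rewrite /M !leq_max leqnn ?orbT.
  have MM2 : (M2 <= M)%N by rewrite /M !leq_max leqnn ?orbT.
  have MN : (N <= M)%N by rewrite /M !leq_max leqnn ?orbT.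
  have MM0 : (M0 <= M)%N by rewrite /M !leq_max leqnn ?orbT.
  have [t /andP[bt ts] ht] := hM2 M MM2.
  have p1 : phi t = 1 by apply: hphi; lra.
  have r1 := hM1 t M (lt_trans ab bt) (le_lt_trans db bt) (ltW ts) MM1.
  rewrite (enstrophy_identity MN p1) in ht.
  have hT := hC M t (leq_trans hN MN).
  have LZ : L2 L (Aproj M (Utr t)) by exact: L2_comb.
  have Lq : L2 L (comb M0 q) by exact: L2_comb.
  have hY := young LZ Lq.
  have hX := cauchy_schwarz_le f_L2 LZ.
  have h := rate_bound_arith hnu C0 (nrm_ge0 L _) e0 e1 Ce (Vnrm_ge0 L _) r1 hT hX ht hY.
  have E := ip_Aproj q (Utr_L2 t) MM0.
  have hc2 : `|ip L (Utr s0) Q - ip L (Utr t) Q| < e.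
    by apply: hd2; rewrite /= ger0_norm; lra.
  rewrite -E in h; exact: key_arith nu4 h hc2.
rewrite leNgt; apply/negP => neg.
have [e [e0 e1 Ce he]] := small_exists hnu C0 K0 neg.
by have := le_lt_trans (step e e0 e1 Ce) he; rewrite ltxx.
Qed.

(** * The case of equality *)

Lemma Vnrm_coef_cvg u : V L u ->
  \sum_(k <- modes M) lam k * ip L u (eb k) ^+ 2 @[M --> \oo] --> Vnrm L u ^+ 2.
Proof.
move=> Vu; apply: cvg_trans (Vnrm_proj_cvg Vu); apply: near_eq_cvg.
by exists 0%N => // M _; exact: VD_proj_sqr.
Qed.

Lemma nrm_coef_cvg u : H L u ->
  \sum_(k <- modes M) ip L u (eb k) ^+ 2 @[M --> \oo] --> nrm L u ^+ 2.
Proof.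
by move=> Hu; have := ip_proj_cvg_sum hL Hu (H_L2 Hu); rewrite -nrm_sqr.
Qed.

Lemma test_arith (n c t S1 S2 l x g : R) :
  4 * n * (c * S1 + t * (l * x)) <=
    c ^+ 2 * S2 + 2 * c * t * x + t ^+ 2 + 2 * (c ^+ 2 * S2 + t * (c * x)) + g ->
  4 * (n * c * S1) + 4 * n * t * (l * x) <= 3 * c ^+ 2 * S2 + 4 * t * c * x + t ^+ 2 + g.
Proof. by lra. Qed.

Lemma euler_arith (n c l x S1 S2 g : R) : n * S1 = c * S2 -> g = c ^+ 2 * S2 ->
  4 * (n * c * S1) + 4 * n * (n * (l * x) - c * x) * (l * x) <=
    3 * c ^+ 2 * S2 + 4 * (n * (l * x) - c * x) * c * x + (n * (l * x) - c * x) ^+ 2 + g ->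
  n * l * x = c * x.
Proof.
move=> E1 ->; have -> : n * c * S1 = c ^+ 2 * S2 by rewrite mulrAC E1; ring.
move=> h; apply/eqP; rewrite -subr_eq0 -sqrf_eq0 eq_le sqr_ge0 andbT.
by lra.
Qed.

(* The test functions [c u_M + t e_k] turn the variational inequality into the
   Euler equation [nu A u = c u]. *)
Lemma coef_of_variational u c : V L u -> (forall k, ip L f (eb k) = c * ip L u (eb k)) ->
  nu * Vnrm L u ^+ 2 = c * nrm L u ^+ 2 -> nrm L f ^+ 2 = c ^+ 2 * nrm L u ^+ 2 ->
  (forall M q, 4 * nu * ip L u (comb M (fun k => lam k * q k)) <= nrm L (comb M q + f) ^+ 2) ->
  forall k, k != 0 -> nu * lam k * ip L u (eb k) = c * ip L u (eb k).
Proof.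
move=> Vu fu E1 E2 hvar k kn0; have Lu := V_L2 Vu; have Hu := V_H Vu.
have main t : 4 * (nu * c * Vnrm L u ^+ 2) + 4 * nu * t * (lam k * ip L u (eb k)) <=
    3 * c ^+ 2 * nrm L u ^+ 2 + 4 * t * c * ip L u (eb k) + t ^+ 2 + nrm L f ^+ 2.
  have [M0 kM0] := modes_exhaust kn0.
  have cl : 4 * (nu * c * \sum_(k <- modes M) lam k * ip L u (eb k) ^+ 2) +
      4 * nu * t * (lam k * ip L u (eb k)) @[M --> \oo] -->
      4 * (nu * c * Vnrm L u ^+ 2) + 4 * nu * t * (lam k * ip L u (eb k)).
    apply: cvgD; last exact: cvg_cst.
    apply: cvgM; first exact: cvg_cst.
    by apply: cvgM; [exact: cvg_cst|exact: Vnrm_coef_cvg].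
  have cr : 3 * c ^+ 2 * \sum_(k <- modes M) ip L u (eb k) ^+ 2 +
      4 * t * c * ip L u (eb k) + t ^+ 2 + nrm L f ^+ 2 @[M --> \oo] -->
      3 * c ^+ 2 * nrm L u ^+ 2 + 4 * t * c * ip L u (eb k) + t ^+ 2 + nrm L f ^+ 2.
    do 3 (apply: cvgD; last exact: cvg_cst).
    by apply: cvgM; [exact: cvg_cst|exact: nrm_coef_cvg].
  apply: (ler_cvg_to cl cr); exists M0 => // M /= M0M.
  have kM := modesS M0M kM0.
  pose q j := c * ip L u (eb j) + t * (j == k)%:R.
  have delta (F : int * int -> R) : \sum_(j <- modes M) (j == k)%:R * F j = F k.
    rewrite (bigD1_seq k) ?modes_uniq //= eqxx mul1r big1 ?addr0 // => j /negPf ->.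
    by rewrite mul0r.
  have := hvar M q.
  have -> : ip L u (comb M (fun k => lam k * q k)) =
      c * (\sum_(j <- modes M) lam j * ip L u (eb j) ^+ 2) + t * (lam k * ip L u (eb k)).
    rewrite ip_combr // -(delta (fun j => lam j * ip L u (eb j))) !mulr_sumr -big_split /=.
    apply: eq_bigr => j _; rewrite /q; move: (lam j) (ip L u (eb j)) (j == k)%:R => *; ring.
  have Lc : L2 L (comb M q) by exact: L2_comb.
  rewrite (nrmD_sqr Lc f_L2) nrm_sqr ip_comb_comb // (ip_combl hL M q f_L2).
  have -> : \sum_(j <- modes M) q j * q j = c ^+ 2 * (\sum_(j <- modes M) ip L u (eb j) ^+ 2) +
      2 * c * t * ip L u (eb k) + t ^+ 2.
    have t2 : t ^+ 2 = t ^+ 2 * \sum_(j <- modes M) (j == k)%:R * (j == k)%:R.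
      by rewrite delta eqxx mulr1n mulr1.
    rewrite t2 -(delta (fun j => ip L u (eb j))).
    rewrite !mulr_sumr -!big_split /=; apply: eq_bigr => j _; rewrite /q.
    by case: (j == k); rewrite ?mulr1n ?mulr0n; move: (ip L u (eb j)) => *; ring.
  have -> : \sum_(j <- modes M) q j * ip L f (eb j) =
      c ^+ 2 * (\sum_(j <- modes M) ip L u (eb j) ^+ 2) + t * (c * ip L u (eb k)).
    rewrite -(delta (fun j => c * ip L u (eb j))) !mulr_sumr -!big_split /=.
    apply: eq_bigr => j _; rewrite /q fu; move: (ip L u (eb j)) (j == k)%:R => *; ring.
  exact: test_arith.
(* The terms without t cancel, leaving [4 t d - t^2 <= 0] with [d = nu lam k x - c x], where x is
   the coefficient of u; the choice [t = d] forces [d = 0]. *)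
have := main (nu * (lam k * ip L u (eb k)) - c * ip L u (eb k)).
exact: euler_arith E1 E2.
Qed.

Lemma ratio_arith (x y X Y : R) : x != 0 -> y != 0 -> 0 <= x -> 0 <= y -> 0 <= X ->
  X / x <= Y / y -> x <= y -> X <= Y.
Proof.
move=> xn yn x0 y0 X0 h xy.
have x1 : 0 < x by rewrite lt_neqAle eq_sym xn.
have y1 : 0 < y by rewrite lt_neqAle eq_sym yn.
rewrite -[X](divfK xn) -[Y](divfK yn); apply: ler_pM => //.
by rewrite divr_ge0.
Qed.

Lemma equality_arith (n U u F I : R) : 0 < n -> 0 < F -> U / u = F / n -> n * U <= I -> I <= F * u ->
  [/\ u != 0, n * U = n * (U / u ^+ 2) * u ^+ 2, F ^+ 2 = (n * (U / u ^+ 2)) ^+ 2 * u ^+ 2 &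
    I = n * (U / u ^+ 2) * u ^+ 2].
Proof.
move=> n0 F0 E h1 h2.
(* A quotient by 0 is 0, whereas [F / n] is positive. *)
have un : u != 0.
  apply/eqP => u0; move: E; rewrite u0 invr0 mulr0 => /eqP.
  by rewrite eq_sym mulf_eq0 invr_eq0 !gt_eqF.
have nn : n != 0 by rewrite gt_eqF.
have EU : U = F / n * u by rewrite -E divfK.
have EI : I = F * u.
  apply/eqP; rewrite eq_le h2 /=; apply: le_trans h1.
  by rewrite EU (_ : n * _ = F * u) //; field.
split=> //.
- by field.
- by rewrite EU; field; apply/andP.
- by rewrite EI EU; field; apply/andP.
Qed.

Lemma equality_arith2 (F I c u : R) : F ^+ 2 = c ^+ 2 * u ^+ 2 -> I = c * u ^+ 2 ->
  F ^+ 2 - 2 * (c * I) + c ^+ 2 * u ^+ 2 = 0.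
Proof. by move=> -> ->; ring. Qed.

Lemma ratio_mono_Vnrm s0 : s0 < sigma1 ->
  (forall s, sigma0 < s < sigma1 -> nrm L (w0 s) != 0) ->
  (forall s t, sigma0 < s -> s <= t -> t < sigma1 ->
     Vnrm L (w0 s) ^+ 2 / nrm L (w0 s) <= Vnrm L (w0 t) ^+ 2 / nrm L (w0 t)) ->
  forall s, sigma0 < s -> s <= s0 -> Vnrm L (w0 s) ^+ 2 <= Vnrm L (w0 s0) ^+ 2.
Proof.
move=> s1 wn hr s ss ss0.
have n0 : nrm L (w0 s) != 0 by apply: wn; rewrite ss (le_lt_trans ss0).
have n1 : nrm L (w0 s0) != 0 by apply: wn; rewrite s1 (lt_le_trans ss).
exact: ratio_arith n0 n1 (nrm_ge0 L _) (nrm_ge0 L _) (sqr_ge0 _) (hr s s0 ss ss0 s1) (hmono ss ss0 s1).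
Qed.

(** By the assumption [nu ||u||^2 = |f| |u|], so the energy inequality and Cauchy-Schwarz bound
    [(f, u)] by the same number from both sides; then [|f - nu lambda0 u|^2] expands to 0. *)
Lemma equality_case u : V L u -> nu * Vnrm L u ^+ 2 <= ip L f u ->
  Vnrm L u ^+ 2 / nrm L u = nrm L f / nu ->
  let lambda0 := Vnrm L u ^+ 2 / nrm L u ^+ 2 in
  [/\ forall k, ip L f (eb k) = nu * lambda0 * ip L u (eb k),
      nu * Vnrm L u ^+ 2 = nu * lambda0 * nrm L u ^+ 2 &
      nrm L f ^+ 2 = (nu * lambda0) ^+ 2 * nrm L u ^+ 2].
Proof.
move=> Vu hE E l0; have Lu := V_L2 Vu.
have hcs := cauchy_schwarz_le f_L2 Lu.
have [un E1 E2 Ei] := equality_arith hnu hf0 E hE hcs.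
split=> // k; have Lk := L2_eb hL k; have Lcu := L2Z (nu * l0) Lu.
rewrite -ipZl //; apply: nrmB_eq0_ip => //; first exact: f_L2.
apply/eqP; rewrite -sqrf_eq0 (nrmB_sqr f_L2 Lcu) (ipZr _ Lu f_L2) nrmZ // exprMn.
by apply/eqP; rewrite real_normK ?num_real //; exact: equality_arith2 E2 Ei.
Qed.

Lemma equality_eigenvector s0 : 3 * cL * G < N%:R -> sigma0 < s0 < sigma1 ->
  (forall s, sigma0 < s < sigma1 -> nrm L (w0 s) != 0) ->
  (forall s t, sigma0 < s -> s <= t -> t < sigma1 ->
     Vnrm L (w0 s) ^+ 2 / nrm L (w0 s) <= Vnrm L (w0 t) ^+ 2 / nrm L (w0 t)) ->
  Vnrm L (v0 s0 + w0 s0) ^+ 2 / nrm L (v0 s0 + w0 s0) = nrm L f / nu ->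
  let lambda0 := Vnrm L (v0 s0 + w0 s0) ^+ 2 / nrm L (v0 s0 + w0 s0) ^+ 2 in
  [/\ eigenvector L lambda0 f, (N%:R * k0) ^+ 2 < lambda0 & eqO L f (QN L N f)].
Proof.
move=> hN1 hs0 wn hr; have p1 := cutoff_eq1 hN1 hs0.
rewrite -(Utr_eq p1); set u := Utr s0 => E l0.
have [ss0 s0s] := andP hs0; have Vu : V L u by exact: Utr_V.
have hE : nu * Vnrm L u ^+ 2 <= ip L f u.
  apply: le_trans (energy_ineq hs0); apply: eq_ler.
  rewrite [phi s0]p1 mul1r -mulrDr; congr (_ * _).
  by apply: (etrans (Vnrm_Utr_sqr s0)); rewrite [phi s0]p1 expr1n mul1r.
have [fu E1 E2] := equality_case Vu hE E.
have hphi s : sigma0 < s -> s <= s0 -> phi s = 1.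
  by move=> ss sl; apply: cutoff_eq1 => //; rewrite ss (le_lt_trans sl).
have hV := ratio_mono_Vnrm s0s wn hr.
have hvar := variational_ineq ss0 hphi hV.
have hu := coef_of_variational Vu fu E1 E2 hvar.
have ul k : k != 0 -> lam k * ip L u (eb k) = l0 * ip L u (eb k).
  move=> kn0; apply: (mulfI (lt0r_neq0 hnu)).
  apply: (etrans (mulrA _ _ _)); apply: (etrans (hu k kn0)); exact: (esym (mulrA nu l0 _)).
(* As [w0] does not vanish at [s0], some mode beyond N is present in u; its eigenvalue must be [l0],
   which gives the lower bound on [l0]. *)
have [k [kn0 kN uk]] : exists k, [/\ k != 0, k \notin modes N & ip L u (eb k) != 0].
  apply: contrapT => hex; have /eqP := wn _ hs0; apply.
  apply: (H_coef_eq0 hL (w_H s0)) => k kn0; apply: contrapT => /eqP wk; apply: hex.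
  have kN : k \notin modes N.
    by apply/negP => kN; move/eqP: wk; apply; exact: cb_low.
  exists k; split=> //; apply: contraNN wk => /eqP uk; apply/eqP.
  by move: uk; rewrite Utr_coef ca_high // mulr0 add0r.
have lk : l0 = lam k by exact: (mulIf uk (esym (ul k kn0))).
have l0N : (k0 * N%:R) ^+ 2 < l0.
  by move: kN; rewrite (mem_modes_lam hL) kn0 /= -ltNge -lk.
have fl j : j != 0 -> lam j * ip L f (eb j) = l0 * ip L f (eb j).
  move=> jn0; rewrite fu -/l0 mulrCA ul //; exact: mulrCA.
split.
- split=> //; first by rewrite gt_eqF.
  apply/is_A_coef => //; split=> //; first exact: HZ.
  by move=> j jn0; rewrite ipZl ?fl //; [exact: f_L2|exact: L2_eb].
- by rewrite mulrC.
(* The coefficients of f in [modes N] vanish, because their eigenvalues are smaller than [l0]. *)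
have [] := @QNH_intro R L hL N f hf _; last by [].
move=> j jN; have jn0 := modes_neq0 jN.
move: jN; rewrite (mem_modes_lam hL) jn0 /= => jl.
apply/eqP; apply: contraT => fj; have := mulIf fj (fl j jn0) => lj.
by move: (le_lt_trans jl l0N); rewrite lj ltxx.
Qed.

End Solution.

Theorem lemma10p1 (R : realType) (nu L cA cB cL cT : R) (N : nat)
    (f : vfield R) (v0 w0 : R -> vfield R) (sigma0 sigma1 : R)
    (hnu : 0 < nu) (hL : 0 < L) (hN : (0 < N)%N)
    (hc : absolute_constants cA cB cL cT)
    (hf : H L f) (hf0 : 0 < nrm L f)
    (hN1 : 3 * cL * Grashof nu L f < N%:R)
    (hN2 : Grashof nu L f * (9 + beta nu L cL cT N f) * (cA + cL) < N%:R)
    (hv0 : X L N v0) (hw0 : is_W nu L N f v0 w0)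
    (heqv : forall s, eqO L (nu *: A L (v0 s))
              (PN L N f - PNB L N (trunc nu L f v0 s + w0 s)))
    (heqw : weak_eq nu L N f v0 w0)
    (hsigma : sigma0 < sigma1)
    (hmono : forall s t, sigma0 < s -> s <= t -> t < sigma1 ->
               nrm L (w0 s) <= nrm L (w0 t)) :
  let u0 := fun s => v0 s + w0 s in
  (forall s, sigma0 < s < sigma1 ->
     nu * Vnrm L (u0 s) ^+ 2 <= nrm L f * nrm L (u0 s)) /\
  ((forall s, sigma0 < s < sigma1 -> nrm L (w0 s) != 0) ->
   (forall s t, sigma0 < s -> s <= t -> t < sigma1 ->
      Vnrm L (w0 s) ^+ 2 / nrm L (w0 s) <= Vnrm L (w0 t) ^+ 2 / nrm L (w0 t)) ->
   forall s0, sigma0 < s0 < sigma1 ->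
     Vnrm L (u0 s0) ^+ 2 / nrm L (u0 s0) = nrm L f / nu ->
     let lambda0 := Vnrm L (u0 s0) ^+ 2 / nrm L (u0 s0) ^+ 2 in
     [/\ eigenvector L lambda0 f,
         (N%:R * kappa0 L) ^+ 2 < lambda0 &
         eqO L f (QN L N f)]).
Proof.
split=> [s hs|wn hr s0 hs0 E].
  exact: (energy_bound hnu hL hN hc hf hf0 hv0 hw0 heqv heqw hmono hN1 hs).
exact: (equality_eigenvector hnu hL hN hc hf hf0 hv0 hw0 heqv heqw hmono hN1 hs0 wn hr E).
Qed.
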